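(* Let $(R,\mathfrak m,K)$ be a local ring of Krull dimension $d$ and let $\{M_n\}_n$ be a weakly lim Cohen-Macaulay sequence of $R$-modules for which rank is defined (the rank is then nonzero, since every $M_n$ has dimension $d$). Then, for every system of parameters $\underline x$ of $R$, $$\lim_{n\to\infty}\frac{\ell(H_0(\underline x;M_n))}{\operatorname{rank}(M_n)}=e(\underline x;R).$$ Hence, for every system of parameters $\underline x$ for $R$ there is a positive real constant $C_{\underline x}$ such that for all $n$, $$1\le\frac{\nu(M_n)}{\operatorname{rank}(M_n)}\le\frac{\ell(H_0(\underline x;M_n))}{\operatorname{rank}(M_n)}\le C_{\underline x}.$$
   Context: A local ring $(R,\mathfrak m,K)$ is Noetherian. $\ell$ is length, $\nu(M)=\dim_K(K\otimes_RM)$, $H_i(\underline x;M)$ is Koszul homology (so $H_0(\underline x;M)=M/(\underline x)M$), and $e(\underline x;R)$ is the Hilbert-Samuel multiplicity of $R$ with respect to the ideal $(\underline x)R$. For a system of parameters $\underline x=x_1,\dots,x_d$, $\chi_1(\underline x;M)=\sum_{i=1}^d(-1)^{i-1}\ell(H_i(\underline x;M))$. A sequence $\{M_n\}_n$ of finitely generated $R$-modules of Krull dimension $d=\dim R$ is weakly lim Cohen-Macaulay if for every system of parameters $\underline x$ of $R$, $\lim_{n\to\infty}\chi_1(\underline x;M_n)/\nu(M_n)=0$. A finitely generated $R$-module $M$ has rank $r$ (written $\operatorname{rank}(M)=r$) if $\ell_{R_{\mathfrak p}}(M_{\mathfrak p})=r\,\ell_{R_{\mathfrak p}}(R_{\mathfrak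 p})$ for every minimal prime $\mathfrak p$ of $R$ with $\dim(R/\mathfrak p)=\dim R$; when $R$ is a domain this is the torsion-free rank and is always defined. *)

(* Defs.v *)
From HB Require Import structures.
From mathcomp Require Import all_boot all_order all_algebra.
From mathcomp Require Import generic_quotient ring_quotient.
From mathcomp Require Import ring.
From mathcomp Require Import boolp classical_sets reals ereal topology normedtype sequences.

Set Implicit Arguments.
Unset Strict Implicit.
Unset Printing Implicit Defensive.

Import GRing.Theory numFieldNormedType.Exports.
Local Open Scope ring_scope.
Local Open Scope quotient_scope.

Definition strict_sub (T : Type) (A B : {pred T}) : Prop :=
  {subset A <= B} /\ ~ {subset B <= A}.

(* The supremum of all k for which there is a chain c 0 < c 1 < ... < c k of
   subsets satisfying P; it is -oo when no subset satisfies P. *)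
Definition chain_sup (F : realType) (T : Type) (P : {pred T} -> Prop) : \bar F :=
  ereal_sup [set (k%:R : F)%:E | k in [set k : nat |
    exists c : nat -> {pred T},
      (forall i, (i <= k)%N -> P (c i)) /\
      (forall i, (i < k)%N -> strict_sub (c i) (c i.+1))]]%classic.

(* The length of V, +oo if infinite. *)
Definition mlength (F : realType) (A : comNzRingType) (V : lmodType A) : \bar F :=
  chain_sup F (fun N : {pred V} => submod_closed N).

Definition prime_ideal (A : comNzRingType) (P : {pred A}) : Prop :=
  idealr_closed P /\ prime_idealr_closed P.

Definition krull_dim (F : realType) (A : comNzRingType) : \bar F :=
  chain_sup F (@prime_ideal A).

(* dim V is the dimension of A / Ann V; the primes of that ring are the primes
   of A that contain Ann V. *)
Definition mod_dim (F : realType) (A : comNzRingType) (V : lmodType A) : \bar F :=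
  chain_sup F (fun P : {pred A} =>
    prime_ideal P /\ forall a, (forall v : V, a *: v = 0) -> a \in P).

Section Span.
Variables (A : comNzRingType) (V : lmodType A).

Definition lspan (k : nat) (v : 'I_k -> V) : {pred V} :=
  fun y => `[< exists c : 'I_k -> A, y = \sum_i c i *: v i >].

Definition fin_gen (N : {pred V}) : Prop :=
  exists (k : nat) (v : 'I_k -> V), N =i lspan v.

Lemma lspan_closed k (v : 'I_k -> V) : submod_closed (lspan v).
Proof.
split=> [|a y z]; rewrite !unfold_in.
  by apply/asboolP; exists (fun=> 0); rewrite big1 // => i _; rewrite scale0r.
move=> /asboolP[c ->] /asboolP[e ->]; apply/asboolP; exists (fun i => a * c i + e i).
rewrite scaler_sumr -big_split /=; apply: eq_bigr => i _.
by rewrite scalerDl scalerA.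
Qed.

HB.instance Definition _ k (v : 'I_k -> V) :=
  GRing.isSubmodClosed.Build A V (lspan v) (lspan_closed v).

(* I N: the submodule generated by the products a *: v, a in I, v in N. *)
Definition ideal_smul (I : {pred A}) (N : {pred V}) : {pred V} :=
  fun y => `[< exists (k : nat) (a : 'I_k -> A) (v : 'I_k -> V),
    (forall i, a i \in I /\ v i \in N) /\ y = \sum_i a i *: v i >].

Lemma ideal_smul_closed (I : {pred A}) (N : submodClosed V) :
  submod_closed (ideal_smul I N).
Proof.
split=> [|b y z]; rewrite !unfold_in.
  apply/asboolP; exists 0%N, (fun=> 0), (fun=> 0).
  by split=> [[]//|]; rewrite big_ord0.
move=> /asboolP[k [a [v [avP ->]]]] /asboolP[l [a' [v' [avP' ->]]]]; apply/asboolP.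
exists (k + l)%N,
  (fun i => match fintype.split i with inl i => a i | inr j => a' j end),
  (fun i => match fintype.split i with inl i => b *: v i | inr j => v' j end).
split=> [i|].
  case: (fintype.split i) => j; last exact: avP'.
  by have [aI vN] := avP j; split=> //; apply: rpredZ.
rewrite big_split_ord scaler_sumr /=; congr (_ + _); apply: eq_bigr => i _.
  by rewrite (unsplitK (inl i)) !scalerA mulrC.
by rewrite (unsplitK (inr i)).
Qed.

HB.instance Definition _ (I : {pred A}) (N : submodClosed V) :=
  GRing.isSubmodClosed.Build A V (ideal_smul I N) (ideal_smul_closed I N).

Definition whole : {pred V} := predT.
Lemma whole_closed : submod_closed whole. Proof. by []. Qed.
HB.instance Definition _ := GRing.isSubmodClosed.Build A V whole whole_closed.

End Span.
Arguments whole {A} V.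

(* The submodules of the regular module A^o are the ideals of A, the unit ideal
   included. *)
Definition noetherian (A : comNzRingType) : Prop :=
  forall I : {pred A^o}, submod_closed I -> fin_gen I.

Definition gen_ideal (A : comNzRingType) (k : nat) (x : 'I_k -> A) : {pred A} :=
  lspan (x : 'I_k -> A^o).

Definition local_ring (A : comNzRingType) (m : idealr A) : Prop :=
  forall I : idealr A, {subset I <= m}.

Fixpoint ideal_exp (A : comNzRingType) (I : {pred A}) (n : nat) : submodClosed A^o :=
  if n is n'.+1 then ideal_smul I (ideal_exp I n') : submodClosed A^o
  else whole A^o : submodClosed A^o.

Section SubQuot.
Variables (A : comNzRingType) (V : lmodType A).

Definition submod (N : submodClosed V) := {v : V | v \in N}.
HB.instance Definition _ (N : submodClosed V) := SubChoice.on (submod N).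

Definition zpred (N : submodClosed V) : {pred V} := N.
Lemma zpred_closed (N : submodClosed V) : submod_closed (zpred N).
Proof. exact: submodClosedP. Qed.
HB.instance Definition _ (N : submodClosed V) :=
  GRing.isSubmodClosed.Build A V (zpred N) (zpred_closed N).
HB.instance Definition _ (N : submodClosed V) :=
  [SubChoice_isSubLmodule of submod N by <:].

Definition quotmod (N : submodClosed V) := {ideal_quot (zpred N)}.
HB.instance Definition _ (N : submodClosed V) := GRing.Zmodule.on (quotmod N).

Section QuotLmodule.
Variable N : submodClosed V.

Definition quotmod_pi (v : V) : quotmod N := \pi_{ideal_quot (zpred N)} v.

Lemma quotmod_piP (x : quotmod N) : exists v, x = quotmod_pi v.
Proof. by exists (repr x); rewrite /quotmod_pi reprK. Qed.

Lemma eq_quotmod (x y : V) : (quotmod_pi x == quotmod_pi y) = (x - y \in N).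
Proof. exact: (esym (Quotient.idealrBE (zpred N) x y)). Qed.

Lemma quotmod_pi_zmod : zmod_morphism quotmod_pi.
Proof. by move=> x y; rewrite /quotmod_pi raddfB. Qed.
HB.instance Definition _ :=
  GRing.isZmodMorphism.Build V (quotmod N) quotmod_pi quotmod_pi_zmod.

Definition quotmod_scale (a : A) (x : quotmod N) : quotmod N :=
  quotmod_pi (a *: repr (x : {ideal_quot (zpred N)})).

Lemma quotmod_scaleE a (v : V) : quotmod_scale a (quotmod_pi v) = quotmod_pi (a *: v).
Proof.
apply/eqP; rewrite eq_quotmod -scalerBr; apply: rpredZ.
by rewrite -eq_quotmod /quotmod_pi reprK.
Qed.

Fact quotmod_scaleA a b (x : quotmod N) :
  quotmod_scale a (quotmod_scale b x) = quotmod_scale (a * b) x.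
Proof.
have [v ->] := quotmod_piP x.
by rewrite (quotmod_scaleE b) !quotmod_scaleE scalerA.
Qed.
Fact quotmod_scale1 : left_id 1 quotmod_scale.
Proof. by move=> x; have [v ->] := quotmod_piP x; rewrite quotmod_scaleE scale1r. Qed.
Fact quotmod_scaleDr : right_distributive quotmod_scale +%R.
Proof.
move=> a x y; have [v ->] := quotmod_piP x; have [w ->] := quotmod_piP y.
by rewrite -raddfD !quotmod_scaleE scalerDr raddfD.
Qed.
Fact quotmod_scaleDl x : {morph quotmod_scale^~ x : a b / a + b}.
Proof.
by move=> a b /=; have [v ->] := quotmod_piP x; rewrite !quotmod_scaleE scalerDl raddfD.
Qed.
HB.instance Definition _ := GRing.Zmodule_isLmodule.Build A (quotmod N)
  quotmod_scaleA quotmod_scale1 quotmod_scaleDr quotmod_scaleDl.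

Lemma quotmod_pi_scalable : scalable quotmod_pi.
Proof. by move=> a v; rewrite -quotmod_scaleE. Qed.
HB.instance Definition _ :=
  GRing.isScalable.Build A V (quotmod N) *:%R quotmod_pi quotmod_pi_scalable.
End QuotLmodule.

End SubQuot.

Section Subquotient.
Variables (A : comNzRingType) (V : lmodType A) (Z B : submodClosed V).

Definition sub_restrict : {pred submod Z} := fun z => val z \in B.
Lemma sub_restrict_closed : submod_closed sub_restrict.
Proof.
have E z : (z \in sub_restrict) = (val z \in B) by [].
split=> [|a u v]; rewrite !E; first by rewrite raddf0 rpred0.
by move=> uB vB; rewrite linearP rpredD ?rpredZ.
Qed.
HB.instance Definition _ :=
  GRing.isSubmodClosed.Build A (submod Z) sub_restrict sub_restrict_closed.

(* The image of Z in the quotient by B, that is Z / B when B is contained in Z. *)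
Definition subquot := quotmod sub_restrict.
HB.instance Definition _ := GRing.Lmodule.on subquot.
End Subquotient.

Section Localization.
Variables (A : comNzRingType) (p : prime_idealr A).

Definition denom := {s : A | s \notin p}.
HB.instance Definition _ := Choice.on denom.

Definition dval (s : denom) : A := sval s.
Arguments dval : simpl never.

Lemma denom1_subproof : 1 \notin p. Proof. by rewrite idealr1. Qed.
Definition denom1 : denom := exist _ 1 denom1_subproof.
Lemma denomM_subproof (s t : denom) : dval s * dval t \notin p.
Proof. by rewrite prime_idealrM negb_or (svalP s) (svalP t). Qed.
Definition denomM (s t : denom) : denom := exist _ (dval s * dval t) (denomM_subproof s t).

Lemma dval1 : dval denom1 = 1. Proof. by []. Qed.
Lemma dvalM s t : dval (denomM s t) = dval s * dval t. Proof. by []. Qed.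

Section Module.
Variable V : lmodType A.

Definition fracs := (V * denom)%type.
HB.instance Definition _ := Choice.on fracs.

Definition frac_eq (x y : fracs) : bool :=
  `[< exists t : denom, dval t *: (dval y.2 *: x.1) = dval t *: (dval x.2 *: y.1) >].

Lemma frac_eq_equiv : equiv_class_of frac_eq.
Proof.
split=> [x|x y|y x z].
- by apply/asboolP; exists denom1.
- by apply/asboolP/asboolP => -[t tE]; exists t.
- move=> /asboolP[t tE] /asboolP[u uE]; apply/asboolP.
  exists (denomM (denomM t u) y.2); rewrite !dvalM.
  transitivity ((dval u * dval z.2) *: (dval t *: (dval y.2 *: x.1))).
    by rewrite !scalerA; congr (_ *: _); ring.
  rewrite tE; transitivity ((dval t * dval x.2) *: (dval u *: (dval z.2 *: y.1))).
    by rewrite !scalerA; congr (_ *: _); ring.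
  by rewrite uE !scalerA; congr (_ *: _); ring.
Qed.
Canonical frac_equiv := EquivRelPack frac_eq_equiv.

(* V_p, the module of fractions v / s with s outside p. *)
Definition locmod := {eq_quot frac_equiv}.
HB.instance Definition _ := Choice.on locmod.

Definition locfrac (v : V) (s : denom) : locmod := \pi_{eq_quot frac_equiv} (v, s).

Lemma eq_locfrac v s w t : locfrac v s = locfrac w t <->
  exists u : denom, dval u *: (dval t *: v) = dval u *: (dval s *: w).
Proof.
split=> [/eqP|H]; first by rewrite /locfrac piE => /asboolP.
by apply/eqP; rewrite /locfrac piE; apply/asboolP.
Qed.

Lemma locfracP (x : locmod) : exists v s, x = locfrac v s.
Proof.
by exists (repr x).1, (repr x).2; rewrite /locfrac -surjective_pairing reprK.
Qed.

Lemma locfrac_repr v s (x := repr (locfrac v s)) :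
  exists u : denom, dval u *: (dval s *: x.1) = dval u *: (dval x.2 *: v).
Proof. by apply/eq_locfrac; rewrite /locfrac -surjective_pairing reprK. Qed.

Definition loc_zero : locmod := locfrac 0 denom1.
Definition loc_opp (x : locmod) : locmod := locfrac (- (repr x).1) (repr x).2.
Definition loc_add (x y : locmod) : locmod :=
  locfrac (dval (repr y).2 *: (repr x).1 + dval (repr x).2 *: (repr y).1)
          (denomM (repr x).2 (repr y).2).

Lemma loc_oppE v s : loc_opp (locfrac v s) = locfrac (- v) s.
Proof.
have [u uE] := locfrac_repr v s; apply/eq_locfrac; exists u.
by rewrite !scalerN uE.
Qed.

Lemma loc_addE v s w t : loc_add (locfrac v s) (locfrac w t) =
  locfrac (dval t *: v + dval s *: w) (denomM s t).
Proof.
have := locfrac_repr v s; have := locfrac_repr w t; rewrite /loc_add.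
case: (repr (locfrac v s)) => v' s'; case: (repr (locfrac w t)) => w' t' /=.
move=> [b bE] [a aE]; apply/eq_locfrac; exists (denomM a b); rewrite !dvalM.
rewrite !scalerDr; congr (_ + _).
  transitivity ((dval b * dval t * dval t') *: (dval a *: (dval s *: v'))).
    by rewrite !scalerA; congr (_ *: _); ring.
  by rewrite aE !scalerA; congr (_ *: _); ring.
transitivity ((dval a * dval s * dval s') *: (dval b *: (dval t *: w'))).
  by rewrite !scalerA; congr (_ *: _); ring.
by rewrite bE !scalerA; congr (_ *: _); ring.
Qed.

Fact loc_addA : associative loc_add.
Proof.
move=> x y z; have [v [s ->]] := locfracP x; have [w [t ->]] := locfracP y.
have [k [r ->]] := locfracP z.
rewrite (loc_addE w t) (loc_addE v s) (loc_addE v s w) loc_addE.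
apply/eq_locfrac; exists denom1; rewrite ?dvalM ?dval1; rewrite !scalerDr !scalerA addrA.
by congr (_ *: _ + _ *: _ + _ *: _); ring.
Qed.
Fact loc_addC : commutative loc_add.
Proof.
move=> x y; have [v [s ->]] := locfracP x; have [w [t ->]] := locfracP y.
rewrite (loc_addE v) (loc_addE w) addrC.
apply/eq_locfrac; exists denom1; rewrite ?dvalM ?dval1; rewrite !scalerDr !scalerA.
by congr (_ *: _ + _ *: _); ring.
Qed.
Fact loc_add0 : left_id loc_zero loc_add.
Proof.
move=> x; have [v [s ->]] := locfracP x; rewrite /loc_zero loc_addE.
apply/eq_locfrac; exists denom1; rewrite ?dvalM ?dval1.
by rewrite scaler0 add0r !scalerA; congr (_ *: _); ring.
Qed.
Fact loc_addN : left_inverse loc_zero loc_opp loc_add.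
Proof.
move=> x; have [v [s ->]] := locfracP x; rewrite loc_oppE loc_addE.
apply/eq_locfrac; exists denom1; rewrite ?dvalM ?dval1.
by rewrite scalerN addNr !scaler0.
Qed.
HB.instance Definition _ := GRing.isZmodule.Build locmod
  loc_addA loc_addC loc_add0 loc_addN.

Lemma locfracD v s w t : locfrac v s + locfrac w t =
  locfrac (dval t *: v + dval s *: w) (denomM s t).
Proof. exact: loc_addE. Qed.

End Module.
Arguments locfrac {V}.

(* (a / s) (v / t) = (a v) / (s t); for V = A^o this is the product of A_p. *)
Definition loc_act (V : lmodType A) (x : locmod A^o) (y : locmod V) : locmod V :=
  locfrac (((repr x).1 : A) *: (repr y).1) (denomM (repr x).2 (repr y).2).

Lemma loc_actE (V : lmodType A) (a : A) s (v : V) t :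
  loc_act (locfrac (a : A^o) s) (locfrac v t) = locfrac (a *: v) (denomM s t).
Proof.
have := @locfrac_repr A^o a s; have := locfrac_repr v t; rewrite /loc_act.
case: (repr (@locfrac A^o a s)) => a' s'; case: (repr (locfrac v t)) => v' t' /=.
move=> [b bE] [c cE]; apply/eq_locfrac; exists (denomM b c); rewrite !dvalM.
have {}cE : dval c * (dval s * a') = dval c * (dval s' * a) := cE.
transitivity ((dval c * (dval s * a')) *: (dval b *: (dval t *: v'))).
  by rewrite !scalerA; congr (_ *: _); ring.
by rewrite bE cE !scalerA; congr (_ *: _); ring.
Qed.

Definition loc_one : locmod A^o := locfrac (1 : A^o) denom1.

Section ActTheory.
Variable V : lmodType A.
Fact loc_actA (x y : locmod A^o) (z : locmod V) :
  loc_act x (loc_act y z) = loc_act (loc_act x y) z.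
Proof.
have [a [s ->]] := locfracP x; have [b [t ->]] := locfracP y.
have [v [r ->]] := locfracP z.
rewrite (loc_actE b t) (loc_actE a s) (loc_actE a s) loc_actE.
apply/eq_locfrac; exists denom1; rewrite ?dvalM ?dval1; rewrite !scalerA.
by congr (_ *: _); rewrite -[(a *: b : A^o)]/(a * b : A); ring.
Qed.
Fact loc_act1 (z : locmod V) : loc_act loc_one z = z.
Proof.
have [v [r ->]] := locfracP z; rewrite /loc_one loc_actE scale1r.
by apply/eq_locfrac; exists denom1; rewrite ?dvalM ?dval1; rewrite !scalerA; congr (_ *: _); ring.
Qed.
Fact loc_actDr (x : locmod A^o) (y z : locmod V) :
  loc_act x (y + z) = loc_act x y + loc_act x z.
Proof.
have [a [s ->]] := locfracP x; have [v [t ->]] := locfracP y.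
have [w [r ->]] := locfracP z.
rewrite (locfracD v) (loc_actE a s v) (loc_actE a s w) loc_actE locfracD.
apply/eq_locfrac; exists denom1; rewrite ?dvalM ?dval1; rewrite !scalerDr !scalerA.
by congr (_ *: _ + _ *: _); ring.
Qed.
Fact loc_actDl (x y : locmod A^o) (z : locmod V) :
  loc_act (x + y) z = loc_act x z + loc_act y z.
Proof.
have [a [s ->]] := locfracP x; have [b [t ->]] := locfracP y.
have [v [r ->]] := locfracP z.
rewrite (locfracD a) (loc_actE a s v) (loc_actE b t v) loc_actE locfracD.
apply/eq_locfrac; exists denom1; rewrite ?dvalM ?dval1.
rewrite scalerDl !scalerDr !scalerA.
rewrite -[(dval t *: a : A^o)]/(dval t * a : A) -[(dval s *: b : A^o)]/(dval s * b : A).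
by congr (_ *: _ + _ *: _); ring.
Qed.
End ActTheory.

Definition locring := locmod A^o.
HB.instance Definition _ := GRing.Zmodule.on locring.

Fact loc_actC : commutative (@loc_act A^o).
Proof.
move=> x y; have [a [s ->]] := locfracP x; have [b [t ->]] := locfracP y.
rewrite (loc_actE a s) (loc_actE b t); apply/eq_locfrac; exists denom1; rewrite ?dvalM ?dval1.
rewrite !scalerA -[LHS]/((1 * (dval t * dval s) * a) * b : A).
by rewrite -[RHS]/((1 * (dval s * dval t) * b) * a : A); ring.
Qed.
Fact loc_one_neq0 : loc_one != 0 :> locring.
Proof.
apply/eqP => /eq_locfrac[t /=]; rewrite !scaler0.
rewrite -[LHS]/(dval t * (1 * 1)) !mulr1 => t0.
by have := svalP t; rewrite -/(dval t) t0 idealr0.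
Qed.
HB.instance Definition _ := GRing.Zmodule_isComNzRing.Build locring
  (@loc_actA A^o) loc_actC (@loc_act1 A^o) (fun x y z => @loc_actDl A^o x y z)
  loc_one_neq0.

HB.instance Definition _ (V : lmodType A) :=
  GRing.Zmodule_isLmodule.Build locring (locmod V)
    (@loc_actA V) (@loc_act1 V) (@loc_actDr V) (fun z x y => @loc_actDl V x y z).

End Localization.

Section ResidueFibre.
Variables (A : comNzRingType) (I : idealr A) (V : lmodType A).

(* (A / I) tensor V, realized as V / I V with its A / I-module structure. *)
Definition fibre := quotmod (ideal_smul I (whole V)).
HB.instance Definition _ := GRing.Zmodule.on fibre.

Definition fibre_pi (v : V) : fibre := quotmod_pi (ideal_smul I (whole V)) v.

Lemma fibre_piP (x : fibre) : exists v, x = fibre_pi v.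
Proof. exact: quotmod_piP. Qed.

Lemma fibre_piD v w : fibre_pi (v + w) = fibre_pi v + fibre_pi w.
Proof. exact: raddfD. Qed.

Lemma eq_fibre v w : (fibre_pi v == fibre_pi w) = (v - w \in ideal_smul I (whole V)).
Proof. exact: eq_quotmod. Qed.

Definition fibre_scale (k : {ideal_quot I}) (x : fibre) : fibre :=
  fibre_pi (repr k *: repr (x : {ideal_quot (zpred (ideal_smul I (whole V)))})).

Lemma fibre_scaleE (a : A) (v : V) :
  fibre_scale (\pi_{ideal_quot I} a) (fibre_pi v) = fibre_pi (a *: v).
Proof.
rewrite /fibre_scale; set b := repr _; set w := repr _.
have bI : b - a \in I.
  by rewrite Quotient.idealrBE /b reprK.
have wN : w - v \in ideal_smul I (whole V).
  by rewrite -eq_fibre /w /fibre_pi /quotmod_pi reprK.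
apply/eqP; rewrite eq_fibre.
have -> : b *: w - a *: v = b *: (w - v) + (b - a) *: v.
  by rewrite scalerBr scalerBl addrA subrK.
apply: rpredD; first exact: rpredZ.
apply/asboolP; exists 1%N, (fun=> b - a), (fun=> v).
by rewrite big_ord1; split=> // i; split.
Qed.

Fact fibre_scaleA k l (x : fibre) :
  fibre_scale k (fibre_scale l x) = fibre_scale (k * l) x.
Proof.
have [v ->] := fibre_piP x; rewrite -[k]reprK -[l]reprK -rmorphM.
by rewrite (fibre_scaleE (repr l)) !fibre_scaleE scalerA.
Qed.
Fact fibre_scale1 : left_id 1 fibre_scale.
Proof.
move=> x; have [v ->] := fibre_piP x.
by rewrite -(rmorph1 (\pi_{ideal_quot I})) fibre_scaleE scale1r.
Qed.
Fact fibre_scaleDr : right_distributive fibre_scale +%R.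
Proof.
move=> k x y; have [v ->] := fibre_piP x; have [w ->] := fibre_piP y.
by rewrite -[k]reprK -fibre_piD !fibre_scaleE scalerDr fibre_piD.
Qed.
Fact fibre_scaleDl x : {morph fibre_scale^~ x : k l / k + l}.
Proof.
move=> k l /=; have [v ->] := fibre_piP x; rewrite -[k]reprK -[l]reprK -rmorphD.
by rewrite !fibre_scaleE scalerDl fibre_piD.
Qed.
HB.instance Definition _ := GRing.Zmodule_isLmodule.Build {ideal_quot I} fibre
  fibre_scaleA fibre_scale1 fibre_scaleDr fibre_scaleDl.
End ResidueFibre.

Definition is_basis (K : comNzRingType) (W : lmodType K) (k : nat) (w : 'I_k -> W) : Prop :=
  forall y : W, exists! c : {ffun 'I_k -> K}, y = \sum_i c i *: w i.

(* The size of a basis, and 0 if there is no finite basis. *)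
Definition vdim (K : comNzRingType) (W : lmodType K) : nat :=
  xget 0%N [set k : nat | exists w : 'I_k -> W, is_basis w]%classic.

Definition nu (A : comNzRingType) (m : idealr A) (V : lmodType A) : nat :=
  vdim (fibre m V).

Section Koszul.
Variables (A : comNzRingType) (d : nat) (x : 'I_d -> A) (V : lmodType A).

(* The Koszul complex with coefficients in V, all degrees together: f stands for
   the sum over J of f J tensor e_J, so degree i consists of the f supported on
   the J with #|J| = i. *)
Definition koszul := {ffun {set 'I_d} -> V}.
HB.instance Definition _ := GRing.Lmodule.on koszul.

(* e_J is sent to the sum over j in J of (-1)^(number of k in J below j)
   times x_j e_(J minus j). *)
Definition koszul_diff (f : koszul) : koszul :=
  [ffun J : {set 'I_d} => \sum_(j | j \notin J)
     ((-1) ^+ #|[set k in J | (k < j)%N]| * x j) *: f (j |: J)].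

Definition koszul_deg (i : nat) : {pred koszul} :=
  fun f => [forall J : {set 'I_d}, (#|J| != i) ==> (f J == 0)].

Definition koszul_cycles (i : nat) : {pred koszul} :=
  fun f => (f \in koszul_deg i) && (koszul_diff f == 0).

Definition koszul_bounds (i : nat) : {pred koszul} :=
  fun f => `[< exists2 g, g \in koszul_deg i.+1 & f = koszul_diff g >].

Lemma koszul_diffP a (f g : koszul) :
  koszul_diff (a *: f + g) = a *: koszul_diff f + koszul_diff g.
Proof.
apply/ffunP => J; rewrite !ffunE scaler_sumr -big_split /=; apply: eq_bigr => j _.
by rewrite !ffunE scalerDr !scalerA [_ * a]mulrC.
Qed.

Lemma koszul_diff_diff (f : koszul) : koszul_diff (koszul_diff f) = 0.
Proof.
apply/ffunP => J; rewrite !ffunE.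
pose s j := #|[set k in J | (k < j)%N]|.
pose G (j k : 'I_d) : V := ((-1) ^+ (s j + s k) * (x j * x k)) *: f (j |: (k |: J)).
have GC j k : G j k = G k j.
  by rewrite /G finset.setUCA addnC [x j * _]mulrC.
have E (j : 'I_d) : j \notin J ->
  ((-1) ^+ s j * x j) *: koszul_diff f (j |: J) =
  \sum_(k | (k \notin J) && (k != j)) (-1) ^+ (j < k)%N *: G j k.
  move=> jJ; rewrite ffunE scaler_sumr; apply: eq_big => k.
    by rewrite in_setU1 negb_or andbC.
  rewrite in_setU1 negb_or => /andP[kj kJ].
  have -> : #|[set l in j |: J | (l < k)%N]| = ((j < k) + s k)%N.
    case: ltnP => jk.
      have -> : [set l in j |: J | (l < k)%N] = j |: [set l in J | (l < k)%N].
        by apply/setP => l; rewrite !inE; case: eqP => [->|]; rewrite ?jk.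
      by rewrite cardsU1 inE (negbTE jJ).
    congr #|pred_of_set _|; apply/setP => l; rewrite !inE.
    by case: eqP => [->|//]; rewrite ltnNge jk /= andbF.
  rewrite /G finset.setUCA !scalerA !exprD; congr (_ *: _); ring.
under eq_bigr => j jJ do rewrite E //.
rewrite (eq_bigr (fun j : 'I_d =>
    \sum_(k | k \notin J) (if (j < k)%N then - G j k else 0 : V) +
    \sum_(k | k \notin J) (if (k < j)%N then G j k else 0 : V))); last first.
  move=> j jJ; rewrite -big_split /= big_mkcondr /=; apply: eq_bigr => k kJ.
  rewrite -val_eqE /=; case: ltngtP => //= _.
  - by rewrite expr1 scaleN1r addr0.
  - by rewrite expr0 scale1r add0r.
  - by rewrite addr0.
rewrite big_split /= [X in X + _]exchange_big /= -big_split /=.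
rewrite big1 // => j jJ; rewrite -big_split /= big1 // => k kJ.
by rewrite GC; case: ifP => _; rewrite ?addNr ?addr0.
Qed.

Lemma koszul_deg_closed i : submod_closed (koszul_deg i).
Proof.
split=> [|a f g]; first by apply/forallP => J; rewrite ffunE eqxx implybT.
move=> /forallP f0 /forallP g0; apply/forallP => J; apply/implyP => Ji.
rewrite !ffunE (eqP (implyP (f0 J) Ji)) (eqP (implyP (g0 J) Ji)).
by rewrite scaler0 addr0.
Qed.
HB.instance Definition _ i :=
  GRing.isSubmodClosed.Build A koszul (koszul_deg i) (koszul_deg_closed i).

Lemma koszul_diff0 : koszul_diff 0 = 0.
Proof. by apply/ffunP => J; rewrite !ffunE big1 // => j _; rewrite ffunE scaler0. Qed.

Lemma koszul_cycles_closed i : submod_closed (koszul_cycles i).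
Proof.
split=> [|a f g]; first by apply/andP; rewrite rpred0 koszul_diff0.
move=> /andP[fi /eqP f0] /andP[gi /eqP g0]; apply/andP; split.
  by rewrite rpredD ?rpredZ.
by rewrite koszul_diffP f0 g0 scaler0 addr0.
Qed.
HB.instance Definition _ i :=
  GRing.isSubmodClosed.Build A koszul (koszul_cycles i) (koszul_cycles_closed i).

Lemma koszul_bounds_closed i : submod_closed (koszul_bounds i).
Proof.
split=> [|a f g].
  by apply/asboolP; exists 0; rewrite ?rpred0 ?koszul_diff0.
move=> /asboolP[f' fi ->] /asboolP[g' gi ->]; apply/asboolP.
by exists (a *: f' + g'); rewrite ?rpredD ?rpredZ ?koszul_diffP.
Qed.
HB.instance Definition _ i :=
  GRing.isSubmodClosed.Build A koszul (koszul_bounds i) (koszul_bounds_closed i).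

Lemma koszul_bounds_sub i : {subset koszul_bounds i <= koszul_cycles i}.
Proof.
move=> f /asboolP[g /forallP gi ->]; apply/andP; split; last first.
  by rewrite koszul_diff_diff.
apply/forallP => J; apply/implyP => Ji; rewrite ffunE big1 // => j jJ.
have /implyP gJ := gi (j |: J); rewrite (eqP (gJ _)) ?scaler0 //.
by rewrite cardsU1 jJ add1n eqSS.
Qed.

Definition koszul_homology (i : nat) : lmodType A :=
  subquot (koszul_cycles i) (koszul_bounds i).

End Koszul.

(* To be used for d = dim A: the x_i lie in m and (x) is m-primary. *)
Definition is_sop (A : comNzRingType) (m : idealr A) (d : nat) (x : 'I_d -> A) : Prop :=
  (forall i, x i \in m) /\
  (forall y, y \in m -> exists k : nat, y ^+ k \in gen_ideal x).

(* The limit of d! l(A / I^k) / k^d. *)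
Definition hs_mult (F : realType) (A : comNzRingType) (d : nat) (I : {pred A}) : F :=
  lim ((fun k : nat => d`!%:R * fine (mlength F (quotmod (ideal_exp I k))) / k%:R ^+ d)
       @ \oo)%classic.

Definition chi1 (F : realType) (A : comNzRingType) (d : nat) (x : 'I_d -> A)
    (V : lmodType A) : F :=
  \sum_(1 <= i < d.+1) (-1) ^+ i.-1 * fine (mlength F (koszul_homology x V i)).

Definition minimal_prime (A : comNzRingType) (p : prime_idealr A) : Prop :=
  forall q : prime_idealr A, {subset q <= p} -> {subset p <= q}.

Definition has_rank (F : realType) (A : comNzRingType) (V : lmodType A) (r : F) : Prop :=
  forall p : prime_idealr A, minimal_prime p ->
    krull_dim F {ideal_quot p} = krull_dim F A ->
    mlength F (locmod p V) = (r%:E * mlength F (locring p)^o)%E.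

Definition weakly_lim_CM (F : realType) (A : comNzRingType) (m : idealr A) (d : nat)
    (M : nat -> lmodType A) : Prop :=
  (forall n, fin_gen (whole (M n)) /\ mod_dim F (M n) = (d%:R)%:E) /\
  (forall x : 'I_d -> A, is_sop m x ->
    ((fun n => chi1 F x (M n) / (nu m (M n))%:R) @ \oo --> (0 : F))%classic).

(* Main.v *)
(** Let I = (x).  Filter the Koszul complex of V by the subcomplexes with
    I^(n-i) V in degree i.  By Artin-Rees these are acyclic for n large, so the
    Koszul Euler characteristic of V is the d-th difference of the function
    n |-> length (V / I^n V), hence the limit of d! length (V / I^n V) / n^d.
    Artin-Rees also makes this limit additive on short exact sequences, and it
    vanishes on A / p when dim (A / p) < d.  A filtration of V with quotients
    A / p therefore gives chi(x; V) = rank V * e(x; A), and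
    length H_0 = rank V * e(x; A) + chi_1.  As nu <= length H_0, the assumption
    chi_1 / nu -> 0 bounds nu / rank V, so that chi_1 / rank V -> 0.  Finally
    rank V <= nu: V is generated by nu elements, hence so is its localization
    at a minimal prime. *)
Require Import Defs.
From HB Require Import structures.
From mathcomp Require Import all_boot all_order all_algebra.
From mathcomp Require Import generic_quotient ring_quotient.
From mathcomp Require Import boolp classical_sets reals ereal topology normedtype sequences.
From mathcomp Require Import zify ring lra.

Set Implicit Arguments.
Unset Strict Implicit.
Unset Printing Implicit Defensive.

Import Order.TTheory GRing.Theory Num.Theory numFieldNormedType.Exports.
Local Open Scope ring_scope.
Local Open Scope classical_set_scope.

(** * Submodules and their relative lengths *)

(** Lengths are relative lengths [len N P] of nested submodules of one module; quotient types appear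
    only where the statement or the Koszul complex asks for a module. That the d-th difference of
    length (V / I^n V) is eventually constant yields the limit directly, for every finitely
    generated V and so in particular for each A / p.

    The rank enters through a count. In a filtration with quotients A / p, a minimal prime q occurs
    exactly length (V_q) times, and multiplicities see only the primes p with d further primes in a
    chain above p, all of which are minimal. Comparing a filtration of V with one of A at these
    primes turns the count for V into rank V times the count for A.

    The obstacle at the end is that chi_1 is small relative to nu, while the limit divides by the
    rank. With t = nu / rank V and e = e(x; A) one has t <= e + (chi_1 / nu) t; once chi_1 / nu is
    at most 1/2 in absolute value, the last term is absorbed and t <= 2 e. *)

Section Submodules.
Variables (A : comNzRingType) (V : lmodType A).
Implicit Types (N P Q : set V).

(** Sets rather than boolean predicates: sums, images and spans, which are given by existence, are
    then submodules directly. *)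
Definition submodule N := N 0 /\ forall a u v, N u -> N v -> N (a *: u + v).

Definition smsum N P : set V := [set w | exists u v, [/\ N u, P v & w = u + v]].

Lemma submodule0 N : submodule N -> N 0. Proof. by case. Qed.

Lemma submoduleZ N a u : submodule N -> N u -> N (a *: u).
Proof. by move=> [N0 H] Nu; rewrite -[_ *: _]addr0; apply: H. Qed.

Lemma submoduleD N u v : submodule N -> N u -> N v -> N (u + v).
Proof. by move=> [N0 H] Nu Nv; rewrite -[u]scale1r; apply: H. Qed.

Lemma submoduleB N u v : submodule N -> N u -> N v -> N (u - v).
Proof. by move=> [N0 H] Nu Nv; rewrite addrC -scaleN1r; apply: H. Qed.

Lemma submodule_sum N (I : Type) (r : seq I) (p : pred I) (f : I -> V) :
  submodule N -> (forall i, p i -> N (f i)) -> N (\sum_(i <- r | p i) f i).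
Proof.
move=> sN H; elim/big_ind: _ => //; first exact: submodule0.
by move=> *; apply: submoduleD.
Qed.

Lemma submodule1 : submodule [set 0].
Proof. by split=> // a u v -> ->; rewrite /= scaler0 addr0. Qed.

Lemma submoduleT : submodule setT. Proof. by []. Qed.

Lemma submoduleI N P : submodule N -> submodule P -> submodule (N `&` P).
Proof.
move=> [N0 HN] [P0 HP]; split=> [|a u v [Nu Pu] [Nv Pv]]; first by split.
by split; [exact: HN|exact: HP].
Qed.

Lemma submodule_smsum N P : submodule N -> submodule P -> submodule (smsum N P).
Proof.
move=> [N0 HN] [P0 HP]; split=> [|a u v].
  by exists 0, 0; rewrite addr0.
move=> [u1 [u2 [N1 P2 ->]]] [v1 [v2 [Nv Pv ->]]].
exists (a *: u1 + v1), (a *: u2 + v2); split; [exact: HN|exact: HP|].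
by rewrite scalerDr addrACA.
Qed.

Lemma smsumSl N P : submodule P -> N `<=` smsum N P.
Proof. by move=> [P0 _] v Nv; exists v, 0; rewrite addr0. Qed.

Lemma smsumSr N P : submodule N -> P `<=` smsum N P.
Proof. by move=> [P0 _] v Nv; exists 0, v; rewrite add0r. Qed.

Lemma smsum_lub N P Q : submodule Q -> N `<=` Q -> P `<=` Q -> smsum N P `<=` Q.
Proof. by move=> sQ NQ PQ _ [u [v [/NQ ? /PQ ? ->]]]; apply: submoduleD. Qed.

Lemma smsumS N N' P P' : N `<=` N' -> P `<=` P' -> smsum N P `<=` smsum N' P'.
Proof. by move=> NN PP _ [u [v [/NN ? /PP ? ->]]]; exists u, v. Qed.

Lemma smsum_modular N P Q : submodule Q -> N `<=` Q ->
  smsum N P `&` Q `<=` smsum N (P `&` Q).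
Proof.
move=> sQ NQ _ [[u [v [Nu Pv ->]]] Quv]; exists u, v; split=> //; split=> //.
by rewrite -[v](addKr u) addrC; apply: submoduleB => //; apply: NQ.
Qed.

(* [ch k N P]: there is a strictly increasing chain of submodules with k steps
   that starts at a submodule containing N and ends at P. *)
Fixpoint ch (k : nat) N P : Prop :=
  if k is k'.+1 then exists Q, [/\ submodule Q, ch k' N Q, Q `<=` P & ~ P `<=` Q]
  else N `<=` P.

Lemma ch_sub k N P : ch k N P -> N `<=` P.
Proof.
elim: k P => [//|k IH] P [Q [_ /IH NQ QP _]]; exact: subset_trans NQ QP.
Qed.

Lemma ch_top k N P P' : P `<=` P' -> ch k N P -> ch k N P'.
Proof.
case: k => [|k] PP' /=; first by move=> NP; apply: subset_trans PP'.
move=> [Q [sQ c QP PQ]]; exists Q; split=> //; first exact: subset_trans PP'.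
by move=> P'Q; apply: PQ; apply: subset_trans P'Q.
Qed.

Lemma ch_bot k N N' P : N' `<=` N -> ch k N P -> ch k N' P.
Proof.
move=> NN; elim: k P => [|k IH] P /=; first exact: subset_trans.
by move=> [Q [sQ /IH c QP PQ]]; exists Q.
Qed.

Lemma ch_cat a b N Q P : ch a N Q -> ch b Q P -> ch (a + b) N P.
Proof.
move=> cNQ; elim: b P => [|b IH] P /=; first by rewrite addn0 => /ch_top; apply.
by rewrite addnS => -[X [sX /IH c XP PX]]; exists X.
Qed.

(** The inequality behind additivity of length: by the modular law a strict step of the chain stays
    strict after intersecting with Q or after adding Q, so the two induced chains have together at
    least k steps. *)
Lemma ch_split k N P Q : submodule P -> submodule Q -> N `<=` Q -> ch k N P ->
  exists a b, [/\ (k <= a + b)%N, ch a N (P `&` Q) & ch b Q (smsum P Q)].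
Proof.
move=> sP sQ NQ; elim: k P sP => [|k IH] P sP /=.
  move=> NP; exists 0%N, 0%N; split=> //= [v Nv|]; last exact: smsumSr.
  by split; [exact: NP|exact: NQ].
move=> [X [sX /(IH _ sX)[a [b [kab ca cb]]] XP PX]].
have [E|E] := pselect (P `&` Q `<=` X `&` Q); last first.
  exists a.+1, b; split; first by rewrite addSn ltnS.
  - by exists (X `&` Q); split=> //; [exact: submoduleI|exact: setSI].
  - by apply: ch_top cb; apply: smsumS.
exists a, b.+1; split; first by rewrite addnS ltnS.
  by apply: ch_top ca; apply: setSI.
exists (smsum X Q); split=> //; first exact: submodule_smsum.
  exact: smsumS.
move=> H; apply: PX => p Pp; have [x [q [Xx Qq pE]]] := H _ (smsumSl sQ Pp).
have /E[Xq _] : (P `&` Q) q.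
  by split=> //; rewrite -[q](addKr x) -pE addrC; apply: submoduleB => //; apply: XP.
by rewrite pE; apply: submoduleD.
Qed.

Definition haslen N P (k : nat) := ch k N P /\ forall j, ch j N P -> (j <= k)%N.

Definition finlen N P := exists k, haslen N P k.

(* Length of P / N, and 0 if that length is infinite. *)
Definition len N P : nat := xget 0%N [set k | haslen N P k].

Lemma haslen_inj N P j k : haslen N P j -> haslen N P k -> j = k.
Proof. by move=> [cj Hj] [ck Hk]; apply/eqP; rewrite eqn_leq Hk ?Hj. Qed.

Lemma lenP N P : finlen N P -> haslen N P (len N P).
Proof. exact: (@xgetPex _ 0%N [set k | haslen N P k]). Qed.

Lemma lenE N P k : haslen N P k -> len N P = k.
Proof. by move=> H; exact: haslen_inj (lenP (ex_intro _ k H)) H. Qed.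

Lemma haslen_bounded N P n : N `<=` P -> (forall k, ch k N P -> (k <= n)%N) ->
  exists2 k, (k <= n)%N & haslen N P k.
Proof.
move=> NP H.
have ex : exists k, `[< ch k N P >] by exists 0%N; apply/asboolP.
have ub k : `[< ch k N P >] -> (k <= n)%N by move/asboolP/H.
case: (ex_maxnP ex ub) => k /asboolP ck kmax.
by exists k; [exact: H|split=> // j cj; apply: kmax; apply/asboolP].
Qed.

Lemma haslen0 N : submodule N -> haslen N N 0%N.
Proof.
move=> sN; split=> [|[//|k] /= [Q [_ /ch_sub NQ _ NN]]]; first exact: subset_refl.
by case: NN.
Qed.

Lemma haslenD N Q P a b : submodule N -> submodule Q -> submodule P ->
  haslen N Q a -> haslen Q P b -> haslen N P (a + b).
Proof.
move=> sN sQ sP [ca Ha] [cb Hb]; split; first exact: ch_cat ca cb.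
have QP := ch_sub cb; have NQ := ch_sub ca.
move=> k /(ch_split sP sQ NQ)[i [j [kij ci cj]]].
apply: (leq_trans kij); apply: leq_add; [apply: Ha|apply: Hb].
  by apply: ch_top ci; exact: subIsetr.
by apply: ch_top cj; apply: smsum_lub.
Qed.

Lemma haslen_sub N P N' P' k : haslen N P k -> N `<=` N' -> N' `<=` P' -> P' `<=` P ->
  exists2 j, (j <= k)%N & haslen N' P' j.
Proof.
move=> [_ H] NN NP PP; apply: haslen_bounded => // j c; apply: H.
by apply: ch_top PP _; apply: ch_bot c.
Qed.

Lemma finlen_sub N P N' P' : finlen N P -> N `<=` N' -> N' `<=` P' -> P' `<=` P ->
  finlen N' P'.
Proof. by move=> [k H] a b c; have [j _ ?] := haslen_sub H a b c; exists j. Qed.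

Lemma finlen_trans N Q P : submodule N -> submodule Q -> submodule P ->
  finlen N Q -> finlen Q P -> finlen N P.
Proof. by move=> sN sQ sP [a Ha] [b Hb]; exists (a + b)%N; apply: haslenD Ha Hb. Qed.

Lemma len_sub N P N' P' : finlen N P -> N `<=` N' -> N' `<=` P' -> P' `<=` P ->
  (len N' P' <= len N P)%N.
Proof.
by move=> /lenP H a b c; have [j ? /lenE->] := haslen_sub H a b c.
Qed.

Lemma lenD N Q P : submodule N -> submodule Q -> submodule P ->
  N `<=` Q -> Q `<=` P -> finlen N P -> len N P = (len N Q + len Q P)%N.
Proof.
move=> sN sQ sP NQ QP f; apply: lenE; apply: (@haslenD _ Q) => //; apply: lenP.
  by apply: finlen_sub f _ _ _.
by apply: finlen_sub f _ _ _.
Qed.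

Lemma len0 N : submodule N -> len N N = 0%N.
Proof. by move=> sN; apply: lenE; apply: haslen0. Qed.

End Submodules.

(** * Isomorphism theorems for relative lengths *)

Section Transport.
Variables (A B : comNzRingType) (V : lmodType A) (W : lmodType B).

(** What carries chains between N and P to chains above N' with as many steps: inclusions are kept,
    and proper ones stay proper. *)
Definition strict_map (N P : set V) (N' : set W) (phi : set V -> set W) :=
  (forall X, submodule X -> N `<=` X -> X `<=` P -> submodule (phi X) /\ N' `<=` phi X) /\
  (forall X Y, submodule X -> submodule Y -> N `<=` X -> X `<=` Y -> Y `<=` P ->
    phi X `<=` phi Y /\ (phi Y `<=` phi X -> Y `<=` X)).

Lemma ch_map N P N' phi k X : strict_map N P N' phi -> submodule X -> X `<=` P ->
  ch k N X -> ch k N' (phi X).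
Proof.
move=> [H1 H2]; elim: k X => [|k IH] X sX XP /=.
  by move=> NX; have [] := H1 X sX NX XP.
move=> [Q [sQ c QX XQ]]; exists (phi Q).
have QP : Q `<=` P by apply: subset_trans XP.
have NQ := ch_sub c.
have [sub neq] := H2 _ _ sQ sX NQ QX XP.
split=> //; [by have [] := H1 _ sQ NQ QP|exact: IH|].
by move/neq/XQ.
Qed.

End Transport.

(** Each of the two maps carries chains to chains with as many steps, so each length bounds the
    other. *)
Lemma haslen_iso (A B : comNzRingType) (V : lmodType A) (W : lmodType B)
    (N P : set V) (N' P' : set W) phi psi k :
  submodule P -> submodule P' ->
  strict_map N P N' phi -> strict_map N' P' N psi ->
  phi P `<=` P' -> psi P' `<=` P ->
  haslen N P k -> haslen N' P' k.
Proof.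
move=> sP sP' H H' PP' PP [c Hc]; split.
  by apply: ch_top PP' _; apply: ch_map H _ _ c.
move=> j cj; apply: Hc; apply: ch_top PP _.
exact: ch_map H' _ _ cj.
Qed.

Section Isomorphisms.
Variables (A : comNzRingType) (V W : lmodType A).
Implicit Types (N P : set V).

Lemma submodule_image (g : {linear V -> W}) N : submodule N -> submodule (g @` N).
Proof.
move=> sN; split=> [|a _ _ [u Nu <-] [v Nv <-]].
  by exists 0; [exact: submodule0|rewrite linear0].
by exists (a *: u + v); [apply: sN.2|rewrite linearP].
Qed.

Lemma submodule_preimage (g : {linear V -> W}) (N : set W) :
  submodule N -> submodule (g @^-1` N).
Proof.
move=> sN; split=> [|a u v]; rewrite /preimage /= ?linear0; first exact: submodule0.
by move=> Nu Nv; rewrite linearP; apply: sN.2.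
Qed.

(** First isomorphism theorem: the kernel of g on P lies in N, so images, and preimages cut down to
    P, keep proper inclusions proper. *)
Lemma haslen_image (g : {linear V -> W}) N P k : submodule N -> submodule P ->
  N `<=` P -> (forall v, P v -> g v = 0 -> N v) ->
  haslen N P k <-> haslen (g @` N) (g @` P) k.
Proof.
move=> sN sP NP ker.
have sg X : N `<=` X -> submodule X -> X `<=` P -> forall v, P v -> (g @` X) (g v) -> X v.
  move=> NX sX XP v Pv [x Xx xE].
  rewrite -[v](subrK x); apply: submoduleD => //; apply: NX; apply: ker.
    by apply: submoduleB => //; apply: XP.
  by rewrite linearB /= xE subrr.
have s1 : strict_map N P (g @` N) (fun X => g @` X).
  split=> [X sX NX XP|X Y sX sY NX XY YP].
    by split; [exact: submodule_image|exact: image_subset].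
  split; first exact: image_subset.
  move=> H y Yy; apply: sg => //; first exact: subset_trans YP.
    exact: YP.
  by apply: H; exists y.
have s2 : strict_map (g @` N) (g @` P) N (fun Y => g @^-1` Y `&` P).
  split=> [X sX NX XP|X Y sX sY NX XY YP].
    split; first by apply: submoduleI => //; apply: submodule_preimage.
    by move=> v Nv; split; [apply: NX; exists v|exact: NP].
  split; first by apply: setSI; apply: preimage_subset.
  move=> H y Yy; have [p Pp pE] := YP _ Yy.
  have /H[] : (g @^-1` Y `&` P) p by split=> //; rewrite /preimage /= pE.
  by rewrite /preimage /= pE.
have sP' := submodule_image g sP.
split.
  by apply: (haslen_iso _ _ s1 s2) => //; exact: subIsetr.
by apply: (haslen_iso _ _ s2 s1) => //; exact: subIsetr.
Qed.

Lemma haslen_second_iso N P k : submodule N -> submodule P ->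
  haslen (N `&` P) P k <-> haslen N (smsum N P) k.
Proof.
move=> sN sP.
have s1 : strict_map (N `&` P) P N (fun X => smsum N X).
  split=> [X sX NX XP|X Y sX sY NX XY YP].
    by split; [exact: submodule_smsum|exact: smsumSl].
  split; first exact: smsumS.
  move=> H y Yy; have [n [x [Nn Xx yE]]] := H _ (smsumSr sN Yy).
  rewrite yE; apply: submoduleD => //; apply: NX; split=> //.
  rewrite -[n](addrK x) -yE; apply: submoduleB => //; first exact: YP.
  by apply: YP; apply: XY.
have s2 : strict_map N (smsum N P) (N `&` P) (fun X => X `&` P).
  split=> [X sX NX XP|X Y sX sY NX XY YP].
    by split; [exact: submoduleI|exact: setSI].
  split; first exact: setSI.
  move=> H y Yy; have [n [p [Nn Pp yE]]] := YP _ Yy.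
  have /H[Xp _] : (Y `&` P) p.
    split=> //; rewrite -[p](addKr n) -yE addrC; apply: submoduleB => //.
    by apply: XY; apply: NX.
  by rewrite yE; apply: submoduleD => //; apply: NX.
have sNP := submodule_smsum sN sP.
split.
  by apply: (haslen_iso _ _ s1 s2) => //; exact: subIsetr.
by apply: (haslen_iso _ _ s2 s1) => //; exact: subIsetr.
Qed.

End Isomorphisms.

(** * Relative lengths and [mlength] of quotients and subquotients *)

Section LengthOfTypes.
Variables (F : realType) (A : comNzRingType).

Lemma submod_closed_submodule (W : lmodType A) (P : {pred W}) :
  submod_closed P <-> submodule [set x | x \in P].
Proof.
by split=> -[P0 H]; split=> // a u v ? ?; exact: H.
Qed.

Lemma ch_chain (W : lmodType A) k :
  (exists c : nat -> {pred W},
      (forall i, (i <= k)%N -> submod_closed (c i)) /\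
      (forall i, (i < k)%N -> strict_sub (c i) (c i.+1))) <->
  ch k [set (0 : W)] setT.
Proof.
split=> [[c [sc lc]]|].
  suff H j : (j <= k)%N -> ch j [set (0 : W)] [set x | x \in c j].
    exact: ch_top (H k (leqnn k)).
  elim: j => [|j IH] jk /=.
    by move=> _ ->; have /submod_closed_submodule[] := sc 0%N jk.
  exists [set x | x \in c j]; have [s1 s2] := lc j jk; split=> //.
  - by apply/submod_closed_submodule/sc/ltnW.
  - exact/IH/ltnW.
suff H P : submodule P -> ch k [set (0 : W)] P ->
   exists c : nat -> {pred W}, [/\ c k = (fun x => `[< P x >]),
      (forall i, (i <= k)%N -> submod_closed (c i)) &
      (forall i, (i < k)%N -> strict_sub (c i) (c i.+1))].
  by move=> /(H _ (@submoduleT _ _))[c [_ ? ?]]; exists c.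
elim: k P => [|k IH] P sP /=.
  move=> _; exists (fun _ x => `[< P x >]); split=> // i _.
  apply/submod_closed_submodule; have [P0 HP] := sP.
  by split=> [|a u v /asboolP Pu /asboolP Pv]; apply/asboolP => //; exact: HP.
move=> [Q [sQ /(IH _ sQ)[c [ck sc lc]] QP PQ]].
exists (fun i => if (i <= k)%N then c i else fun x => `[< P x >]).
split=> [|i ik|i ik]; first by rewrite ltnn.
  case: ifP => H; first exact: sc.
  apply/submod_closed_submodule; have [P0 HP] := sP.
  by split=> [|a u v /asboolP Pu /asboolP Pv]; apply/asboolP => //; exact: HP.
rewrite -ltnS ik; have := ik; rewrite ltnS leq_eqVlt => /orP[/eqP->|ik'].
  rewrite ltnn ck; split=> [x /asboolP /QP Px|H]; first exact/asboolP.
  by apply: PQ => x Px; apply/asboolP/H/asboolP.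
by rewrite ik'; exact: lc.
Qed.

Lemma mlength_haslen (W : lmodType A) k :
  haslen [set (0 : W)] setT k -> mlength F W = (k%:R : F)%:E.
Proof.
move=> [ck Hk]; apply/eqP; rewrite eq_le; apply/andP; split.
  apply: ge_ereal_sup => _ [j /ch_chain /Hk jk <-].
  by rewrite lee_fin ler_nat.
by apply: ereal_sup_ubound; exists k => //; apply/ch_chain.
Qed.

Lemma mlength_quotmod (V : lmodType A) (N : submodClosed V) k :
  haslen [set v | v \in N] setT k -> mlength F (quotmod N) = (k%:R : F)%:E.
Proof.
move=> H; apply: mlength_haslen.
have sN : submodule [set v | v \in N].
  by apply/submod_closed_submodule; exact: submodClosedP.
have -> : [set (0 : quotmod N)] = quotmod_pi N @` [set v | v \in N].
  apply/seteqP; split=> [_ ->|_ [v Nv <-]] /=.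
    by exists 0; rewrite ?raddf0 //=; exact: rpred0.
  apply/eqP; rewrite -[0](raddf0 (@quotmod_pi _ _ N)) eq_quotmod subr0 //.
have -> : setT = quotmod_pi N @` setT.
  apply/seteqP; split=> // x _; have [v ->] := quotmod_piP x; by exists v.
apply/(haslen_image (g := @quotmod_pi _ _ N)) => // v _ /eqP.
by rewrite -[0](raddf0 (@quotmod_pi _ _ N)) eq_quotmod subr0.
Qed.

Lemma mlength_subquot (V : lmodType A) (Z B : submodClosed V) k :
  {subset B <= Z} ->
  haslen [set v | v \in B] [set v | v \in Z] k ->
  mlength F (subquot Z B) = (k%:R : F)%:E.
Proof.
move=> BZ H; apply: mlength_quotmod.
have sR : submodule [set z : submod Z | z \in sub_restrict B].
  by apply/submod_closed_submodule; exact: sub_restrict_closed.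
apply/(haslen_image (g := (val : submod Z -> V))) => //.
  move=> v _ v0; rewrite /= unfold_in /sub_restrict v0; exact: rpred0.
have <- : [set v | v \in B] =
    (val : submod Z -> V) @` [set z : submod Z | z \in sub_restrict B].
  apply/seteqP; split=> [v Bv|_ [z Bz <-]] //=.
  by exists (exist _ v (BZ v Bv)).
have <- // : [set v | v \in Z] = (val : submod Z -> V) @` setT.
apply/seteqP; split=> [v Zv|_ [z _ <-]] /=; last exact: (valP z).
by exists (exist _ v Zv).
Qed.

End LengthOfTypes.

(** * Noetherian modules *)

Section ChainConditions.
Variables (A : comNzRingType) (V : lmodType A).
Implicit Types (N P Q U : set V).

Definition acc U := forall c : nat -> set V, (forall i, submodule (c i)) ->
  (forall i, c i `<=` c i.+1) -> (forall i, c i `<=` U) ->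
  exists n, forall i, (n <= i)%N -> c i `<=` c n.

Lemma chain_mono (T : Type) (c : nat -> set T) : (forall i, c i `<=` c i.+1) ->
  forall i j, (i <= j)%N -> c i `<=` c j.
Proof.
move=> H i j /subnK <-; elim: (j - i)%N => [|k IH] //.
exact: subset_trans IH (H _).
Qed.

Lemma acc_max U (S : set (set V)) : acc U -> (exists N, S N) ->
  (forall N, S N -> submodule N /\ N `<=` U) ->
  exists N, S N /\ forall P, S P -> N `<=` P -> P `<=` N.
Proof.
move=> aU [N0 SN0] HS; apply: contrapT => no.
have H (N : {N | S N}) : {P : {P | S P} | sval N `<=` sval P /\ ~ sval P `<=` sval N}.
  apply: cid; apply: contrapT => H; apply: no; exists (sval N).
  split=> [|P SP NP]; first exact: svalP N.
  by apply: contrapT => PN; apply: H; exists (exist _ P SP).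
pose f := fix f n := if n is n'.+1 then sval (H (f n')) else exist _ N0 SN0.
have [i|i|i|n Hn] := aU (fun n => sval (f n)).
- by have [] := HS _ (svalP (f i)).
- by have [] := svalP (H (f i)).
- by have [] := HS _ (svalP (f i)).
by have [_ []] := svalP (H (f n)); exact: (Hn n.+1).
Qed.

Lemma acc_sub U U' : U' `<=` U -> acc U -> acc U'.
Proof. by move=> UU aU c sc mc cU; apply: aU => // i; exact: subset_trans UU. Qed.

Definition line (v : V) : set V := [set a *: v | a in setT].

Fixpoint span (s : seq V) : set V :=
  if s is v :: s' then smsum (line v) (span s') else [set 0].

Lemma submodule_line v : submodule (line v).
Proof.
split=> [|a _ _ [b _ <-] [c _ <-]]; first by exists 0; rewrite ?scale0r.
by exists (a * b + c); rewrite // scalerDl scalerA.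
Qed.

Lemma submodule_span s : submodule (span s).
Proof.
elim: s => [|v s IH] /=; first exact: submodule1.
by apply: submodule_smsum => //; exact: submodule_line.
Qed.

Lemma line_id v : line v v. Proof. by exists 1; rewrite ?scale1r. Qed.

Lemma line_sub v N : submodule N -> N v -> line v `<=` N.
Proof. by move=> sN Nv _ [a _ <-]; exact: submoduleZ. Qed.

Lemma span_sub s N : submodule N -> (forall v, v \in s -> N v) -> span s `<=` N.
Proof.
move=> sN; elim: s => [|v s IH] H /=; first by move=> _ ->; exact: submodule0.
apply: smsum_lub => //; first by apply: line_sub => //; apply: H; rewrite mem_head.
by apply: IH => w ws; apply: H; rewrite inE ws orbT.
Qed.

Lemma mem_span s v : v \in s -> span s v.
Proof.
elim: s => [//|w s IH]; rewrite inE => /orP[/eqP->|/IH sv] /=.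
  by apply: smsumSl; [exact: submodule_span|exact: line_id].
by apply: smsumSr; first exact: submodule_line.
Qed.

Definition colon N (v : V) : set A^o := [set a | N ((a : A) *: v)].

Lemma submodule_colon N v : submodule N -> submodule (colon N v).
Proof.
move=> sN; split=> [|a x y]; rewrite /colon /= ?scale0r; first exact: submodule0.
by move=> ? ?; rewrite scalerDl -[(a *: x)]/(a * (x : A)) -scalerA; apply: sN.2.
Qed.

End ChainConditions.

Section Noetherian.
Variables (A : comNzRingType) (V : lmodType A).
Implicit Types (N P Q U : set V).

(** Two nested submodules of Av + U agree once they have the same ideal of coefficients of v modulo
    U ([J]) and the same intersection with U; both stabilise along the chain. *)
Lemma acc_line U v : acc (setT : set A^o) -> submodule U -> acc U ->
  acc (smsum (line v) U).
Proof.
move=> aA sU aU c sc mc cU.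
pose J i : set A^o := [set a | exists2 w, U w & c i ((a : A) *: v + w)].
have sJ i : submodule (J i).
  split=> [|a x y [w Uw cw] [z Uz cz]].
    by exists 0; [exact: submodule0|rewrite scale0r addr0; exact: submodule0].
  exists (a *: w + z); first exact: sU.2.
  rewrite scalerDl -[(a *: x)]/(a * (x : A)) -scalerA addrACA -scalerDr.
  exact: (sc i).2.
have [n1 H1] : exists n, forall i, (n <= i)%N -> J i `<=` J n.
  by apply: aA => // i a [w Uw cw]; exists w => //; apply: mc.
have [n2 H2] : exists n, forall i, (n <= i)%N -> c i `&` U `<=` c n `&` U.
  apply: aU => i; [exact: submoduleI|exact: setSI|exact: subIsetr].
exists (maxn n1 n2) => i; rewrite geq_max => /andP[i1 i2] x cx.
have [_ [w [[a _ <-] Uw xE]]] := cU i x cx.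
have /H1 : J i a by exists w => //; rewrite -xE.
move=> /(_ i1) [z Uz cz].
have m1 : c n1 `<=` c (maxn n1 n2) by apply: chain_mono => //; exact: leq_maxl.
have m2 : c n2 `<=` c (maxn n1 n2) by apply: chain_mono => //; exact: leq_maxr.
have mi : c n1 `<=` c i by exact: chain_mono.
have [|cwz _] := H2 i i2 (w - z).
  split; last exact: submoduleB.
  have -> : w - z = x - (a *: v + z) by rewrite xE opprD addrACA subrr add0r.
  by apply: submoduleB => //; apply: mi.
have -> : x = (a *: v + z) + (w - z) by rewrite xE -addrA [z + _]addrC subrK.
by apply: submoduleD => //; [exact: m1|exact: m2].
Qed.

Lemma acc_span (s : seq V) : acc (setT : set A^o) -> acc (span s).
Proof.
move=> aA; elim: s => [|v s IH] /=.
  move=> c sc _ cU; exists 0%N => i _ x /cU ->; exact: submodule0.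
by apply: acc_line => //; exact: submodule_span.
Qed.

Lemma acc_fg U N : acc U -> submodule N -> N `<=` U -> exists s, N = span s.
Proof.
move=> aU sN NU.
have [||_ [[s [<- sNs]] smax]] := @acc_max _ _ U
  [set P | exists s, span s = P /\ (forall v, v \in s -> N v)] aU.
- by exists [set 0], [::].
- move=> _ [s [<- sNs]]; split; first exact: submodule_span.
  by apply: subset_trans NU; exact: span_sub.
exists s; apply/seteqP; split; last exact: span_sub.
move=> v Nv; apply: (smax (span (v :: s))) => /=.
- exists (v :: s); split=> // w; rewrite inE => /orP[/eqP->//|]; exact: sNs.
- by apply: smsumSr; exact: submodule_line.
- by apply: smsumSl; [exact: submodule_span|exact: line_id].
Qed.

End Noetherian.

(** * Prime filtrations *)

Section Devissage.
Variables (A : comNzRingType) (V : lmodType A).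
Implicit Types (N P Q U : set V).

Definition prime_set (p : set A^o) :=
  [/\ submodule p, ~ p 1 & forall a b : A, p (a * b) -> p a \/ p b].

(* A colon ideal (N : v) that is maximal among those with v in P but not in N
   is prime. *)
Lemma exists_prime_colon N P : acc (setT : set A^o) -> submodule N ->
  submodule P -> ~ P `<=` N -> exists v, P v /\ prime_set (colon N v).
Proof.
move=> aA sN sP PN.
have [v0 [Pv0 Nv0]] : exists v, P v /\ ~ N v.
  apply: contrapT => no; apply: PN => v Pv; apply: contrapT => Nv.
  by apply: no; exists v.
pose S : set (set A^o) := [set q | exists2 v, q = colon N v & P v /\ ~ N v].
have [||_ [[v -> [Pv Nv]] vmax]] := @acc_max A A^o setT S aA.
- by exists (colon N v0), v0.
- by move=> _ [v -> _]; split=> //; exact: submodule_colon.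
exists v; split=> //; split.
- exact: submodule_colon.
- by rewrite /colon /= scale1r.
move=> a b; rewrite /colon /= => Nab.
have [Nb|Nb] := pselect (N (b *: v)); [by right|left].
apply: (vmax (colon N (b *: v))); last by rewrite /colon /= scalerA.
  by exists (b *: v) => //; split=> //; exact: submoduleZ.
move=> c; rewrite /colon /= => Nc.
by rewrite scalerA mulrC -scalerA; exact: submoduleZ.
Qed.

(** Induction along a filtration with quotients A / p, since (Av + Q) / Q is A / (Q : v). A maximal
    Q with [Phi Q] that is smaller than P could be enlarged by such a v. *)
Lemma devissage (Phi : set V -> Prop) N P : acc (setT : set A^o) -> acc P ->
  submodule N -> submodule P -> N `<=` P -> Phi N ->
  (forall Q v, submodule Q -> N `<=` Q -> Q `<=` P -> Phi Q -> P v ->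
     prime_set (colon Q v) -> Phi (smsum (line v) Q)) ->
  Phi P.
Proof.
move=> aA aP sN sP NP PhiN step.
have [||Q [[sQ NQ QP PhiQ] Qmax]] := @acc_max _ _ P
    [set Q | [/\ submodule Q, N `<=` Q, Q `<=` P & Phi Q]] aP.
- by exists N; split.
- by move=> Q [].
have [PQ|PQ] := pselect (P `<=` Q).
  by suff <- : Q = P by []; apply/seteqP.
have [v [Pv pv]] := exists_prime_colon aA sQ sP PQ.
have sL := submodule_line v.
have /Qmax : [set Q | [/\ submodule Q, N `<=` Q, Q `<=` P & Phi Q]] (smsum (line v) Q).
  split; first exact: submodule_smsum.
  - exact: subset_trans NQ (smsumSr sL).
  - by apply: smsum_lub => //; exact: line_sub.
  - exact: step.
move=> /(_ (smsumSr sL)) /(_ v) vQ.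
have [_ + _] := pv; case; rewrite /colon /= scale1r; apply: vQ.
by apply: smsumSl => //; exact: line_id.
Qed.

End Devissage.

Lemma noetherian_acc (A : comNzRingType) : noetherian A -> acc (setT : set A^o).
Proof.
move=> nA c sc mc _.
pose I : {pred A^o} := fun x => `[< exists i, c i x >].
have sI : submod_closed I.
  split=> [|a u v]; first by apply/asboolP; exists 0%N; exact: submodule0.
  move=> /asboolP[i ci] /asboolP[j cj]; apply/asboolP; exists (maxn i j).
  apply: (sc _).2; [apply: chain_mono ci|apply: chain_mono cj] => //.
    exact: leq_maxl.
  exact: leq_maxr.
have [k [v Iv]] := nA I sI.
have vI i : exists n, c n (v i).
  apply/asboolP; change (v i \in I); rewrite Iv; apply/asboolP.
  exists (fun j => (i == j)%:R); rewrite (bigD1 i) //= eqxx scale1r big1 ?addr0 //.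
  by move=> j /negbTE ji; rewrite eq_sym ji scale0r.
have /choice[n nP] := vI; exists (\max_i n i) => i _ x cx.
have : x \in I by apply/asboolP; exists i.
rewrite Iv => /asboolP[b ->]; apply: submodule_sum => // j _.
apply: submoduleZ => //; apply: chain_mono (nP j) => //.
exact: leq_bigmax.
Qed.

Lemma fin_gen_span (A : comNzRingType) (V : lmodType A) (N : {pred V}) :
  fin_gen N -> exists s : seq V, [set v | v \in N] = span s.
Proof.
move=> [k [v Nv]]; exists [seq v i | i : 'I_k].
apply/seteqP; split=> x /=.
  rewrite Nv => /asboolP[c ->]; apply: submodule_sum => [|i _].
    exact: submodule_span.
  apply: submoduleZ; first exact: submodule_span.
  by apply: mem_span; apply: map_f; rewrite mem_enum.
apply: (span_sub (N := [set v | v \in N])) => [|_ /mapP[i _ ->]] /=.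
  have [s0 sD] := lspan_closed v.
  by split=> [|a y z] /=; rewrite ?Nv //; exact: sD.
rewrite Nv; apply/asboolP.
exists (fun j => (i == j)%:R); rewrite (bigD1 i) //= eqxx scale1r big1 ?addr0 //.
by move=> j /negbTE ji; rewrite eq_sym ji scale0r.
Qed.

(** * The Artin-Rees lemma *)

Section IdealPowers.
Variables (A : comNzRingType) (d : nat) (x : 'I_d -> A).

(* With I = (x), [xpow n N] is the submodule I^n N. *)
Definition xmul (V : lmodType A) (N : set V) : set V :=
  [set y | exists v : 'I_d -> V, (forall i, N (v i)) /\ y = \sum_i x i *: v i].

Definition xpow (V : lmodType A) n (N : set V) : set V := iter n (@xmul V) N.

Variable V : lmodType A.
Implicit Types (N P : set V).

Lemma submodule_xmul N : submodule N -> submodule (xmul N).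
Proof.
move=> sN; split=> [|a _ _ [u [Nu ->]] [v [Nv ->]]].
  exists (fun=> 0); split=> [_|]; first exact: submodule0.
  by rewrite big1 // => i _; rewrite scaler0.
exists (fun i => a *: u i + v i); split=> [i|]; first exact: sN.2.
rewrite scaler_sumr -big_split; apply: eq_bigr => i _ /=.
by rewrite scalerDr !scalerA mulrC.
Qed.

Lemma submodule_xpow n N : submodule N -> submodule (xpow n N).
Proof. by move=> sN; elim: n => //= n; exact: submodule_xmul. Qed.

Lemma xmulS N P : N `<=` P -> xmul N `<=` xmul P.
Proof. by move=> NP _ [v [Nv ->]]; exists v; split=> // i; exact: NP. Qed.

Lemma xpowS n N P : N `<=` P -> xpow n N `<=` xpow n P.
Proof. by move=> NP; elim: n => //= n; exact: xmulS. Qed.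

Lemma xmul_sub N : submodule N -> xmul N `<=` N.
Proof.
by move=> sN _ [v [Nv ->]]; apply: submodule_sum => // i _; exact: submoduleZ.
Qed.

Lemma xpowSr n N : submodule N -> xpow n.+1 N `<=` xpow n N.
Proof. by move=> sN; apply: xmul_sub; exact: submodule_xpow. Qed.

Lemma xpow_sub n N : submodule N -> xpow n N `<=` N.
Proof.
by move=> sN; elim: n => //= n; apply: subset_trans; exact: xpowSr.
Qed.

Lemma xpowD i j N : xpow (i + j) N = xpow i (xpow j N).
Proof. exact: iterD. Qed.

Lemma xmulZ N i v : submodule N -> N v -> xmul N (x i *: v).
Proof.
move=> sN Nv; exists (fun j => if j == i then v else 0); split=> [j|].
  by case: ifP => // _; exact: submodule0.
by rewrite (bigD1 i) //= eqxx big1 ?addr0 // => j /negbTE->; rewrite scaler0.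
Qed.

Lemma xpow_smul j (a : A) N w : submodule N -> xpow j (setT : set A^o) a -> N w ->
  xpow j N (a *: w).
Proof.
move=> sN; elim: j a w => [|j IH] a w /=; first by move=> _; exact: submoduleZ.
move=> [v [Hv ->]] Nw; rewrite scaler_suml.
exists (fun i => (v i : A) *: w); split=> [i|]; first exact: IH.
by apply: eq_bigr => i _; rewrite scalerA.
Qed.

Lemma xpow_smsum n N P : submodule N -> submodule P ->
  xpow n (smsum N P) `<=` smsum (xpow n N) (xpow n P).
Proof.
move=> sN sP; elim: n => [//|n IH] /= _ [v [/(_ _)/IH Hv ->]].
have /choice[u Hu] := Hv.
have /choice[w Hw] := Hu.
exists (\sum_i x i *: u i), (\sum_i x i *: w i); split.
- by exists u; split=> // i; have [] := Hw i.
- by exists w; split=> // i; have [] := Hw i.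
- rewrite -big_split; apply: eq_bigr => i _ /=.
  by have [_ _ ->] := Hw i; rewrite scalerDr.
Qed.

End IdealPowers.

Section IdealPowersCombinations.
Variables (A : comNzRingType) (d : nat) (x : 'I_d -> A) (V : lmodType A).

Lemma xpow_comb n (s : seq V) w : xpow x n (span s) w ->
  exists a : nat -> A, (forall k, xpow x n (setT : set A^o) (a k)) /\
    w = \sum_(k < size s) a k *: s`_k.
Proof.
have sT i := @submodule_xpow _ _ x _ i (setT : set A^o) (@submoduleT _ _).
elim: n w => [|n IH] w /=.
  elim: s w => [|v s IH] w /=.
    by move=> ->; exists (fun=> 0); rewrite big_ord0.
  move=> [_ [u [[a _ <-] /IH[b [_ ->]] ->]]].
  exists (fun k => if k is k'.+1 then b k' else a); split=> //.
  by rewrite big_ord_recl.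
move=> [v [/(_ _)/IH Hv ->]]; have /choice[a Ha] := Hv.
exists (fun k => \sum_i x i * a i k); split=> [k|].
  by exists (fun i => a i k); split=> // i; have [] := Ha i.
transitivity (\sum_i \sum_(k < size s) x i *: (a i k *: s`_k)).
  by apply: eq_bigr => i _; rewrite {1}(Ha i).2 scaler_sumr.
rewrite exchange_big; apply: eq_bigr => k _ /=.
by rewrite scaler_suml; apply: eq_bigr => i _; rewrite scalerA.
Qed.

End IdealPowersCombinations.

(** * The Hilbert basis theorem and the Rees algebra *)

(** Hilbert's argument: [L n i] consists of the coefficients of X^n of the members of [c i] of
    degree at most n. It grows with n and with i. If [L n i] is contained in [L n N] for all n, then
    [c i] is contained in [c N], by lowering the degree of a polynomial one step at a time. *)
Lemma acc_poly (A : comNzRingType) :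
  acc (setT : set A^o) -> acc (setT : set {poly A}^o).
Proof.
move=> aA c sc mc _.
pose L n i : set A^o := [set a | exists p : {poly A},
  [/\ c i p, (size p <= n.+1)%N & p`_n = a]].
have sL n i : submodule (L n i).
  split=> [|a _ _ [p [cp sp <-]] [q [cq sq <-]]].
    exists 0; rewrite size_poly0 coef0; split=> //; exact: (submodule0 (sc i)).
  exists (a%:P * p + q); split; first exact: (sc i).2.
    rewrite (leq_trans (size_polyD _ _)) // geq_max sq andbT mul_polyC.
    exact: leq_trans (size_scale_leq _ _) sp.
  by rewrite coefD coefCM.
have Li n i j : (i <= j)%N -> L n i `<=` L n j.
  move=> ij a [p [cp sp <-]]; exists p; split=> //.
  exact: (chain_mono mc ij).
have Ln n k i : (n <= k)%N -> L n i `<=` L k i.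
  apply: (@chain_mono _ (fun n => L n i)) => {n k} n a [p [cp sp <-]].
  exists ('X * p); split; first exact: (submoduleZ 'X (sc i) cp).
    rewrite (leq_trans (size_polyMleq _ _)) // size_polyX.
    by rewrite addSn add1n.
  by rewrite coefXM.
have [n0 H0] : exists n, forall i, (n <= i)%N -> L i i `<=` L n n.
  apply: (aA (fun i => L i i)) => // i.
  by apply: subset_trans (Ln _ _ _ (leqnSn i)); exact: Li.
have /choice[f Hf] : forall n, exists m, forall i, (m <= i)%N -> L n i `<=` L n m.
  by move=> n; apply: (aA (L n)) => // i; exact: Li.
(* From degree n0 on, stability of the diagonal at n0 serves all degrees; each of the finitely many
   lower degrees k brings its own index [f k]. *)
pose N := maxn n0 (\max_(k < n0) f k).
have HL n i : L n i `<=` L n N.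
  case: (ltnP n n0) => nn.
    have fN : (f n <= N)%N.
      apply: leq_trans (leq_maxr _ _).
      exact: (leq_bigmax (F := fun k : 'I_n0 => f k) (Ordinal nn)).
    apply: subset_trans (Li _ _ _ fN).
    apply: subset_trans (Hf n (maxn i (f n)) (leq_maxr _ _)).
    exact/Li/leq_maxl.
  apply: (@subset_trans _ (L (maxn n i) (maxn n i))).
    apply: subset_trans (Ln _ _ _ (leq_maxl _ _)).
    exact/Li/leq_maxr.
  apply: subset_trans (H0 _ _) _; first exact: leq_trans nn (leq_maxl _ _).
  by apply: subset_trans (Ln _ _ _ nn) _; apply: Li; exact: leq_maxl.
exists N => i Ni.
suff H k (p : {poly A}) : (size p <= k)%N -> c i p -> c N p.
  by move=> p; exact: (H (size p)).
elim: k p => [|k IH] p.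
  by rewrite leqn0 size_poly_eq0 => /eqP -> _; exact: (submodule0 (sc N)).
move=> sp cp.
have [q [cq sq qk]] : L k N p`_k by apply: (HL k i); exists p.
have -> : p = (p - q) + q by rewrite subrK.
apply: (submoduleD (sc N)) => //; apply: IH.
  apply/leq_sizeP => j; rewrite leq_eqVlt => /orP[/eqP<-|kj].
    by rewrite coefB qk subrr.
  rewrite coefB !nth_default ?subrr //; first exact: leq_trans sq kj.
  exact: leq_trans sp kj.
by apply: (submoduleB (sc i)) => //; exact: (chain_mono mc Ni).
Qed.

Fixpoint mpolyring (A : comNzRingType) (d : nat) : comNzRingType :=
  if d is d'.+1 then {poly mpolyring A d'} : comNzRingType else A.

Lemma acc_mpolyring (A : comNzRingType) d : acc (setT : set A^o) -> acc (setT : set (mpolyring A d)^o).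
Proof. by move=> aA; elim: d => //= d; exact: acc_poly. Qed.

(* The ring morphism A[X_0, ..., X_(d-1)] -> A[t] with X_i |-> x_i t, whose image
   is the Rees algebra of (x). *)
Fixpoint rees (A : comNzRingType) (x : nat -> A) (d : nat) :
    {rmorphism mpolyring A d -> {poly A}} :=
  if d is d'.+1 return {rmorphism mpolyring A d -> {poly A}}
  then horner_morph (fun a => mulrC (x d' *: 'X) (rees x d' a)) : {rmorphism _ -> _}
  else polyC : {rmorphism A -> {poly A}}.

Lemma rees_X (A : comNzRingType) (x : nat -> A) d i : (i < d)%N ->
  exists g, rees x d g = x i *: 'X.
Proof.
elim: d => // d IH; rewrite ltnS leq_eqVlt => /orP[/eqP->|/IH[g gE]].
  by exists 'X; rewrite /= horner_morphX.
by exists g%:P; rewrite /= horner_morphC.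
Qed.

Lemma rees_C (A : comNzRingType) (x : nat -> A) d a :
  exists g, rees x d g = a%:P.
Proof.
elim: d => [|d [g gE]]; first by exists a.
by exists g%:P; rewrite /= horner_morphC.
Qed.

Section ReesImage.
Variables (A : comNzRingType) (d : nat) (x : 'I_d -> A).

(** Extended by 0 to all natural numbers because [rees] recurses on the number of variables. *)
Definition xnat (k : nat) : A := if insub k is Some i then x i else 0.

Lemma xnatE (i : 'I_d) : xnat i = x i.
Proof. by rewrite /xnat valK. Qed.

Let I n : set A^o := xpow x n setT.
Let sI n : submodule (I n).
Proof. exact: submodule_xpow (@submoduleT _ _). Qed.

(** The Rees algebra of (x) as a subset of A[t]. *)
Definition rees_set : set {poly A} := [set f | forall n, I n (f`_n)].

Lemma rees_setD f g : rees_set f -> rees_set g -> rees_set (f + g).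
Proof. by move=> Hf Hg n; rewrite coefD; exact: submoduleD (sI n) _ _. Qed.

Lemma rees_setM f g : rees_set f -> rees_set g -> rees_set (f * g).
Proof.
move=> Hf Hg n; rewrite coefM.
apply: (@submodule_sum A A^o _ _ _ _ (fun i : 'I_n.+1 => f`_i * g`_(n - i)) (sI n)) => i _.
have := xpow_smul (sI (n - i)) (Hf i) (Hg (n - i)%N).
by rewrite /I -xpowD subnKC // -ltnS.
Qed.

Lemma rees_setC a : rees_set a%:P.
Proof.
by move=> [|n]; rewrite coefC //=; exact: (submodule0 (sI n.+1)).
Qed.

Lemma rees_set_rees k g : rees_set (rees xnat k g).
Proof.
elim: k g => [|k IH] g; first exact: rees_setC.
have H (p : {poly mpolyring A k}) : rees_set (rees xnat k.+1 p).
  elim/poly_ind: p => [|p c IHp]; first by rewrite rmorph0; exact: rees_setC.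
  rewrite rmorphD rmorphM /= horner_morphX horner_morphC.
  apply: rees_setD; last exact: IH.
  apply: rees_setM => // n; rewrite coefZ coefX.
  case: eqP => [->|_]; last by rewrite mulr0; exact: (submodule0 (sI n)).
  rewrite mulr1 /xnat; case: insubP => [i _ _|_]; last exact: (submodule0 (sI 1)).
  rewrite -[x i]mulr1; exact: (xmulZ x i (@submoduleT _ _)).
exact: H.
Qed.

Lemma rees_surj n a : I n a -> exists g, rees xnat d g = a *: 'X^n.
Proof.
elim: n a => [|n IH] a /=.
  by move=> _; have [g gE] := rees_C xnat d a; exists g; rewrite gE expr0 alg_polyC.
move=> [v [/(_ _)/IH Hv ->]]; have /choice[f fE] := Hv.
have /choice[X XE] : forall i : 'I_d, exists g, rees xnat d g = xnat i *: 'X.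
  by move=> i; exact: rees_X.
exists (\sum_i X i * f i); rewrite rmorph_sum scaler_suml; apply: eq_bigr => i _.
by rewrite rmorphM /= XE fE xnatE -scalerAl -scalerAr scalerA exprS.
Qed.

End ReesImage.

Section ArtinRees.
Variables (A : comNzRingType) (d : nat) (x : 'I_d -> A) (V : lmodType A).
Hypothesis accA : acc (setT : set A^o).

Lemma acc_rV (B : comNzRingType) N :
  acc (setT : set B^o) -> acc (setT : set 'rV[B]_N).
Proof.
move=> aB; apply: (@acc_sub _ _ (span [seq delta_mx 0 i | i : 'I_N])).
  move=> u _; rewrite (row_sum_delta u); apply: submodule_sum => [|i _].
    exact: submodule_span.
  apply: submoduleZ; first exact: submodule_span.
  by apply: mem_span; apply: map_f; rewrite mem_enum.
exact: acc_span.
Qed.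

(** The rows over the polynomial ring B whose components all lie in Q form a submodule [Z], finitely
    generated because B is Noetherian. The components of its generators vanish from degree c on, so
    they satisfy the claim trivially, and the claim passes to B-combinations. *)
Lemma artin_rees (s : seq V) (Q : set V) : submodule Q ->
  exists c, forall n, (c <= n)%N ->
    Q `&` xpow x n (span s) `<=` xpow x (n - c) (Q `&` xpow x c (span s)).
Proof.
move=> sQ; pose P := span s; have sP : submodule P := submodule_span s.
pose B := mpolyring A d; pose phi := rees (xnat x) d.
(* The component of degree n in the Rees module, the sum of the I^n P t^n, of the combination of s
   with coefficients f; B acts through [phi]. *)
pose T n (f : 'rV[B]_(size s)) : V := \sum_k (phi (f 0 k))`_n *: s`_k.
have TP n f : xpow x n P (T n f).
  apply: submodule_sum => [|k _]; first exact: submodule_xpow.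
  apply: xpow_smul => //; first exact: rees_set_rees.
  by apply: mem_span; exact: mem_nth.
have TD n f g : T n (f + g) = T n f + T n g.
  rewrite /T -big_split; apply: eq_bigr => k _.
  by rewrite !mxE rmorphD coefD scalerDl.
have TM n a f : T n (a *: f) = \sum_(i < n.+1) (phi a)`_i *: T (n - i)%N f.
  rewrite /T; under [RHS]eq_bigr do rewrite scaler_sumr.
  rewrite exchange_big; apply: eq_bigr => k _ /=.
  rewrite mxE rmorphM coefM scaler_suml; apply: eq_bigr => i _.
  by rewrite scalerA.
have T0 n : T n 0 = 0.
  by rewrite /T big1 // => k _; rewrite mxE rmorph0 coef0 scale0r.
pose Z : set 'rV[B]_(size s) := [set f | forall n, Q (T n f)].
have sZ : submodule Z.
  split=> [n|a f g Zf Zg n]; first by rewrite T0; exact: submodule0.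
  rewrite TD; apply: submoduleD => //; rewrite TM; apply: submodule_sum => // i _.
  exact: submoduleZ.
have [G ZG] : exists G, Z = span G.
  apply: (@acc_fg _ _ setT) => //; apply: acc_rV; exact: acc_mpolyring.
pose sz (f : 'rV[B]_(size s)) := \max_k size (phi (f 0%R k)).
pose c := \max_(f <- G) sz f; exists c => n cn.
pose QI l := Q `&` xpow x l P.
have sQI l : submodule (QI l) by apply: submoduleI => //; exact: submodule_xpow.
pose Y : set 'rV[B]_(size s) :=
  [set f | Z f /\ forall n, (c <= n)%N -> xpow x (n - c) (QI c) (T n f)].
have sY : submodule Y.
  split=> [|a f g [Zf Hf] [Zg Hg]].
    split=> [|k _]; rewrite ?T0; first exact: submodule0.
    exact: submodule0 (submodule_xpow x _ (sQI c)).
  split=> [|k ck]; first exact: sZ.2.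
  have sX := submodule_xpow x (k - c) (sQI c).
  rewrite TD; apply: submoduleD => //; last exact: Hg.
  rewrite TM; apply: submodule_sum => // i _.
  have iI := rees_set_rees x a (i : nat).
  have ik : (i <= k)%N by rewrite -ltnS.
  (* If k - i >= c, the property of f applies. Otherwise the component is only known to lie in Q and
     in I^(k-i) P; of the i factors supplied by a, c - (k - i) move it into I^c P and the other k -
     c stay outside. *)
  case: (leqP c (k - i)%N) => cki.
    have -> : (k - c = i + (k - i - c))%N by lia.
    rewrite xpowD; apply: xpow_smul => //; first exact: submodule_xpow.
    exact: Hf.
  have QT : QI (k - i)%N (T (k - i)%N f) by split; [exact: Zf|exact: TP].
  have := xpow_smul (sQI _) iI QT.
  have {1}-> : (i = (k - c) + (c - (k - i)) :> nat)%N by lia.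
  rewrite xpowD; apply: xpowS => w Hw; split.
    by have [] := xpow_sub (sQI _) Hw.
  have -> : (c = (c - (k - i)) + (k - i))%N by lia.
  by rewrite xpowD; apply: xpowS Hw; exact: subIsetr.
have ZY : Z `<=` Y.
  rewrite ZG; apply: span_sub => // f fG; split; first by rewrite ZG; exact: mem_span.
  move=> k ck; suff -> : T k f = 0 by apply: submodule0 (submodule_xpow x _ (sQI c)).
  rewrite /T big1 // => j _; rewrite nth_default ?scale0r //.
  apply: leq_trans ck; apply: leq_trans (leq_bigmax_seq _ fG _) => //.
  by apply: (leq_bigmax (F := fun j => size (phi (f 0%R j)))).
move=> z [Qz Hz].
have [a [aI zE]] := xpow_comb Hz.
have /choice[f fE] : forall k, exists g, phi g = a k *: 'X^n.
  by move=> k; exact: rees_surj (aI k).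
(* A homogeneous lift of z: its only nonzero component is z, in degree n. *)
pose g : 'rV[B]_(size s) := \row_k f k.
have Tg k : T k g = if k == n then z else 0.
  rewrite /T; case: eqP => [->|/eqP kn].
    rewrite zE; apply: eq_bigr => j _.
    by rewrite mxE fE coefZ coefXn eqxx mulr1.
  by rewrite big1 // => j _; rewrite mxE fE coefZ coefXn (negbTE kn) mulr0 scale0r.
have /ZY[_ /(_ n cn)] : Z g.
  by move=> k; rewrite Tg; case: ifP => // _; exact: submodule0.
by rewrite Tg eqxx.
Qed.

End ArtinRees.

(** * The Euler characteristic of the Koszul complex *)

Section KoszulHomotopy.
Variables (A : comNzRingType) (d : nat) (x : 'I_d -> A) (V : lmodType A).
Local Notation K := (koszul d V).
Implicit Types (f g : K) (N P : set V).

HB.instance Definition _ :=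
  GRing.isLinear.Build A K K *:%R (@koszul_diff A d x V) (@koszul_diffP A d x V).

Definition kcoord (J : {set 'I_d}) f : V := f J.

Lemma kcoord_linear J : linear (kcoord J).
Proof. by move=> a f g; rewrite /kcoord !ffunE. Qed.
HB.instance Definition _ J :=
  GRing.isLinear.Build A K V *:%R (kcoord J) (kcoord_linear J).

Definition ksingle (J : {set 'I_d}) (v : V) : K := [ffun L => if L == J then v else 0].

Definition kbelow (j : 'I_d) (J : {set 'I_d})  : nat :=
  #|([set k in J | (k < j)%N])%SET|.

Lemma kbelow_add j k (J : {set 'I_d}) : k \notin J -> kbelow j (k |: J)%SET = ((k < j)%N + kbelow j J)%N.
Proof.
move=> kJ; rewrite /kbelow; case: ltnP => jk.
  have -> : ([set l in k |: J | (l < j)%N] = k |: [set l in J | (l < j)%N])%SET.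
    by apply/setP => l; rewrite !inE; case: eqP => [->|]; rewrite ?jk.
  by rewrite cardsU1 inE (negbTE kJ).
congr #|pred_of_set _|; apply/setP => l; rewrite !inE.
by case: eqP => [->|//]; rewrite ltnNge jk /= andbF.
Qed.

(* Exterior multiplication by e_j, a null-homotopy for multiplication by x_j. *)
Definition kwedge (j : 'I_d) f : K :=
  [ffun J : {set 'I_d} => if j \in J then (-1) ^+ kbelow j J *: f (J :\ j)%SET else 0].

Lemma koszul_homotopy j f :
  koszul_diff x (kwedge j f) + kwedge j (koszul_diff x f) = x j *: f.
Proof.
apply/ffunP => J; rewrite !ffunE.
case: ifP => jJ; last first.
  rewrite addr0 (bigD1 j) ?jJ //= big1 ?addr0.
    rewrite ffunE finset.setU11 finset.setU1K ?jJ // kbelow_add ?jJ // ltnn add0n.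
    by rewrite scalerA mulrAC -expr2 sqrr_sign mul1r.
  move=> k /andP[kJ kj]; rewrite ffunE in_setU1 jJ orbF eq_sym (negbTE kj).
  by rewrite scaler0.
set J' := (J :\ j)%SET.
have jJ' : j \notin J' by rewrite finset.setD11.
have JE : J = (j |: J')%SET by rewrite finset.setD1K.
rewrite [X in _ *: X](bigD1 j) //= -JE scalerDr addrCA.
have -> : kbelow j J = kbelow j J' by rewrite JE kbelow_add // ltnn.
rewrite -/(kbelow j J') scalerA mulrA -expr2 sqrr_sign mul1r -[RHS]addr0.
congr (_ + _); rewrite scaler_sumr.
rewrite [X in _ + X](eq_bigl (fun k => k \notin J)); last first.
  by move=> k; rewrite JE in_setU1 negb_or andbC.
rewrite -big_split big1 // => k kJ /=.
have kJ' : k \notin J' by move: kJ; rewrite JE in_setU1 negb_or => /andP[].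
have kj : k != j by move: kJ; rewrite JE in_setU1 negb_or => /andP[].
rewrite ffunE in_setU1 jJ orbT.
have -> : (k |: J) :\ j = (k |: J')%SET.
  rewrite JE finset.setUCA finset.setU1K // in_setU1 eq_sym negb_or kj //.
rewrite kbelow_add // -!/(kbelow _ _) {1 2}JE !kbelow_add // ltnn add0n.
rewrite !scalerA -scalerDl; set a := kbelow k J'; set b := kbelow j J'.
rewrite [X in X *: _](_ : _ = 0) ?scale0r // !exprD.
(* Exactly one of j < k and k < j holds, so the two orders of inserting k and removing j have
   opposite signs. *)
have := kj; rewrite -val_eqE neq_ltn /= => /orP[] lt; rewrite lt ltnNge (ltnW lt) /=; ring.
Qed.

(* The chains of degree i with coefficients in N. *)
Definition kpart (i : nat) N : set K :=
  [set f : K | forall J : {set 'I_d}, if #|J| == i then N (f J) else f J = 0].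

Lemma kpartT i : kpart i setT = [set f | f \in @koszul_deg A d V i].
Proof.
apply/seteqP; split=> f H /=.
  by apply/forallP => J; apply/implyP => Ji; have := H J; rewrite (negbTE Ji) => ->.
by move=> J; case: ifP => // Ji; have /forallP/(_ J) := H; rewrite Ji => /eqP.
Qed.

Lemma submodule_kpart i N : submodule N -> submodule (kpart i N).
Proof.
move=> sN; split=> [J|a f g Hf Hg J]; rewrite !ffunE.
  by case: ifP => // _; exact: submodule0.
have := Hf J; have := Hg J; case: ifP => _; last by move=> -> ->; rewrite scaler0 addr0.
by move=> ? ?; exact: sN.2.
Qed.

Lemma kpartS i N P : N `<=` P -> kpart i N `<=` kpart i P.
Proof. by move=> NP f H J; have := H J; case: ifP => // _ /NP. Qed.

(** The differential gains a factor from (x). This is why the filtration takes one power less in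
    each higher degree. *)
Lemma koszul_diff_kpart i N f : submodule N -> kpart i.+1 N f ->
  kpart i (xmul x N) (koszul_diff x f).
Proof.
move=> sN H J; rewrite ffunE; case: ifP => Ji.
  apply: submodule_sum => [|j jJ]; first exact: submodule_xmul.
  rewrite -mulrC -scalerA; apply: xmulZ => //; apply: submoduleZ => //.
  by have := H (j |: J)%SET; rewrite cardsU1 jJ (eqP Ji) eqxx.
rewrite big1 // => j jJ; have := H (j |: J)%SET.
by rewrite cardsU1 jJ add1n eqSS Ji => ->; rewrite scaler0.
Qed.

Lemma kwedge_kpart i N j f : submodule N -> kpart i N f -> kpart i.+1 N (kwedge j f).
Proof.
move=> sN H J; rewrite ffunE.
have [jJ|jJ] := boolP (j \in J); last by case: ifP => // _; exact: submodule0.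
have := H (J :\ j)%SET; rewrite [#|J|](cardsD1 j) jJ add1n eqSS.
case: ifP => _; last by move=> ->; rewrite scaler0.
exact: submoduleZ.
Qed.

Lemma xpow_kpart n i N : xpow x n (kpart i N) = kpart i (xpow x n N).
Proof.
elim: n => // n IH; rewrite [LHS]/= -/(xpow x n _) IH.
apply/seteqP; split=> [_ [v [Hv ->]] J|f Hf].
  rewrite sum_ffunE; case: ifP => Ji.
    by exists (fun j => v j J); split=> [j|]; [have := Hv j J; rewrite Ji|apply: eq_bigr => j _; rewrite ffunE].
  by rewrite big1 // => j _; rewrite ffunE; have := Hv j J; rewrite Ji => ->; rewrite scaler0.
have /choice[v Hv] (J : {set 'I_d}) : exists v : 'I_d -> V, #|J| == i ->
    (forall j, xpow x n N (v j)) /\ f J = \sum_j x j *: v j.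
  have := Hf J; case: ifP => [_ [v Hv]|_ _]; first by exists v.
  by exists (fun=> 0).
exists (fun j => [ffun J : {set 'I_d} => if #|J| == i then v J j else 0]); split=> [j J|].
  by rewrite ffunE; have [Ji|//] := boolP (#|J| == i); have [] := Hv J Ji.
apply/ffunP => J; rewrite sum_ffunE; have := Hf J; case: ifP => [Ji _|Ji ->].
  by rewrite (Hv J Ji).2; apply: eq_bigr => j _; rewrite !ffunE Ji.
by rewrite big1 // => j _; rewrite !ffunE Ji scaler0.
Qed.

Lemma koszul_span (s : seq V) : setT = span s -> exists t : seq K, setT = span t.
Proof.
move=> sE; exists [seq ksingle J v | J <- enum {set 'I_d}, v <- s].
apply/seteqP; split=> // f _.
have -> : f = \sum_J ksingle J (f J).
  apply/ffunP => L; rewrite sum_ffunE (bigD1 L) //= ffunE eqxx big1 ?addr0 //.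
  by move=> J JL; rewrite ffunE eq_sym (negbTE JL).
apply: submodule_sum => [|J _]; first exact: submodule_span.
have lin : linear (ksingle J).
  by move=> a u v; apply/ffunP => L; rewrite !ffunE; case: ifP; rewrite // scaler0 addr0.
pose g : {linear V -> K} := HB.pack (ksingle J) (GRing.isLinear.Build A V K *:%R (ksingle J) lin).
have : span s (f J) by rewrite -sE.
apply: (@span_sub _ _ s (g @^-1` span _)) => [|v vs].
  by apply: submodule_preimage; exact: submodule_span.
by apply: mem_span; apply: allpairs_f => //; rewrite mem_enum.
Qed.

End KoszulHomotopy.

Section KoszulEuler.
Variables (A : comNzRingType) (d : nat) (x : 'I_d -> A) (V : lmodType A).
Local Notation K := (koszul d V).
Implicit Types (f g : K) (N P : set V).

Definition kfam (T : {set 'I_d} -> set V) : set K := [set f | forall J, T J (f J)].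

Lemma submodule_kfam T : (forall J, submodule (T J)) -> submodule (kfam T).
Proof.
move=> sT; split=> [J|a f g Hf Hg J]; rewrite !ffunE; first exact: submodule0.
exact: (sT J).2.
Qed.

Lemma haslen_kfam T J0 P k : (forall J, submodule (T J)) -> submodule P ->
  T J0 `<=` P -> haslen (T J0) P k ->
  haslen (kfam T) (kfam (fun J => if J == J0 then P else T J)) k.
Proof.
move=> sT sP TP H; set T' := fun J => _.
have sT' J : submodule (T' J) by rewrite /T'; case: ifP.
have TT' : kfam T `<=` kfam T'.
  by move=> f Hf J; rewrite /T'; case: eqP => // ->; exact: TP.
have img (U : {set 'I_d} -> set V) : (forall J, submodule (U J)) ->
    @kcoord A d V J0 @` kfam U = U J0.
  move=> sU; apply/seteqP; split=> [_ [f Hf <-]|v Uv]; first exact: Hf.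
  exists (ksingle J0 v); last by rewrite /kcoord ffunE eqxx.
  by move=> J; rewrite ffunE; case: eqP => [->//|_]; exact: submodule0.
apply/(haslen_image (g := @kcoord A d V J0)) => //; try exact: submodule_kfam.
  move=> f Hf f0 J; have := Hf J; rewrite /T'; case: eqP => [-> _|//].
  rewrite -[f J0]/(kcoord J0 f) f0; exact: submodule0.
by rewrite !img // /T' eqxx.
Qed.

(** The coefficients are enlarged from N to P at one subset J at a time, each adding k to the
    length; there are 'C(d, i) subsets of size i. *)
Lemma haslen_kpart i N P k : submodule N -> submodule P -> N `<=` P ->
  haslen N P k -> haslen (@kpart A d V i N) (kpart i P) ('C(d, i) * k).
Proof.
move=> sN sP NP H.
pose T (s : seq {set 'I_d}) (J : {set 'I_d}) :=
  if J \in s then P else if #|J| == i then N else [set 0].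
have sT s J : submodule (T s J).
  by rewrite /T; do 2 case: ifP => // _; exact: submodule1.
have step (s : seq {set 'I_d}) : uniq s -> all (fun J : {set 'I_d} => #|J| == i) s ->
    haslen (kfam (T [::])) (kfam (T s)) (size s * k).
  elim: s => [_ _|J0 s IH]; first exact/haslen0/submodule_kfam.
  move=> /= /andP[J0s us] /andP[J0i si]; rewrite mulSn addnC.
  apply: (haslenD _ _ _ (IH us si)); try exact: submodule_kfam.
  have -> : T (J0 :: s) = fun J => if J == J0 then P else T s J.
    by apply/funext => J; rewrite /T inE; case: eqP.
  by apply: haslen_kfam => //; rewrite /T (negbTE J0s) J0i.
pose E := enum (finset (fun J : {set 'I_d} => #|J| == i)).
have := step E (enum_uniq _).
have kE (Q : set V) : kfam (fun J => if #|J| == i then Q else [set 0]) = kpart i Q.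
  by apply/seteqP; split=> f Hf J; have := Hf J; case: ifP.
have -> : T E = (fun J => if #|J| == i then P else [set 0]).
  by apply/funext => J; rewrite /T mem_enum inE; case: ifP => // ->.
have -> : T [::] = (fun J => if #|J| == i then N else [set 0]).
  by apply/funext.
rewrite !kE.
have -> : size E = 'C(d, i) by rewrite -cardE card_draws card_ord.
apply.
by apply/allP => J; rewrite mem_enum inE.
Qed.

Definition kcyc i : set K := [set f | kpart i setT f /\ koszul_diff x f = 0].
Definition kbnd i : set K := @koszul_diff A d x V @` kpart i.+1 setT.

Lemma kcycE i : kcyc i = [set f | f \in @koszul_cycles A d x V i].
Proof.
rewrite /kcyc kpartT; apply/seteqP; split=> f /=.
  by move=> [fi f0]; apply/andP; rewrite f0.
by move=> /andP[fi /eqP].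
Qed.

Lemma kbndE i : kbnd i = [set f | f \in @koszul_bounds A d x V i].
Proof.
rewrite /kbnd kpartT; apply/seteqP; split=> [_ [g gi <-]|f] /=.
  by apply/asboolP; exists g.
by move=> /asboolP[g gi ->]; exists g.
Qed.

Lemma submodule_kcyc i : submodule (kcyc i).
Proof.
have [K0 HK] := @submodule_kpart A d V i setT (@submoduleT _ _).
split=> [|a f g [Hf f0] [Hg g0]]; first by split=> //; exact: linear0.
by split; [exact: HK|rewrite koszul_diffP f0 g0 scaler0 addr0].
Qed.

Lemma submodule_kbnd i : submodule (kbnd i).
Proof. exact/submodule_image/submodule_kpart. Qed.

Lemma kbnd_sub i : kbnd i `<=` kcyc i.
Proof.
move=> _ [g Hg <-]; split; last exact: koszul_diff_diff.
by apply: kpartS (koszul_diff_kpart x _ Hg).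
Qed.

Lemma kcyc_sub i : kcyc i `<=` kpart i setT.
Proof. by move=> f []. Qed.

Lemma kcyc0 : kcyc 0 = kpart 0 setT.
Proof.
apply/seteqP; split=> [f []//|f Hf]; split=> //.
apply/ffunP => J; rewrite !ffunE big1 // => j jJ; have := Hf (j |: J)%SET.
by rewrite cardsU1 jJ => ->; rewrite scaler0.
Qed.

Lemma kpart_top N : submodule N -> @kpart A d V d.+1 N = [set 0].
Proof.
move=> sN; apply/seteqP; split=> [f Hf|_ ->]; last exact: (submodule0 (submodule_kpart _ _ sN)).
apply/ffunP => J; rewrite ffunE; have := Hf J.
by rewrite ltn_eqF // ltnS -[X in (_ <= X)%N]card_ord max_card.
Qed.

(* On cycles multiplication by x_j is a boundary, so the Artin-Rees lemma for
   the cycles inside the chains makes the filtration subcomplexes acyclic. *)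
Lemma koszul_acyclic (s : seq V) : acc (setT : set A^o) -> setT = span s ->
  exists n0, forall n i, (n0 <= n)%N -> (i <= d)%N ->
    kcyc i `&` kpart i (xpow x n setT) `<=`
    @koszul_diff A d x V @` kpart i.+1 (xpow x n.-1 setT).
Proof.
move=> aA sE; have [t tE] := koszul_span d sE.
have aK : acc (setT : set K) by rewrite tE; exact: acc_span.
have H i : exists n0, forall n, (n0 <= n)%N ->
    kcyc i `&` kpart i (xpow x n setT) `<=`
    @koszul_diff A d x V @` kpart i.+1 (xpow x n.-1 setT).
  have [u uE] := acc_fg aK (@submodule_kpart A d V i setT (@submoduleT _ _)) (@subsetT _ _).
  have [c Hc] := artin_rees x aA u (submodule_kcyc i).
  exists c.+1 => n cn f; rewrite -xpow_kpart uE => Hf.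
  have {Hf} := Hc n (ltnW cn) f Hf.
  (* At least one factor of (x) remains outside the cycles; the homotopy consumes it, hence the
     exponent [n.-1] for the preimage. *)
  have -> : (n - c = (n - c).-1.+1)%N by lia.
  have -> : n.-1 = ((n - c).-1 + c)%N by lia.
  rewrite -uE xpow_kpart; move: (n - c).-1 f => m.
  rewrite xpowD -!xpow_kpart; elim: m => [|m IH] _ [v [Hv ->]].
    exists (\sum_j kwedge j (v j)); last first.
      rewrite linear_sum; apply: eq_bigr => j _ /=.
      rewrite -koszul_homotopy; have [[_ ->] _] := Hv j.
      by rewrite (_ : kwedge j 0 = 0) ?addr0 //; apply/ffunP => J; rewrite !ffunE scaler0 if_same.
    rewrite /= xpow_kpart; apply: submodule_sum => [|j _].
      by apply: submodule_kpart; exact: submodule_xpow.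
    apply: kwedge_kpart; first exact: submodule_xpow.
    by rewrite -xpow_kpart; have [] := Hv j.
  have /choice[w Hw] : forall j, exists w, xpow x m (xpow x c (kpart i.+1 setT)) w /\
      koszul_diff x w = v j.
    by move=> j; have [w ? ?] := IH _ (Hv j); exists w.
  exists (\sum_j x j *: w j).
    by exists w; split=> // j; have [] := Hw j.
  rewrite linear_sum; apply: eq_bigr => j _.
  by rewrite linearZ /=; have [_ ->] := Hw j.
have /choice[n0 Hn0] := H.
exists (\max_(i < d.+1) n0 i) => n i n0n id; apply: Hn0.
apply: leq_trans n0n.
exact: (leq_bigmax (F := fun k : 'I_d.+1 => n0 k) (Ordinal (id : (i < d.+1)%N))).
Qed.

(** Let F be the subcomplex, Z the cycles and B the boundaries. K_i / F_i is made of (F_i + Z_i) /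
    F_i, which is Z_i / D F_(i+1) by acyclicity, and K_i / (F_i + Z_i), which D maps isomorphically
    to B_(i-1) / D F_i. Its length is therefore h_i + b_i + b_(i-1), where h_i is the length of
    homology and b_i that of B_i / D F_(i+1), and the b_i cancel in the alternating sum. *)
Theorem koszul_euler (F : numDomainType) (s : seq V) :
  acc (setT : set A^o) -> setT = span s ->
  (forall n, finlen (xpow x n setT) (setT : set V)) ->
  (forall i, (i <= d)%N -> finlen (kbnd i) (kcyc i)) /\
  exists n0, forall n, (n0 <= n)%N ->
    \sum_(i < d.+1) (-1) ^+ i * ('C(d, i) * len (xpow x (n - i) setT) (setT : set V))%:R =
    \sum_(i < d.+1) (-1) ^+ i * (len (kbnd i) (kcyc i))%:R :> F.
Proof.
move=> aA sE fin; have [n0 Hn0] := koszul_acyclic aA sE.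
have sT := @submoduleT A V.
pose Fi n i : set K := kpart i (xpow x (n - i) setT).
have sF n i : submodule (Fi n i) by exact/submodule_kpart/submodule_xpow.
have sK i : submodule (@kpart A d V i setT) by exact: submodule_kpart.
have FK n i : Fi n i `<=` kpart i setT by exact: kpartS.
have fFK n i : haslen (Fi n i) (kpart i setT)
    ('C(d, i) * len (xpow x (n - i) setT) (setT : set V)).
  apply: haslen_kpart => //; first exact: submodule_xpow.
  exact: lenP.
pose D := @koszul_diff A d x V.
pose b n i := len (D @` Fi n i.+1) (kbnd i).
pose h i := len (kbnd i) (kcyc i).
have sDF n i : submodule (D @` Fi n i) by exact: submodule_image.
have sZ := submodule_kcyc; have sB := submodule_kbnd.
have DFB n i : D @` Fi n i.+1 `<=` kbnd i by apply: image_subset; exact: FK.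
(* Taking n above n0 + d keeps n - i above n0 in every degree i <= d. *)
have ac n i : (n0 + d < n)%N -> (i <= d)%N -> Fi n i `&` kcyc i = D @` Fi n i.+1.
  move=> nn id; apply/seteqP; split.
    rewrite setIC; apply: subset_trans (Hn0 (n - i)%N i _ id) _; first lia.
    by apply: image_subset; rewrite /Fi (_ : n - i.+1 = (n - i).-1)%N //; lia.
  move=> f Hf; split; last exact: kbnd_sub (DFB n i f Hf).
  case: Hf => g Hg <-; rewrite /Fi (_ : n - i = (n - i.+1).+1)%N; last lia.
  by apply: koszul_diff_kpart => //; exact: submodule_xpow.
have fz n i : (n0 + d < n)%N -> (i <= d)%N ->
    haslen (D @` Fi n i.+1) (kcyc i) (len (Fi n i) (smsum (Fi n i) (kcyc i))).
  move=> nn id; rewrite -ac //; apply/haslen_second_iso => //.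
  apply: lenP; apply: finlen_sub (ex_intro _ _ (fFK n i)) _ _ _ => //.
    exact: smsumSl.
  by apply: smsum_lub => //; exact: kcyc_sub.
have fzl n i : (n0 + d < n)%N -> (i <= d)%N ->
    len (Fi n i) (smsum (Fi n i) (kcyc i)) = (b n i + h i)%N.
  move=> nn id; have H := fz n i nn id; rewrite -(lenE H).
  by rewrite (@lenD _ _ _ (kbnd i)) //; [exact: kbnd_sub|exists (len (Fi n i) (smsum (Fi n i) (kcyc i)))].
split=> [i id|].
  have nn : (n0 + d < (n0 + d).+1)%N by [].
  by apply: finlen_sub (ex_intro _ _ (fz _ _ nn id)) _ _ _ => //; exact: kbnd_sub.
exists (n0 + d).+1 => n nn.
have main i : (i <= d)%N -> ('C(d, i) * len (xpow x (n - i) setT) (setT : set V))%N =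
    (b n i + h i + (if i is j.+1 then b n j else 0))%N.
  move=> id; rewrite -(lenE (fFK n i)).
  have FS : Fi n i `<=` smsum (Fi n i) (kcyc i) by exact: smsumSl.
  have SK : smsum (Fi n i) (kcyc i) `<=` kpart i setT.
    by apply: smsum_lub => //; exact: kcyc_sub.
  have sS : submodule (smsum (Fi n i) (kcyc i)) by exact: submodule_smsum.
  rewrite (lenD (sF n i) sS (sK i) FS SK); last by eexists; exact: fFK.
  rewrite fzl //; congr (_ + _)%N.
  have fS : finlen (smsum (Fi n i) (kcyc i)) (kpart i setT).
    by apply: finlen_sub (ex_intro _ _ (fFK n i)) _ _ _.
  case: i id FS SK sS fS => [|j] jd FS SK sS fS.
    rewrite (_ : smsum _ _ = kpart 0 setT) ?len0 //.
    by apply/seteqP; split=> //; rewrite kcyc0; exact: smsumSr.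
  have ker f : kpart j.+1 setT f -> koszul_diff x f = 0 -> smsum (Fi n j.+1) (kcyc j.+1) f.
    by move=> Kf f0; apply: smsumSr => //; split.
  have [+ _] := haslen_image (g := @koszul_diff A d x V)
    (len (smsum (Fi n j.+1) (kcyc j.+1)) (kpart j.+1 setT)) sS (sK j.+1) SK ker.
  move=> /(_ (lenP fS)) /lenE <-; rewrite /b; congr (len _ _).
  apply/seteqP; split=> [_ [_ [u [v [Fu [_ v0] ->]]] <-]|]; last exact: image_subset.
  by exists u => //; rewrite linearD /= v0 addr0.
pose G i : F := (-1) ^+ i * (b n i)%:R.
transitivity (\sum_(i < d.+1) ((-1) ^+ i * (h i)%:R + (G i - (if (i : nat) is j.+1 then G j else 0)))).
  apply: eq_bigr => -[i /= id] _; rewrite main // !natrD.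
  case: i id => [|i] id /=; rewrite /G ?expr0 ?exprS; ring.
rewrite big_split /= -[RHS]addr0; congr (_ + _).
have tel k : \sum_(i < k.+1) (G i - (if (i : nat) is j.+1 then G j else 0)) = G k.
  elim: k => [|k IH]; first by rewrite big_ord1 subr0.
  by rewrite big_ord_recr IH /= addrC subrK.
(* The end of the telescope vanishes: there are no chains in degree d + 1. *)
rewrite tel /G (_ : b n d = 0%N) ?mulr0 //.
rewrite /b /Fi /kbnd !kpart_top //; last exact: submodule_xpow.
by rewrite len0 //; apply: submodule_image; exact: submodule1.
Qed.

End KoszulEuler.

(** * Functions of polynomial growth *)

Section Asymptotics.
Variable F : realType.
Implicit Types (u : nat -> F).

(** With [n.+1] in place of n the bound does not degenerate at n = 0 and can be asked for all n. *)
Definition polyO (e : nat) u := exists2 C : F, 0 <= C & forall n, `|u n| <= C * n.+1%:R ^+ e.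

Lemma polyO_le e e' u : (e <= e')%N -> polyO e u -> polyO e' u.
Proof.
move=> ee [C C0 H]; exists C => // n; apply: le_trans (H n) _.
by apply: ler_wpM2l => //; apply: ler_weXn2l => //; rewrite ler1n.
Qed.

Lemma polyO_sum e u v w : (forall n, 0 <= w n <= u n + v n) ->
  polyO e u -> polyO e v -> polyO e w.
Proof.
move=> H [C C0 HC] [D D0 HD]; exists (C + D); first exact: addr_ge0.
move=> n; have /andP[w0 wuv] := H n; rewrite ger0_norm // mulrDl.
by apply: le_trans wuv _; apply: lerD; [apply: le_trans (HC n)|apply: le_trans (HD n)]; exact: ler_norm.
Qed.

Lemma polyO_const e u (C : F) : (forall n, `|u n| <= C) -> polyO e u.
Proof.
move=> H; apply: (polyO_le (leq0n e)); exists C => [|n]; last by rewrite expr0 mulr1.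
exact: le_trans (normr_ge0 _) (H 0%N).
Qed.

(** Up to n, u gains at most n terms of degree e on top of [u 0]; hence the degree e + 1 and the
    constant [u 0 + C]. *)
Lemma polyO_step e u v : (forall n, 0 <= u n) -> (forall n, u n.+1 <= u n + v n) ->
  polyO e v -> polyO e.+1 u.
Proof.
move=> u0 H [C C0 HC]; exists (u 0%N + C); first exact: addr_ge0.
have pos n : (0 : F) <= n.+1%:R ^+ e by apply: exprn_ge0; exact: ler0n.
have step n : u n <= u 0%N + C * (n%:R * n.+1%:R ^+ e).
  elim: n => [|n IH]; first by rewrite mul0r mulr0 addr0.
  apply: le_trans (H n) _; apply: le_trans (lerD IH (le_trans (ler_norm _) (HC n))) _.
  rewrite -addrA lerD2l -mulrDr ler_wpM2l // -[X in _ + X]mul1r -mulrDl -natr1.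
  apply: ler_wpM2l; first by rewrite natr1.
  by apply: lerXn2r; rewrite ?nnegrE ?ler0n // natr1 // ler_nat.
move=> n; rewrite ger0_norm //; apply: le_trans (step n) _.
rewrite mulrDl lerD //.
  by rewrite ler_peMr // exprn_ege1 // ler1n.
apply: ler_wpM2l => //; rewrite exprS; apply: ler_wpM2r => //.
by rewrite ler_nat.
Qed.

Lemma polyO_cvg0 e d u : (e < d)%N -> polyO e u ->
  (fun n => u n / n%:R ^+ d) @ \oo --> (0 : F).
Proof.
move=> ed [C C0 H].
suff : (fun n => `|u n / n%:R ^+ d|) @ \oo --> (0 : F) by move/norm_cvg0P.
(* The power of 2 comes from n + 1 <= 2 n for n > 0. *)
have lim0 : (fun n => C * 2 ^+ e.+1 * harmonic n) @ \oo --> (0 : F).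
  by rewrite -[0](mulr0 (C * 2 ^+ e.+1)); apply: cvgMl_tmp; exact: cvg_harmonic.
apply: (squeeze_cvgr _ (cvg_cst (0 : F)) lim0).
near=> n; rewrite normr_ge0 /=.
have n0 : (0 < n)%N by near: n; exact: nbhs_infty_gt.
have np k : (0 : F) < n%:R ^+ k by rewrite exprn_gt0 // ltr0n.
rewrite normrM normfV (ger0_norm (ltW (np d))) ler_pdivrMr //.
apply: le_trans (H n) _; rewrite -!mulrA; apply: ler_wpM2l => //.
rewrite /harmonic /= mulrCA ler_pdivlMl ?ltr0n // -exprS.
apply: (@le_trans _ _ ((2 * n%:R) ^+ e.+1)).
  apply: lerXn2r; rewrite ?nnegrE ?mulr_ge0 ?ler0n // -natrM ler_nat; lia.
rewrite exprMn; apply: ler_wpM2l; first by rewrite exprn_ge0.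
by apply: ler_weXn2l => //; rewrite ler1n.
Unshelve. all: by end_near.
Qed.

Lemma cvg_subn_div c : (fun n => (n - c)%:R / n%:R) @ \oo --> (1 : F).
Proof.
have H : (fun n => 1 - (c%:R : F) / n%:R ^+ 1) @ \oo --> (1 : F).
  rewrite -[X in _ --> X]subr0; apply: cvgB; first exact: cvg_cst.
  apply: (@polyO_cvg0 0 1 (fun=> c%:R)) => //.
  by apply: (@polyO_const _ _ c%:R) => n; rewrite ger0_norm.
apply: cvg_trans H; apply: near_eq_cvg; near=> n.
have n0 : (0 < n)%N by near: n; exact: nbhs_infty_gt.
have cn : (c <= n)%N by near: n; exact: nbhs_infty_ge.
by rewrite expr1 natrB // mulrBl divff // pnatr_eq0 -lt0n.
Unshelve. all: by end_near.
Qed.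

Lemma cvg_ffact d : (fun n => (n ^_ d)%:R / n%:R ^+ d) @ \oo --> (1 : F).
Proof.
elim: d => [|d IH].
  by under eq_fun do rewrite ffactn0 expr0 divr1; exact: cvg_cst.
have -> : (fun n => (n ^_ d.+1)%:R / n%:R ^+ d.+1) =
    (fun n => ((n ^_ d)%:R / n%:R ^+ d) * ((n - d)%:R / n%:R)) :> (nat -> F).
  by apply/funext => n; rewrite ffactnSr natrM exprSr invfM mulrACA.
by rewrite -[X in _ --> X]mulr1; apply: cvgM => //; exact: cvg_subn_div.
Qed.

(** For the comparison by Artin-Rees, which shifts the argument of a Hilbert function by a
    constant. *)
Lemma cvg_shift_down d c u (a : F) :
  (fun n => u n / n%:R ^+ d) @ \oo --> a ->
  (fun n => u (n - c)%N / n%:R ^+ d) @ \oo --> a.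
Proof.
move=> H.
have H1 : (fun n => u (n - c)%N / (n - c)%:R ^+ d) @ \oo --> a.
  apply: (cvg_comp (fun n => n - c)%N (fun n => u n / n%:R ^+ d) _ H).
  exact: cvg_subnr.
have H2 : (fun n => (u (n - c)%N / (n - c)%:R ^+ d) * ((n - c)%:R / n%:R) ^+ d) @ \oo --> a.
  rewrite -[X in _ --> X]mulr1 -[X in _ * X](expr1n _ d); apply: cvgM => //.
  elim: d {H H1} => [|d IH].
    by under eq_fun do rewrite expr0; rewrite expr0; exact: cvg_cst.
  under eq_fun do rewrite exprS; rewrite exprS; apply: cvgM => //.
  exact: cvg_subn_div.
apply: cvg_trans H2; apply: near_eq_cvg; near=> n.
have cn : (c < n)%N by near: n; exact: nbhs_infty_gt.
have nc : (n - c)%:R != 0 :> F by rewrite pnatr_eq0 subn_eq0 -ltnNge.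
have n0 : n%:R != 0 :> F by rewrite pnatr_eq0; lia.
by rewrite expr_div_n mulrA divfK // expf_neq0.
Unshelve. all: by end_near.
Qed.

Definition fdiff u : nat -> F := fun n => u n.+1 - u n.

Lemma iter_fdiffE d u k : iter d fdiff u k =
  \sum_(i < d.+1) (-1) ^+ i * 'C(d, i)%:R * u (k + d - i)%N.
Proof.
elim: d u k => [|d IH] u k.
  by rewrite big_ord1 expr0 bin0 !mul1r addn0 subn0.
rewrite iterSr IH /fdiff.
pose v i := u (k + d.+1 - i)%N.
pose G (i : nat) := (-1) ^+ i * 'C(d, i)%:R * v i.
have -> : \sum_(i < d.+2) (-1) ^+ i * 'C(d.+1, i)%:R * u (k + d.+1 - i)%N =
    \sum_(i < d.+2) G i - \sum_(i < d.+1) (-1) ^+ i * 'C(d, i)%:R * v i.+1.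
  rewrite [LHS]big_ord_recl [\sum_(i < d.+2) G i]big_ord_recl -addrA -sumrB.
  congr (_ + _); first by rewrite /G !bin0.
  apply: eq_bigr => i _; rewrite /G lift0 /= binS natrD exprS /v; ring.
rewrite [\sum_(i < d.+2) _]big_ord_recr /= {2}/G bin_small // mulr0 mul0r addr0.
rewrite -sumrB; apply: eq_bigr => -[i /= id] _; rewrite /G /v.
have -> : (k + d - i).+1 = (k + d.+1 - i)%N by lia.
have -> : (k + d.+1 - i.+1 = k + d - i)%N by lia.
by rewrite mulrBr.
Qed.

(** Each summation raises the degree by one; [polyO_step] is applied to absolute values because the
    differences may have any sign. *)
Lemma iter_fdiff_polyO d u :
  (exists N, forall n, (N <= n)%N -> iter d.+1 fdiff u n = 0) -> polyO d u.
Proof.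
elim: d u => [|d IH] u [N HN].
  have H n : (N <= n)%N -> u n = u N.
    move=> /subnK <-; elim: (n - N)%N => // k IHk.
    by have /eqP := HN _ (leq_addl k N); rewrite subr_eq0 => /eqP ->.
  apply: (@polyO_const _ _ (\sum_(i < N.+1) `|u i|)) => n.
  have le i : (i <= N)%N -> `|u i| <= \sum_(i < N.+1) `|u i|.
    move=> iN; rewrite (bigD1 (Ordinal (iN : (i < N.+1)%N))) //= lerDl.
    exact: sumr_ge0.
  case: (leqP n N) => nN; first exact: le.
  by rewrite (H _ (ltnW nN)); exact: le.
have Hd : polyO d (fdiff u) by apply: IH; exists N => n /HN; rewrite -iterSr.
have : polyO d.+1 (fun n => `|u n|).
  apply: (@polyO_step _ _ (fun n => `|fdiff u n|)) => // [n|].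
    by rewrite -{1}[u n.+1](subrK (u n)) addrC; exact: ler_normD.
  by have [C C0 H] := Hd; exists C => // n; rewrite normr_id.
by move=> [C C0 H]; exists C => // n; have := H n; rewrite normr_id.
Qed.

Lemma iter_fdiff_bin d n : iter d fdiff (fun n => 'C(n, d)%:R) n = 1.
Proof.
elim: d n => [|d IH] n; first by rewrite /= bin0.
rewrite iterSr -[RHS](IH n); congr (iter d fdiff _ n); apply/funext => k.
by rewrite /fdiff binS natrD addrAC subrr add0r.
Qed.

Lemma fdiff_linear d u v (c : F) :
  iter d fdiff (fun n => u n - c * v n) = (fun n => iter d fdiff u n - c * iter d fdiff v n).
Proof.
elim: d u v => // d IH u v; rewrite !iterSr -IH; congr iter.
by apply/funext => n; rewrite /fdiff; ring.
Qed.

(** Subtracting c 'C(n, d), whose d-th difference is c, leaves a function [w] of degree below d, and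
    d! 'C(n, d) is the falling factorial, asymptotic to n^d. *)
Lemma fdiff_const_cvg d u (c : F) :
  (exists N, forall n, (N <= n)%N -> iter d fdiff u n = c) ->
  (fun n => d`!%:R * u n / n%:R ^+ d) @ \oo --> c.
Proof.
move=> [N HN]; pose w n := u n - c * 'C(n, d)%:R.
have Hw n : (N <= n)%N -> iter d fdiff w n = 0.
  by move=> /HN H; rewrite /w fdiff_linear iter_fdiff_bin H mulr1 subrr.
have w0 : (fun n => w n / n%:R ^+ d) @ \oo --> (0 : F).
  (* For d = 0 no degree d - 1 exists; there w itself is eventually 0. *)
  case: d @w HN Hw => [|d] w HN Hw.
    have c0 : (fun=> 0 : F) @ \oo --> (0 : F) by exact: cvg_cst.
    apply: cvg_trans c0; apply: near_eq_cvg; near=> n.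
    have Nn : (N <= n)%N by near: n; exact: nbhs_infty_ge.
    by have := Hw n Nn => /= ->; rewrite mul0r.
  by apply: (@polyO_cvg0 d) => //; apply: iter_fdiff_polyO; exists N.
have -> : (fun n => d`!%:R * u n / n%:R ^+ d) =
   (fun n => d`!%:R * (w n / n%:R ^+ d) + c * ((n ^_ d)%:R / n%:R ^+ d)).
  apply/funext => n; rewrite /w -bin_ffact natrM; ring.
rewrite -[X in _ --> X]add0r; apply: cvgD.
  by rewrite -[X in _ --> X](mulr0 d`!%:R); exact: cvgMl_tmp.
by rewrite -[X in _ --> X]mulr1; apply: cvgMl_tmp; exact: cvg_ffact.
Unshelve. all: by end_near.
Qed.

End Asymptotics.

(** * Hilbert-Samuel multiplicity *)

Section SimpleQuotients.
Variables (A : comNzRingType) (V : lmodType A).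

(** An element of Av + Q outside Q has a unit as coefficient of v, so together with Q it generates
    v. Applied over the local ring A and over its localizations. *)
Lemma haslen_simple (Q : set V) v : submodule Q -> ~ Q v ->
  (forall a : A, ~ Q (a *: v) -> exists b, b * a = 1) ->
  haslen Q (smsum (line v) Q) 1.
Proof.
move=> sQ Qv H; have sL := submodule_line v.
have sub (X : set V) : submodule X -> Q `<=` X -> X v -> smsum (line v) Q `<=` X.
  by move=> sX QX Xv; apply: smsum_lub => //; exact: line_sub.
split=> /=.
  exists Q; split=> //; first exact: smsumSr.
  by move=> PQ; apply: Qv; apply: PQ; apply: smsumSl => //; exact: line_id.
move=> [|[|k]] //= [X [sX [Y [sY /ch_sub QY YX XY]] XP PX]].
exfalso; apply: PX; apply: sub => //; first exact: subset_trans YX.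
apply: contrapT => Xv; apply: XY => w Xw.
have [_ [q [[a _ <-] Qq wE]]] := XP w Xw.
have [Qa|/H[b ba]] := pselect (Q (a *: v)).
  by rewrite wE; apply: QY; exact: submoduleD.
exfalso; apply: Xv; rewrite -[v]scale1r -ba -scalerA; apply: submoduleZ => //.
have -> : a *: v = w - q by rewrite wE addrK.
by apply: submoduleB => //; apply: YX; exact: QY.
Qed.

End SimpleQuotients.

Section LocalRing.
Variables (A : comNzRingType) (m : idealr A).
Hypothesis local_m : local_ring m.

Lemma local_unit a : a \notin m -> exists b, b * a = 1.
Proof.
move=> am; apply: contrapT => no; case/negP: am.
pose S : {pred A} := fun y => `[< exists b, y = b * a >].
have S_closed : idealr_closed S.
  split; first by apply/asboolP; exists 0; rewrite mul0r.
    by apply/asboolP => -[b bE]; apply: no; exists b.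
  move=> c y z /asboolP[b ->] /asboolP[b' ->]; apply/asboolP.
  by exists (c * b + b'); rewrite mulrDl mulrA.
pose I : idealr A := HB.pack S (isIdealr.Build A S S_closed).
apply: (local_m (I := I)); apply/asboolP; exists 1; by rewrite mul1r.
Qed.

Lemma prime_set_sub_max (p : set A^o) a : prime_set p -> p a -> a \in m.
Proof.
move=> [sp p1 _] pa; apply: contrapT => /negP/local_unit[b ba].
by apply: p1; rewrite -ba; exact: (submoduleZ b sp pa).
Qed.

Lemma prime_set_max : prime_set [set a : A^o | a \in m].
Proof.
split=> [|/=|a b /= ab]; last 2 first.
- by rewrite idealr1.
- apply: contrapT => /not_orP[/negP/local_unit[a' aa] /negP bm].
  by case/negP: bm; rewrite -[b]mul1r -aa -mulrA; exact: idealMr.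
split=> [|a u v /= um vm]; first exact: idealr0.
by apply: rpredD => //; exact: (idealMr a um).
Qed.

End LocalRing.

Section Multiplicity.
Variables (A : comNzRingType) (m : idealr A) (d : nat) (x : 'I_d -> A).
Hypothesis accA : acc (setT : set A^o).
Hypothesis local_m : local_ring m.
Hypothesis sop_x : is_sop m x.

Lemma xpow_X i n : xpow x n (setT : set A^o) (x i ^+ n).
Proof.
elim: n => // n IH; rewrite exprS.
exact: (xmulZ x i (submodule_xpow x n (@submoduleT _ _)) IH).
Qed.

Lemma prime_setX (p : set A^o) (a : A) n : prime_set p -> p (a ^+ n) -> p a.
Proof.
move=> [_ p1 pM]; elim: n => [|n IH]; first by move=> /p1.
by rewrite exprS => /pM[].
Qed.

Lemma prime_sop (p : set A^o) a : prime_set p -> (forall i, p (x i)) -> a \in m -> p a.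
Proof.
move=> pp px am; have [n /asboolP[c cE]] := sop_x.2 a am.
apply: (prime_setX (n := n) pp); rewrite cE; have [sp _ _] := pp.
apply: (@submodule_sum A A^o _ _ _ _ (fun i => c i *: (x i : A^o)) sp) => i _.
exact: (submoduleZ (c i) sp (px i)).
Qed.

Section Lengths.
Variable V : lmodType A.
Implicit Types (N P Q : set V).

(** Each prime in a filtration of P / N contains the n-th powers of the x_i, hence the x_i, hence m;
    so every quotient of the filtration is simple. *)
Lemma finlen_quot N P n : acc P -> submodule N -> submodule P -> N `<=` P ->
  xpow x n P `<=` N -> finlen N P.
Proof.
move=> aP sN sP NP IN; apply: (@devissage A V (finlen N) N P) => //.
  by exists 0%N; exact: haslen0.
move=> Q v sQ NQ QP fQ Pv pv.
apply: (finlen_trans sN sQ _ fQ).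
  by apply: submodule_smsum => //; exact: submodule_line.
exists 1%N; apply: haslen_simple => // [Qv|a Qav].
  by have [_ p1 _] := pv; apply: p1; rewrite /colon /= scale1r.
apply: (local_unit local_m); apply/negP => am; apply: Qav.
apply: (prime_sop pv _ am) => i; apply: (prime_setX (n := n) pv).
by rewrite /colon /=; apply/NQ/IN; apply: xpow_smul => //; exact: xpow_X.
Qed.

(* The Hilbert-Samuel function of P / N. *)
Definition hs N P n := len (smsum N (xpow x n P)) P.

Lemma finlen_hs N P n : acc P -> submodule N -> submodule P -> N `<=` P ->
  finlen (smsum N (xpow x n P)) P.
Proof.
move=> aP sN sP NP; have sX := submodule_xpow x n sP.
apply: (@finlen_quot _ _ n) => //; first exact: submodule_smsum.
  by apply: smsum_lub => //; exact: xpow_sub.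
exact: smsumSr.
Qed.

(** The first summand belongs to the filtration that P induces on Q, not to the I^n Q; Artin-Rees
    compares the two. *)
Lemma hs_split N Q P n : acc P -> submodule N -> submodule Q -> submodule P ->
  N `<=` Q -> Q `<=` P ->
  hs N P n = (len (smsum N (xpow x n P) `&` Q) Q + hs Q P n)%N.
Proof.
move=> aP sN sQ sP NQ QP; have sX := submodule_xpow x n sP.
have NP : N `<=` P by exact: subset_trans QP.
have sNX := submodule_smsum sN sX.
have XP : smsum N (xpow x n P) `<=` P by apply: smsum_lub => //; exact: xpow_sub.
have QX : smsum Q (xpow x n P) `<=` P by apply: smsum_lub => //; exact: xpow_sub.
have f := finlen_hs n aP sN sP NP.
rewrite /hs (lenD sNX (submodule_smsum sQ sX) sP) //; last exact: smsumS.
congr (_ + _)%N.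
have E : smsum (smsum N (xpow x n P)) Q = smsum Q (xpow x n P).
  apply/seteqP; split.
    apply: smsum_lub; [exact: submodule_smsum|exact: smsumS|exact: smsumSl].
  apply: smsum_lub; [exact: submodule_smsum|exact: smsumSr|].
  exact: subset_trans (smsumSr sN) (smsumSl sQ).
rewrite -E; apply/esym/lenE; apply/haslen_second_iso => //; apply: lenP.
by rewrite E; apply: finlen_sub f _ _ _ => //; exact: smsumS.
Qed.

Lemma hs_sub N Q P n : acc P -> submodule N -> submodule Q -> submodule P ->
  N `<=` Q -> Q `<=` P -> (len (smsum N (xpow x n P) `&` Q) Q <= hs N Q n)%N.
Proof.
move=> aP sN sQ sP NQ QP; apply: len_sub.
- by apply: finlen_hs => //; exact: acc_sub aP.
- apply: smsum_lub; first by apply: submoduleI => //; apply: submodule_smsum => //; exact: submodule_xpow.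
    by move=> v Nv; split; [apply: smsumSl => //; exact: submodule_xpow|exact: NQ].
  move=> v Iv; split; last exact: xpow_sub Iv.
  by apply: smsumSr => //; exact: xpowS Iv.
- exact: subIsetr.
- exact: subset_refl.
Qed.

Lemma hs_subadd N Q P n : acc P -> submodule N -> submodule Q -> submodule P ->
  N `<=` Q -> Q `<=` P -> (hs N P n <= hs N Q n + hs Q P n)%N.
Proof.
by move=> aP sN sQ sP NQ QP; rewrite (hs_split n aP sN sQ sP) // leq_add2r hs_sub.
Qed.

Definition has_mult (F : realType) N P (e : F) :=
  (fun n => d`!%:R * (hs N P n)%:R / n%:R ^+ d) @ \oo --> e.

Lemma has_mult0 (F : realType) N : submodule N -> has_mult N N (0 : F).
Proof.
move=> sN; rewrite /has_mult (_ : (fun n => _) = fun=> 0); first exact: cvg_cst.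
apply/funext => n; rewrite /hs (_ : smsum _ _ = N) ?len0 ?mulr0 ?mul0r //.
apply/seteqP; split; first by apply: smsum_lub => //; exact: xpow_sub.
by apply: smsumSl; exact: submodule_xpow.
Qed.

(** N + I^n Q is contained in (N + I^n P) & Q, and by the modular law and Artin-Rees the latter is
    contained in N + I^(n-c) Q. So the induced Hilbert function [g] is squeezed between that of Q /
    N and its shift by c. *)
Lemma has_multD (F : realType) N Q P (a b : F) (s : seq V) : P = span s ->
  submodule N -> submodule Q -> N `<=` Q -> Q `<=` P ->
  has_mult N Q a -> has_mult Q P b -> has_mult N P (a + b).
Proof.
move=> PE sN sQ NQ QP Ha Hb.
have sP : submodule P by rewrite PE; exact: submodule_span.
have aP : acc P by rewrite PE; exact: acc_span.
have [c Hc] := artin_rees x accA s sQ.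
pose g n := len (smsum N (xpow x n P) `&` Q) Q.
rewrite /has_mult (_ : (fun n => _) = fun n =>
    d`!%:R * (g n)%:R / n%:R ^+ d + d`!%:R * (hs Q P n)%:R / n%:R ^+ d); last first.
  by apply/funext => n; rewrite (hs_split n aP sN sQ sP) // natrD mulrDr mulrDl.
apply: cvgD => //.
apply: (squeeze_cvgr _ (cvg_shift_down c Ha) Ha); near=> n.
have cn : (c <= n)%N by near: n; exact: nbhs_infty_ge.
have nd : (0 : F) <= (n%:R ^+ d)^-1 by rewrite invr_ge0 exprn_ge0.
apply/andP; split; (apply: ler_wpM2r => //; apply: ler_wpM2l; first exact: ler0n);
    rewrite ler_nat; last exact: hs_sub.
apply: len_sub; last exact: subset_refl.
  - apply: (@finlen_quot _ _ n) => //; first exact: acc_sub aP.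
    + apply: submoduleI => //; apply: submodule_smsum => //; exact: submodule_xpow.
    + move=> v Iv; split; last exact: xpow_sub Iv.
      by apply: smsumSr => //; exact: xpowS Iv.
  - apply: subset_trans (smsum_modular sQ NQ) _; apply: smsumS => //.
    rewrite setIC PE; apply: subset_trans (Hc n cn) _.
    by apply: xpowS; exact: subIsetl.
  - by apply: smsum_lub => //; exact: xpow_sub.
Unshelve. all: by end_near.
Qed.

End Lengths.

Section Transfer.
Variable V : lmodType A.
Implicit Types (N P Q : set V).

Lemma haslen_cyclic N v k : submodule N ->
  haslen (colon N v) setT k <-> haslen N (smsum (line v) N) k.
Proof.
move=> sN; have sL := submodule_line v.
have lin : linear (fun a : A^o => (a : A) *: v).
  by move=> a b c; rewrite scalerDl -scalerA.
pose g : {linear A^o -> V} :=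
  HB.pack (fun a : A^o => (a : A) *: v) (GRing.isLinear.Build A A^o V *:%R _ lin).
have E : smsum N (line v) = smsum (line v) N.
  by apply/seteqP; split=> w [a [b [? ? ->]]]; exists b, a; rewrite addrC.
rewrite -E; apply: (iff_trans _ (haslen_second_iso k sN sL)).
have -> : N `&` line v = g @` colon N v.
  apply/seteqP; split=> [w [Nw [a _ aE]]|w [a Na <-]].
    by exists a => //; rewrite /colon /= aE.
  by split=> //; exists a.
rewrite -[line v]/(g @` setT).
apply: haslen_image => //; first exact: submodule_colon.
by move=> a _ ga0; rewrite /colon /= -[a *: v]/(g a) ga0; exact: submodule0.
Qed.

Lemma xpow_line n (v : V) : xpow x n (line v) = 
  (fun a : A^o => (a : A) *: v) @` xpow x n (setT : set A^o).
Proof.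
elim: n => [|n IH] //; rewrite [LHS]/= -/(xpow x n _) IH.
apply/seteqP; split=> [_ [w [Hw ->]]|_ [_ [w [Hw ->]] <-]].
  have /choice[a Ha] : forall i, exists a : A^o, xpow x n setT a /\ (a : A) *: v = w i.
    by move=> i; have [a ? ?] := Hw i; exists a.
  exists (\sum_i x i * a i); first by exists a; split=> // i; have [] := Ha i.
  rewrite scaler_suml; apply: eq_bigr => i _.
  by have [_ <-] := Ha i; rewrite scalerA.
rewrite scaler_suml; exists (fun i => (w i : A) *: v); split=> [i|].
  by exists (w i) => //; exact: Hw.
by apply: eq_bigr => i _; rewrite scalerA.
Qed.

(** N + I^n (Av + N) equals N + I^n v, and its colon ideal by v is (N : v) + I^n; [haslen_cyclic]
    then compares the lengths. *)
Lemma hs_cyclic N v n : submodule N -> acc (setT : set V) ->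
  hs N (smsum (line v) N) n = hs (colon N v) setT n.
Proof.
move=> sN aV; have sL := submodule_line v.
have sLN := submodule_smsum sL sN.
have sT := submodule_xpow x n (@submoduleT A A^o).
have sX := submodule_xpow x n sLN.
have sXL := submodule_xpow x n sL.
set M := smsum N (xpow x n (smsum (line v) N)).
have sM : submodule M by exact: submodule_smsum.
have ME : M = smsum N (xpow x n (line v)).
  apply/seteqP; split; last first.
    by apply: smsumS => //; apply: xpowS; exact: smsumSl.
  have sS : submodule (smsum N (xpow x n (line v))) by exact: submodule_smsum.
  apply: smsum_lub => //; first exact: smsumSl.
  apply: subset_trans (xpow_smsum sL sN) _; apply: smsum_lub => //; first exact: smsumSr.
  by apply: subset_trans (smsumSl sXL); exact: xpow_sub.
have NM : N `<=` M by exact: smsumSl.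
have PE : smsum (line v) N = smsum (line v) M.
  apply/seteqP; split; first exact: smsumS.
  apply: smsum_lub => //; first exact: smsumSl.
  apply: smsum_lub => //; first exact: smsumSr.
  exact: xpow_sub.
have cE : colon M v = smsum (colon N v) (xpow x n setT).
  apply/seteqP; split=> [a|_ [b [c [Nb Ic ->]]]]; rewrite /colon /=; last first.
    rewrite scalerDl ME; exists (b *: v), (c *: v); split=> //.
    by rewrite xpow_line; exists c.
  rewrite ME xpow_line => -[w [_ [Nw [c Ic <-] aE]]].
  exists (a - c), c; split=> //; last by rewrite subrK.
  suff : N ((a : A) *: v - (c : A) *: v) by rewrite -scalerBl.
  by rewrite aE addrK.
rewrite /hs -/M -cE; apply/esym/lenE; apply/haslen_cyclic => //.
rewrite -PE; apply: lenP; apply: finlen_hs => //; last exact: smsumSr.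
exact: acc_sub aV.
Qed.

Lemma has_mult_cyclic (F : realType) N v (e : F) : submodule N -> acc (setT : set V) ->
  has_mult (colon N v) setT e -> has_mult N (smsum (line v) N) e.
Proof.
by move=> sN aV; rewrite /has_mult; under [in X in _ -> X]eq_fun do rewrite hs_cyclic //.
Qed.

End Transfer.
End Multiplicity.

(** * Existence of multiplicities, and their vanishing in smaller dimension *)

Section MultiplicityTheory.
Variables (A : comNzRingType) (m : idealr A) (d : nat) (x : 'I_d -> A) (F : realType).
Hypothesis accA : acc (setT : set A^o).
Hypothesis local_m : local_ring m.
Hypothesis sop_x : is_sop m x.

Lemma xpow_image (V W : lmodType A) (g : {linear V -> W}) n N :
  g @` xpow x n N = xpow x n (g @` N).
Proof.
elim: n => //= n IH; rewrite -IH; apply/seteqP; split=> [_ [_ [v [Hv ->]] <-]|_ [w [Hw ->]]].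
  exists (fun i => g (v i)); split=> [i|]; first by exists (v i).
  by rewrite linear_sum; apply: eq_bigr => i _ /=; rewrite linearZ.
have /choice[v Hv] : forall i, exists v, xpow x n N v /\ g v = w i.
  by move=> i; have [v ? ?] := Hw i; exists v.
exists (\sum_i x i *: v i); first by exists v; split=> // i; have [] := Hv i.
by rewrite linear_sum; apply: eq_bigr => i _ /=; rewrite linearZ /=; have [_ ->] := Hv i.
Qed.

Lemma hs_quotmod (V : lmodType A) (N : submodClosed V) n : acc (setT : set V) ->
  hs x [set v | v \in N] setT n = hs x [set 0] (setT : set (quotmod N)) n.
Proof.
move=> aV; set S := [set v | v \in N].
have sS : submodule S by apply/submod_closed_submodule; exact: submodClosedP.
have sX := submodule_xpow x n (@submoduleT A V).
have f := finlen_hs accA local_m sop_x n aV sS (@submoduleT _ _) (@subsetT _ _).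
have pi0 v : S v -> quotmod_pi N v = 0.
  by move=> Nv; apply/eqP; rewrite -[0](raddf0 (@quotmod_pi _ _ N)) eq_quotmod subr0.
have ker v : setT v -> quotmod_pi N v = 0 -> smsum S (xpow x n setT) v.
  move=> _ /eqP; rewrite -[0](raddf0 (@quotmod_pi _ _ N)) eq_quotmod subr0 => Sv.
  exact: smsumSl.
have [+ _] := haslen_image (g := @quotmod_pi _ _ N)
    (len (smsum S (xpow x n setT)) setT) (submodule_smsum sS sX) (@submoduleT _ _)
    (@subsetT _ _) ker.
move=> /(_ (lenP f)) H; rewrite [LHS]/hs; apply/esym/lenE.
have -> : (setT : set (quotmod N)) = quotmod_pi N @` setT.
  by apply/seteqP; split=> // y _; have [v ->] := quotmod_piP y; exists v.
rewrite -xpow_image.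
have -> : smsum [set 0] (quotmod_pi N @` xpow x n setT) =
    quotmod_pi N @` smsum S (xpow x n setT).
  apply/seteqP; split=> [w [a [b [a0 [v Hv vE] wE]]]|_ [_ [u [v [Su Hv ->]]] <-]].
    by rewrite wE a0 -vE; exists v; rewrite ?add0r //; exact: smsumSr.
  by exists 0, (quotmod_pi N v); split=> //; rewrite raddfD /= pi0.
exact: H.
Qed.

Definition koszul_chi (V : lmodType A) : F :=
  \sum_(i < d.+1) (-1) ^+ i * (len (@kbnd A d x V i) (@kcyc A d x V i))%:R.

Lemma finlen_xpow (V : lmodType A) (s : seq V) n : setT = span s ->
  finlen (xpow x n setT) (setT : set V).
Proof.
move=> sE; have sT := @submoduleT A V.
apply: (finlen_quot accA local_m sop_x (n := n)) => //; last exact: submodule_xpow.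
by rewrite sE; exact: acc_span.
Qed.

Lemma finlen_koszul (V : lmodType A) (s : seq V) i : setT = span s -> (i <= d)%N ->
  finlen (@kbnd A d x V i) (@kcyc A d x V i).
Proof.
move=> sE; have [H _] := koszul_euler F accA sE (fun n => finlen_xpow n sE).
exact: H.
Qed.

Lemma has_mult_koszul (V : lmodType A) (s : seq V) : setT = span s ->
  has_mult x [set 0] (setT : set V) (koszul_chi V).
Proof.
move=> sE; have [_ [n0 H]] := koszul_euler F accA sE (fun n => finlen_xpow n sE).
apply: fdiff_const_cvg; exists n0 => n n0n.
rewrite iter_fdiffE /koszul_chi -(H (n + d)%N); last exact: leq_trans n0n (leq_addr _ _).
apply: eq_bigr => i _; rewrite -mulrA natrM /hs; congr (_ * (_ * (len _ _)%:R)).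
have sX := submodule_xpow x (n + d - i) (@submoduleT A V).
apply/seteqP; split; last exact: smsumSr (@submodule1 _ _).
by apply: smsum_lub => // _ ->; exact: submodule0.
Qed.

Lemma acc_spanT (V : lmodType A) : acc (setT : set V) -> exists s : seq V, setT = span s.
Proof. by move=> aV; exact: (acc_fg aV). Qed.

Lemma span_quotmod (V : lmodType A) (N : submodClosed V) (s : seq V) : setT = span s ->
  setT = span [seq quotmod_pi N v | v <- s].
Proof.
move=> sE; apply/seteqP; split=> // y _; have [v ->] := quotmod_piP y.
have : span s v by rewrite -sE.
apply: (@span_sub _ _ s (quotmod_pi N @^-1` _)) => [|w ws].
  by apply: (submodule_preimage (@quotmod_pi _ _ N)); exact: submodule_span.
by apply: mem_span; apply: map_f.
Qed.

(** The Koszul complex takes its coefficients in a module, so the pair p, A is replaced by the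
    quotient module A / p, whose Euler characteristic is the limit. *)
Lemma has_mult_exists (p : set A^o) : submodule p -> exists e : F, has_mult x p setT e.
Proof.
move=> sp.
pose P : {pred A^o} := fun a => `[< p a >].
have P_closed : submod_closed P.
  have [p0 pD] := sp.
  by split=> [|a u v /asboolP pu /asboolP pv]; apply/asboolP => //; exact: pD.
pose N : submodClosed A^o := HB.pack P (GRing.isSubmodClosed.Build A A^o P P_closed).
have [s sE] := acc_spanT accA.
exists (koszul_chi (quotmod N)).
have := has_mult_koszul (span_quotmod N sE); rewrite /has_mult.
have -> : p = [set v | v \in N].
  by apply/seteqP; split=> v pv; [exact/asboolP|apply/asboolP].
by under [in X in _ -> X]eq_fun do rewrite hs_quotmod //.
Qed.

(** The multiplicity e(x; A / p) normalised by the number d of parameters instead of dim (A / p). *)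
Definition mult_quot (p : set A^o) : F :=
  lim ((fun n => d`!%:R * (hs x p setT n)%:R / n%:R ^+ d : F) @ \oo).

Lemma mult_quotP p : submodule p -> has_mult x p setT (mult_quot p).
Proof.
move=> sp; have [e He] := has_mult_exists sp.
by rewrite /mult_quot (cvg_lim _ He).
Qed.

(** For a prime p this says that dim (A / p) is at least k. *)
Fixpoint pchain (k : nat) (p : set A^o) : Prop :=
  if k is k'.+1 then exists q, [/\ prime_set q, p `<=` q, ~ q `<=` p & pchain k' q]
  else True.

(* With A/p a domain, x_i not in p and q = p + (x_i), exactness of
   0 -> A/p -> A/p -> A/q -> 0 gives hs p n.+1 <= hs p n + hs q n.+1, and the
   primes of a filtration of A/q strictly contain p. *)
Lemma hs_polyO e p : prime_set p -> ~ pchain e.+1 p ->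
  polyO e (fun n => (hs x p setT n)%:R : F).
Proof.
have sT := @submoduleT A A^o.
elim: e p => [|e IH] p pp nch; have [sp p1 pM] := pp;
    (have [px|/existsNP[i pxi]] := pselect (forall i, p (x i));
    first by
      (have fp : finlen p setT by
        [apply: (finlen_quot accA local_m sop_x (n := 1)) => // _ [v [_ ->]];
         apply: submodule_sum => // j _; rewrite -[x j *: v j]/(x j * (v j : A)) mulrC;
         exact: (submoduleZ (v j : A) sp (px j))|];
      apply: (@polyO_const _ _ _ (len p setT)%:R) => n;
      rewrite ger0_norm // ler_nat; apply: len_sub => //; exact/smsumSl/submodule_xpow)).
(* In degree 0 an x_i outside p would make m a prime strictly above p. *)
- exfalso; apply: nch; exists [set a : A^o | a \in m]; split=> //.
  + exact: prime_set_max.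
  + by move=> a pa; exact: (prime_set_sub_max local_m pp pa).
  + by move=> H; apply: pxi; apply: H => /=; exact: sop_x.1.
set b : A := x i.
pose q : set A^o := smsum (line (b : A^o)) p.
have sL := submodule_line (b : A^o).
have sq : submodule q by exact: submodule_smsum.
have pq : p `<=` q by exact: smsumSr.
have qb : q b by apply: smsumSl => //; exact: line_id.
have key n : (hs x p setT n.+1 <= hs x p setT n + hs x q setT n.+1)%N.
  rewrite (hs_split accA local_m sop_x n.+1 accA sp sq sT) // leq_add2r.
  have sX := submodule_xpow x n.+1 sT; have sXn := submodule_xpow x n sT.
  set M := smsum p (xpow x n.+1 setT).
  have sM : submodule M by exact: submodule_smsum.
  have pM' : p `<=` M by exact: smsumSl.
  have fM : finlen M setT by exact: (finlen_hs accA local_m sop_x).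
  have LM : smsum (line (b : A^o)) (M `&` q) = q.
    apply/seteqP; split.
      by apply: smsum_lub => //; exact: line_sub.
    by apply: smsumS => // a pa; split; [exact: pM'|exact: pq].
  have sMq : submodule (M `&` q) by exact: submoduleI.
  have fMq : finlen (M `&` q) q.
    have fq : finlen M (smsum M q).
      apply: finlen_sub fM _ _ _ => //; exact: smsumSl.
    by apply: (ex_intro _ _ _); apply/(haslen_second_iso _ sM sq); exact: lenP.
  have E : len (colon (M `&` q) (b : A^o)) setT = len (M `&` q) q.
    by apply: lenE; apply/haslen_cyclic => //; rewrite LM; exact: lenP.
  (* The colon ideal by b contains p, and also I^n because b = x_i takes I^n into I^(n+1). So the
     first term is at most the length of A / (p + I^n); this is where [n.+1] drops to n. *)
  rewrite -E.
  apply: len_sub; first exact: (finlen_hs accA local_m sop_x).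
  - apply: smsum_lub; first exact: submodule_colon.
      move=> a pa; rewrite /colon /=.
      have pab : p (a * b : A) by rewrite mulrC; exact: (submoduleZ b sp pa).
      by split; [exact: pM'|exact: pq].
    move=> a Ia; rewrite /colon /=; split.
      apply: smsumSr => //; rewrite -[_ *: _]/(a * b : A) mulrC.
      exact: (xmulZ x i sXn Ia).
    exact: submoduleZ.
  - exact: subsetT.
  - exact: subsetT.
have Hq : polyO e (fun n => (hs x q setT n)%:R : F).
  apply: (@devissage A A^o (fun Q => polyO e (fun n => (hs x q Q n)%:R : F)) q setT) => //.
    apply: (@polyO_const _ _ _ 0) => n; rewrite /hs (_ : smsum _ _ = q).
      by rewrite len0 // normr0.
    apply/seteqP; split; first by apply: smsum_lub => //; exact: xpow_sub.
    exact/smsumSl/submodule_xpow.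
  move=> Q v sQ qQ _ PQ _ pv.
  have sLv := submodule_line v.
  have aS : acc (smsum (line v) Q) by apply: acc_sub accA; exact: subsetT.
  have H : polyO e (fun n => (hs x (colon Q v) setT n)%:R : F).
    apply: IH => // ch; apply: nch; exists (colon Q v); split=> //.
      move=> a pa; rewrite /colon /= -[_ *: _]/((a : A) * (v : A)) mulrC.
      by apply: qQ; apply: pq; exact: (submoduleZ (v : A) sp pa).
    move=> H; apply: pxi; apply: H.
    rewrite /colon /= -[_ *: _]/((b : A) * (v : A)) mulrC; apply: qQ.
    exact: (submoduleZ (v : A) sq qb).
  apply: polyO_sum PQ H => n; rewrite ler0n -natrD ler_nat.
  rewrite -(hs_cyclic accA local_m sop_x) //.
  by apply: (hs_subadd accA local_m sop_x) => //; [exact: submodule_smsum|exact: smsumSr].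
have : polyO e (fun n => (hs x q setT n.+1)%:R : F).
  (* The factor pays for the shift by one: n + 2 <= 2 (n + 1). *)
  have [C C0 HC] := Hq; exists (C * 2 ^+ e); first by rewrite mulr_ge0 // exprn_ge0.
  move=> n; apply: le_trans (HC n.+1) _; rewrite -mulrA; apply: ler_wpM2l => //.
  rewrite -exprMn; apply: lerXn2r; rewrite ?nnegrE ?ler0n //.
  by rewrite -natrM ler_nat; lia.
apply: polyO_step => // n; by rewrite -natrD ler_nat.
Qed.

End MultiplicityTheory.

(** Growth of degree d - 1 vanishes against n^d. The case d = 0 is void, since [pchain 0 p] always
    holds. *)
Lemma mult_quot0 (A : comNzRingType) (m : idealr A) (d : nat) (x : 'I_d -> A) (F : realType)
    (p : set A^o) :
  acc (setT : set A^o) -> local_ring m -> is_sop m x -> prime_set p -> ~ pchain d p ->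
  mult_quot x F p = 0.
Proof.
case: d x => [|d] x aA local_m sop_x pp nch; first by case: nch.
apply: cvg_lim => //.
have := polyO_cvg0 (ltnSn d) (hs_polyO F aA local_m sop_x pp nch).
move/(cvgMl_tmp (a := d.+1`!%:R)); rewrite mulr0.
by under eq_fun do rewrite mulrA.
Qed.

(** * Lengths of localizations *)

Section LocalizedLengths.
Variables (A : comNzRingType) (q : prime_idealr A) (V : lmodType A).
Implicit Types (N P : set V).

Definition locset N : set (locmod q V) :=
  [set y | exists v (s : denom q), N v /\ y = locfrac v s].

Lemma locfrac_cancel (u : denom q) (v : V) s : locfrac (dval u *: v) (denomM u s) = locfrac v s.
Proof.
apply/eq_locfrac; exists (denom1 q); rewrite !dvalM !scalerA; congr (_ *: _); ring.
Qed.

Lemma loc_scaleE (a : A) (s : denom q) (v : V) t :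
  (locfrac (a : A^o) s : locring q) *: locfrac v t = locfrac (a *: v) (denomM s t).
Proof. exact: loc_actE. Qed.

Lemma submodule_locset N : submodule N -> submodule (locset N).
Proof.
move=> sN; split; first by exists 0, (denom1 q); split=> //; exact: submodule0.
move=> a _ _ [u [s [Nu ->]]] [v [t [Nv ->]]].
have [b [r ->]] := locfracP a; rewrite loc_scaleE locfracD.
exists (dval t *: (b *: u) + dval (denomM r s) *: v), (denomM (denomM r s) t); split=> //.
by apply: submoduleD => //; do ?apply: submoduleZ.
Qed.

Lemma locset_frac N v (s : denom q) : submodule N ->
  locset N (locfrac v s) <-> exists u : denom q, N (dval u *: v).
Proof.
move=> sN; split=> [[w [t [Nw /eq_locfrac[u uE]]]]|[u Nu]].
  exists (denomM u t); rewrite dvalM -scalerA uE.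
  by apply: submoduleZ => //; exact: submoduleZ.
by exists (dval u *: v), (denomM u s); rewrite locfrac_cancel.
Qed.

Lemma locset0 : locset [set 0] = [set 0].
Proof.
apply/seteqP; split=> [_ [v [s [-> ->]]]|_ ->] /=.
  by apply/eq_locfrac; exists (denom1 q); rewrite !scaler0.
by exists 0, (denom1 q).
Qed.

Lemma locsetT : locset setT = setT.
Proof. by apply/seteqP; split=> // y _; have [v [s ->]] := locfracP y; exists v, s. Qed.

Lemma locset_smsum N v (s : denom q) : submodule N ->
  locset (smsum (line v) N) = smsum (line (locfrac v s)) (locset N).
Proof.
move=> sN; have sL := submodule_line v; apply/seteqP; split.
  move=> _ [_ [t [[_ [n [[a _ <-] Nn ->]]] ->]]].
  exists ((locfrac ((dval s * a : A) : A^o) t : locring q) *: locfrac v s), (locfrac n t); split.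
  - by exists (locfrac ((dval s * a : A) : A^o) t : locring q).
  - by exists n, t.
  rewrite loc_scaleE locfracD; apply/eq_locfrac; exists (denom1 q).
  rewrite !dvalM !scalerDr !scalerA.
  congr (_ *: _ + _ *: _); ring.
apply: smsum_lub; first by apply: submodule_locset; exact: submodule_smsum.
  apply: line_sub; first by apply: submodule_locset; exact: submodule_smsum.
  by exists v, s; split=> //; apply: smsumSl => //; exact: line_id.
by move=> _ [n [t [Nn ->]]]; exists n, t; split=> //; exact: smsumSr.
Qed.

(** The quotient is A / p with p = (N : v). Localized at q it becomes the residue field if p = q,
    and 0 if p has an element outside q; the last hypothesis excludes that p lies strictly inside q.
    The length is the boolean test read as 0 or 1. *)
Lemma haslen_locset_cyclic N v : submodule N -> prime_set (colon N v) ->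
  (colon N v `<=` [set a : A^o | a \in q] -> [set a : A^o | a \in q] `<=` colon N v) ->
  haslen (locset N) (locset (smsum (line v) N)) (colon N v == [set a : A^o | a \in q]).
Proof.
move=> sN [sp p1 pM] min; pose s1 := denom1 q.
have sLN := submodule_locset sN.
rewrite (locset_smsum v s1 sN).
have [E|E] := eqVneq (colon N v) [set a : A^o | a \in q].
  have Np a : N (a *: v) <-> a \in q.
    by rewrite -[N _]/(colon N v a) E.
  apply: haslen_simple => // [/(locset_frac _ _ sN)[u /Np]|a].
    by have := svalP u; rewrite -/(dval u) => /negP.
  have [b [t ->]] := locfracP a; rewrite loc_scaleE => Nb.
  have bq : b \notin q.
    apply/negP => /Np Nbv; apply: Nb; exists (b *: v), (denomM t s1); by split.
  pose b' : denom q := exist _ b bq.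
  exists (locfrac (dval t : A^o) b' : locring q).
  rewrite -[_ * _]/(loc_act (locfrac (dval t : A^o) b') (locfrac (b : A^o) t)) loc_actE.
  apply/eq_locfrac; exists s1; rewrite !dvalM -[dval b']/b dval1.
  rewrite -[LHS]/(1 * (1 * (dval t * b)) : A) -[RHS]/(1 * ((b * dval t) * 1) : A); ring.
rewrite (_ : smsum _ _ = locset N); first exact: haslen0.
have [a [pa aq]] : exists a : A, colon N v a /\ a \notin q.
  apply: contrapT => no; case/eqP: E.
  have sub : colon N v `<=` [set a : A^o | a \in q].
    by move=> a pa /=; apply: contrapT => /negP aq; apply: no; exists a.
  by apply/seteqP; split=> //; exact: min.
apply/seteqP; split; last by apply: smsumSr; exact: submodule_line.
apply: smsum_lub => //; apply: line_sub => //.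
by apply/locset_frac => //; exists (exist _ a aq).
Qed.

End LocalizedLengths.
Arguments locset {A} q {V} N.

Lemma prime_set_idealr (A : comNzRingType) (p : set A^o) : prime_set p ->
  exists q : prime_idealr A, p = [set a : A^o | a \in q].
Proof.
move=> [[p0 pD] p1 pM].
pose P : {pred A} := fun a => `[< p a >].
have P1 : idealr_closed P.
  split=> [||a u v /asboolP pu /asboolP pv]; [exact/asboolP|exact/asboolP|].
  exact/asboolP/(pD a).
have P2 : prime_idealr_closed P.
  by move=> a b /asboolP/pM[pa|pb]; apply/orP; [left|right]; apply/asboolP.
pose I : prime_idealr A :=
  HB.pack P (isIdealr.Build A P P1) (isPrimeIdealrClosed.Build A P P2).
exists I; apply/seteqP; split=> a pa; [exact/asboolP|exact/asboolP].
Qed.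

Lemma prime_idealr_set (A : comNzRingType) (q : prime_idealr A) :
  prime_set [set a : A^o | a \in q].
Proof.
split=> [|/=|a b /=]; last 2 first.
- by rewrite idealr1.
- by rewrite prime_idealrM => /orP.
split=> [|a u v /= uq vq]; first exact: idealr0.
by apply: rpredD => //; exact: (idealMr a uq).
Qed.

Section PrimeFiltration.
Variables (A : comNzRingType) (m : idealr A) (d : nat) (x : 'I_d -> A) (F : realType).
Hypothesis accA : acc (setT : set A^o).
Hypothesis local_m : local_ring m.
Hypothesis sop_x : is_sop m x.

(** One filtration serves both purposes: multiplicities add up over its quotients, and at a minimal
    prime q the length of V_q counts the quotients A / q. *)
Lemma prime_filtration (V : lmodType A) (s : seq V) : setT = span s ->
  exists ps : seq (set A^o), [/\ forall p, p \in ps -> prime_set p,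
    has_mult x [set 0] (setT : set V) (\sum_(p <- ps) mult_quot x F p) &
    forall q : prime_idealr A, minimal_prime q ->
      haslen [set (0 : locmod q V)] setT (count_mem [set a : A^o | a \in q] ps)].
Proof.
move=> sE; have s1 := @submodule1 A V.
have aV : acc (setT : set V) by rewrite sE; exact: acc_span.
suff [ps [H1 H2 H3]] : exists ps : seq (set A^o), [/\ forall p, p \in ps -> prime_set p,
    has_mult x [set 0] (setT : set V) (\sum_(p <- ps) mult_quot x F p) &
    forall q : prime_idealr A, minimal_prime q ->
      haslen (locset q [set (0 : V)]) (locset q setT)
        (count_mem [set a : A^o | a \in q] ps)].
  by exists ps; split=> // q /H3; rewrite locset0 locsetT.
apply: (@devissage A V (fun Q => exists ps : seq (set A^o),
   [/\ forall p, p \in ps -> prime_set p,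
    has_mult x [set 0] Q (\sum_(p <- ps) mult_quot x F p) &
    forall q : prime_idealr A, minimal_prime q ->
      haslen (locset q [set (0 : V)]) (locset q Q)
        (count_mem [set a : A^o | a \in q] ps)]) [set 0] setT) => //.
  exists [::]; split=> //; first by rewrite big_nil; exact: has_mult0.
  by move=> q _; apply: haslen0; exact: submodule_locset.
move=> Q v sQ NQ _ [ps [H1 H2 H3]] _ pv.
have sL := submodule_line v.
exists (colon Q v :: ps); split.
- by move=> p; rewrite inE => /orP[/eqP->//|]; exact: H1.
- have [t tE] : exists t, smsum (line v) Q = span t.
    by apply: (acc_fg aV) => //; exact: submodule_smsum.
  rewrite big_cons addrC.
  apply: (has_multD accA local_m sop_x tE s1 sQ) => //; first exact: smsumSr.
  apply: (has_mult_cyclic accA local_m sop_x) => //.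
  by apply: (mult_quotP accA local_m sop_x); have [] := pv.
- move=> q qmin /=; rewrite addnC; apply: haslenD (H3 q qmin) _.
  + exact: submodule_locset.
  + exact: submodule_locset.
  + by apply: submodule_locset; exact: submodule_smsum.
  apply: haslen_locset_cyclic => //.
  have [p pE] := prime_set_idealr pv; rewrite pE => pq a aq.
  by apply: (qmin p) aq => b; exact: pq.
Qed.

End PrimeFiltration.

(** * Krull dimension and the rank formula *)

Section Dimension.
Variable F : realType.

Definition ischain (T : Type) (P : {pred T} -> Prop) k (c : nat -> {pred T}) :=
  (forall i, (i <= k)%N -> P (c i)) /\ (forall i, (i < k)%N -> strict_sub (c i) (c i.+1)).

Lemma chain_supP (T : Type) (P : {pred T} -> Prop) d :
  chain_sup F P = (d%:R)%:E <->
  (exists c, ischain P d c) /\ (forall k c, ischain P k c -> (k <= d)%N).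
Proof.
split=> [E|[[c cP] ub]]; last first.
  apply/eqP; rewrite eq_le; apply/andP; split.
    by apply: ge_ereal_sup => _ [k [c' /ub kd] <-]; rewrite lee_fin ler_nat.
  by apply: ereal_sup_ubound; exists d => //; exists c.
have ub k c : ischain P k c -> (k <= d)%N.
  move=> kc; rewrite -(ler_nat F) -lee_fin -E.
  by apply: ereal_sup_ubound; exists k => //; exists c.
split=> //; apply: contrapT => no.
(* The supremum is attained by integrality: without a chain of d steps it would be at most d - 1. *)
have : (chain_sup F P <= (d%:R - 1)%:E)%E.
  apply: ge_ereal_sup => _ [k [c kc] <-]; rewrite lee_fin lerBrDr natr1 ler_nat.
  rewrite ltn_neqAle (ub _ _ kc) andbT; apply/eqP => kd; apply: no.
  by exists c; rewrite -kd.
by rewrite E lee_fin lerDl oppr_ge0 leNgt ltr01.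
Qed.

Variable A : comNzRingType.

Lemma prime_ideal_set (P : {pred A}) :
  prime_ideal P <-> prime_set [set a : A^o | a \in P].
Proof.
split=> [[[P0 P1 PD] PM]|[[P0 PD] P1 PM]].
  split=> [||a b /=]; [by split=> // a u v; exact: PD|exact/negP|].
  by move/PM/orP.
split; first by split=> [||a u v uP vP]; [exact: P0|exact/negP|exact: (PD a u v)].
by move=> a b /PM[ap|bp]; apply/orP; [left|right].
Qed.

Lemma pchain_ischain k (c : nat -> {pred A}) : ischain (@prime_ideal A) k c ->
  pchain k [set a : A^o | a \in c 0%N].
Proof.
elim: k c => // k IH c [cP cs].
exists [set a : A^o | a \in c 1%N]; have [s1 s2] := cs 0%N isT; split=> //.
  exact/prime_ideal_set/cP.
apply: (IH (fun i => c i.+1)); split=> i ik; [exact: cP|exact: cs].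
Qed.

Lemma ischain_pchain k (p : set A^o) : prime_set p -> pchain k p ->
  exists2 c, ischain (@prime_ideal A) k c & [set a : A^o | a \in c 0%N] = p.
Proof.
elim: k p => [|k IH] p pp; pose P : {pred A} := fun a => `[< p a >];
  have pE : [set a : A^o | a \in P] = p by [apply/seteqP; split=> a H; apply/asboolP].
  by move=> _; exists (fun _ => P) => //; split=> // i _; apply/prime_ideal_set; rewrite pE.
move=> /= [q [qp pq qnp /(IH _ qp)[c [cP cs] c0]]].
exists (fun i => if i is j.+1 then c j else P) => //; split=> [[|i]|[|i]] ik.
- by apply/prime_ideal_set; rewrite pE.
- exact: cP.
- split=> [a /asboolP/pq|H]; first by rewrite -c0.
  by apply: qnp => a; rewrite -c0 => /H /asboolP.
- exact: cs.
Qed.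

Variable d : nat.
Hypothesis dimA : krull_dim F A = (d%:R)%:E.

Lemma pchain_le k (p : set A^o) : prime_set p -> pchain k p -> (k <= d)%N.
Proof.
move=> pp /(ischain_pchain pp)[c cc _]; have /chain_supP[_ ub] := dimA; exact: ub cc.
Qed.

Lemma pchain_minimal (q : prime_idealr A) : pchain d [set a : A^o | a \in q] ->
  minimal_prime q.
Proof.
move=> qd q' q'q; apply: contrapT => qq'.
have : pchain d.+1 [set a : A^o | a \in q'].
  by exists [set a : A^o | a \in q]; split=> //; exact: prime_idealr_set.
by move/(pchain_le (prime_idealr_set q')); rewrite ltnn.
Qed.

(** The primes of a chain above q contain q and so descend to A / q; conversely, preimages turn
    chains of A / q into chains of A, which have at most d steps. *)
Lemma pchain_krull_dim (q : prime_idealr A) : pchain d [set a : A^o | a \in q] ->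
  krull_dim F {ideal_quot q} = krull_dim F A.
Proof.
move=> qd; rewrite dimA; apply/chain_supP; pose pi : {rmorphism A -> {ideal_quot q}} := (\pi_{ideal_quot q})%qT.
have piP (y : {ideal_quot q}) : exists a, y = pi a.
  by exists (repr y); rewrite /pi /= reprK.
have [c [cP cs] c0] := ischain_pchain (prime_idealr_set q) qd.
have qc i : (i <= d)%N -> {subset q <= c i}.
  elim: i => [|i IH] id a aq.
    by have : [set a : A^o | a \in c 0%N] a by rewrite c0.
  by have [s1 _] := cs i id; apply: s1; apply: IH => //; exact: ltnW.
split.
  pose c' i : {pred {ideal_quot q}} := fun y => repr y \in c i.
  have c'E i a : (i <= d)%N -> (pi a \in c' i) = (a \in c i).
    move=> id; have /prime_ideal_set[sc _ _] := cP i id.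
    have : repr (pi a) - a \in q by rewrite Quotient.idealrBE /pi /= reprK.
    move=> /(qc i id) H; apply/idP/idP => aci.
      rewrite -[a](subKr (repr (pi a))).
      by have := @submoduleB A A^o _ (repr (pi a)) _ sc aci H.
    change (repr (pi a) \in c i); rewrite -[repr _](subrK a).
    by have := @submoduleD A A^o _ _ a sc H aci.
  exists c'; split=> i id.
    have [[c0' c1 cD] cM] := cP i id; split; first split.
    + by rewrite -(rmorph0 pi) c'E.
    + by rewrite -(rmorph1 pi) c'E.
    + move=> y u v; have [a ->] := piP y; have [b ->] := piP u; have [e ->] := piP v.
      by rewrite -rmorphM -rmorphD !c'E //; exact: cD.
    + move=> u v; have [b ->] := piP u; have [e ->] := piP v.
      by rewrite -rmorphM !c'E //; exact: cM.
  have [s1 s2] := cs i id; split=> [y|H].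
    by have [a ->] := piP y; rewrite !c'E //; [exact: s1|exact: ltnW].
  by apply: s2 => a; have := H (pi a); rewrite !c'E //; exact: ltnW.
move=> k e [eP es].
have /chain_supP[_ ub] := dimA; apply: (ub k (fun i a => pi a \in e i)).
split=> i ik.
  have [[e0 e1 eD] eM] := eP i ik; split; first split.
  + by rewrite unfold_in rmorph0.
  + by rewrite unfold_in rmorph1.
  + by move=> a u v; rewrite !unfold_in rmorphD rmorphM; exact: eD.
  + by move=> u v; rewrite !unfold_in rmorphM; exact: eM.
have [s1 s2] := es i ik; split=> [a|H]; first by rewrite !unfold_in; exact: s1.
by apply: s2 => y; have [a ->] := piP y; have := H a; rewrite !unfold_in.
Qed.

Lemma mod_dim_prime (V : lmodType A) : mod_dim F V = (d%:R)%:E ->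
  exists q : prime_idealr A, pchain d [set a : A^o | a \in q] /\
    forall a, (forall v : V, a *: v = 0) -> a \in q.
Proof.
move=> /chain_supP[[c [cP cs]] _].
have cc : ischain (@prime_ideal A) d c by split=> // i /cP[].
have [c0 c0V] := cP 0%N (leq0n d).
have /prime_ideal_set/prime_set_idealr[q qE] := c0.
exists q; rewrite -qE; split; first exact: pchain_ischain.
move=> a /c0V ac; by have : [set a : A^o | a \in c 0%N] a by []; rewrite qE.
Qed.

End Dimension.

Lemma sum_count (R : nmodType) (T : eqType) (f : T -> R) (s u : seq T) : uniq u ->
  {subset s <= u} -> \sum_(p <- s) f p = \sum_(p <- u) f p *+ count_mem p s.
Proof.
move=> uu; elim: s => [|a s IH] su.
  by rewrite big_nil big1.
rewrite big_cons IH; last by move=> p ps; apply: su; rewrite inE ps orbT.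
rewrite [RHS](eq_bigr (fun p => f p *+ (a == p) + f p *+ count_mem p s)); last first.
  by move=> p _ /=; rewrite mulrnDr.
rewrite big_split /=; congr (_ + _).
rewrite (big_rem a) /=; last by apply: su; rewrite mem_head.
rewrite eqxx mulr1n big_seq big1 ?addr0 // => p.
by rewrite mem_rem_uniq // inE eq_sym => /andP[/negbTE-> _].
Qed.

Section RankFormula.
Variables (A : comNzRingType) (m : idealr A) (d : nat) (x : 'I_d -> A) (F : realType).
Hypothesis accA : acc (setT : set A^o).
Hypothesis local_m : local_ring m.
Hypothesis sop_x : is_sop m x.
Hypothesis dimA : krull_dim F A = (d%:R)%:E.

Lemma mlength_locring (q : prime_idealr A) k :
  haslen [set (0 : locmod q A^o)] setT k -> mlength F (locring q)^o = (k%:R)%:E.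
Proof. by move=> H; rewrite -(mlength_haslen F H). Qed.

(** The filtrations of V and A are compared over all primes that occur in either. A prime with
    [pchain d] is minimal of full dimension, so the rank condition says that its count for V is r
    times its count for A; every other prime has multiplicity 0. *)
Theorem koszul_chi_rank (V : lmodType A) (s : seq V) (r : F) : setT = span s ->
  has_rank V r -> koszul_chi x F V = r * koszul_chi x F A^o.
Proof.
move=> sE rk; have [t tE] := acc_spanT accA.
have [ps [psP psE psL]] := prime_filtration F accA local_m sop_x sE.
have [qs [qsP qsE qsL]] := prime_filtration F accA local_m sop_x tE.
have uniq_lim (W : lmodType A) e e' : has_mult x [set 0] (setT : set W) e ->
    has_mult x [set 0] (setT : set W) e' -> e = e' :> F.
  by move=> H H'; apply: cvg_unique H H'.
rewrite (uniq_lim _ _ _ (has_mult_koszul accA local_m sop_x sE) psE).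
rewrite (uniq_lim _ _ _ (has_mult_koszul accA local_m sop_x tE) qsE).
have su (l : seq (set A^o)) : {subset l <= ps ++ qs} -> {subset l <= undup (ps ++ qs)}.
  by move=> H p /H; rewrite mem_undup.
rewrite (sum_count _ (undup_uniq (ps ++ qs)) (su ps _)).
  rewrite (sum_count _ (undup_uniq (ps ++ qs)) (su qs _)).
    rewrite mulr_sumr; apply: eq_big_seq => p; rewrite mem_undup mem_cat => pin.
    have pp : prime_set p by case/orP: pin; [exact: psP|exact: qsP].
    have [pd|npd] := pselect (pchain d p); last first.
      by rewrite (mult_quot0 F accA local_m sop_x pp npd) !mul0rn mulr0.
    have [q qE] := prime_set_idealr pp; rewrite qE in pd *.
    have qmin := pchain_minimal dimA pd.
    have := rk q qmin (pchain_krull_dim dimA pd).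
    rewrite (mlength_haslen F (psL q qmin)) (mlength_locring (qsL q qmin)).
    by rewrite -EFinM => E; rewrite -2!(mulr_natl (mult_quot _ _ _)) mulrA -(EFin_inj E).
  by move=> p pq; rewrite mem_cat pq orbT.
by move=> p pq; rewrite mem_cat pq.
Qed.

Lemma mlength_koszul (V : lmodType A) (s : seq V) i : setT = span s -> (i <= d)%N ->
  mlength F (koszul_homology x V i) = ((len (@kbnd A d x V i) (@kcyc A d x V i))%:R)%:E.
Proof.
move=> sE id; apply: mlength_subquot; first exact: koszul_bounds_sub.
by rewrite -kcycE -kbndE; apply: lenP; exact: (finlen_koszul F accA local_m sop_x sE).
Qed.

Lemma koszul_chi_chi1 (V : lmodType A) (s : seq V) : setT = span s ->
  fine (mlength F (koszul_homology x V 0)) = koszul_chi x F V + chi1 F x V.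
Proof.
move=> sE; rewrite (mlength_koszul sE) //= /koszul_chi big_ord_recl /= expr0 mul1r.
rewrite -addrA -[LHS]addr0; congr (_ + _); apply/esym.
rewrite /chi1 big_add1 /= big_mkord -big_split big1 // => i _ /=.
by rewrite (mlength_koszul sE) //= /bump leq0n add1n exprS mulN1r mulNr addNr.
Qed.

Lemma ideal_exp_xpow k :
  [set a | a \in ideal_exp (gen_ideal x) k] = xpow x k (setT : set A^o).
Proof.
elim: k => [|k IH]; first by apply/seteqP.
rewrite /= -IH; apply/seteqP; split=> [a /asboolP[n [b [v [bv ->]]]]|_ [v [Hv ->]]].
  have sI : submodule (xmul x [set a : A^o | a \in ideal_exp (gen_ideal x) k]).
    by apply: submodule_xmul; apply/submod_closed_submodule; exact: submodClosedP.
  apply: submodule_sum => // i _; have [/asboolP[c ->] vi] := bv i.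
  exists (fun j => c j *: v i); split=> [j|]; first exact: rpredZ.
  rewrite scaler_suml; apply: eq_bigr => j _.
  by rewrite !scalerA mulrC.
apply/asboolP; exists d, x, v; split=> // i; split; last exact: Hv.
apply/asboolP; exists (fun j => (i == j)%:R); rewrite (bigD1 i) //= eqxx scale1r.
by rewrite big1 ?addr0 // => j /negbTE ji; rewrite eq_sym ji scale0r.
Qed.

Lemma hs_mult_koszul : hs_mult F d (gen_ideal x) = koszul_chi x F A^o.
Proof.
have [t tE] := acc_spanT accA; apply: cvg_lim => //.
have H := has_mult_koszul accA local_m sop_x tE.
suff E k : mlength F (quotmod (ideal_exp (gen_ideal x) k)) =
    ((hs x [set 0] (setT : set A^o) k)%:R)%:E.
  by under eq_fun do rewrite E; exact: H.
rewrite (@mlength_quotmod F A A^o _ (len (xpow x k (setT : set A^o)) setT)).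
  rewrite /hs; congr ((len _ _)%:R%:E); apply/seteqP; split; first exact: smsumSr (@submodule1 _ _).
  have sX := submodule_xpow x k (@submoduleT A A^o).
  by apply: smsum_lub => // _ ->; exact: submodule0.
by rewrite ideal_exp_xpow; apply: lenP; exact: (finlen_xpow accA local_m sop_x _ tE).
Qed.

End RankFormula.

(** * Minimal numbers of generators *)

Section Nakayama.
Variables (A : comNzRingType) (m : idealr A) (V : lmodType A).
Hypothesis local_m : local_ring m.

Definition maxmul : set V := [set v | v \in ideal_smul m (whole V)].

Lemma submodule_maxmul : submodule maxmul.
Proof. by apply/submod_closed_submodule; exact: ideal_smul_closed. Qed.

Lemma maxmulZ a v : a \in m -> maxmul (a *: v).
Proof.
move=> am; apply/asboolP; exists 1%N, (fun=> a), (fun=> v).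
by rewrite big_ord1; split=> // i; split.
Qed.

Lemma maxmul_sub N : submodule N -> (forall a v, a \in m -> N (a *: v)) -> maxmul `<=` N.
Proof.
move=> sN H v /asboolP[k [a [w [aw ->]]]]; apply: submodule_sum => // i _.
by apply: H; have [] := aw i.
Qed.

(* A maximal proper submodule containing N also contains mV. *)
Lemma nakayama N : acc (setT : set V) -> submodule N -> setT `<=` smsum N maxmul ->
  setT `<=` N.
Proof.
move=> aV sN NV; apply: contrapT => nN.
have [||Q [[sQ NQ nQ] Qmax]] := @acc_max _ _ setT
    [set Q | [/\ submodule Q, N `<=` Q & ~ setT `<=` Q]] aV.
- by exists N; split.
- by move=> Q [].
apply: nQ; apply: subset_trans NV _; apply: smsum_lub => //.
apply: maxmul_sub => // a v am; apply: contrapT => Qav.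
have sL := submodule_line (a *: v).
have [TQ|TQ] := pselect (setT `<=` smsum (line (a *: v)) Q); last first.
  apply: Qav; apply: (Qmax (smsum (line (a *: v)) Q)).
  - split=> //; first exact: submodule_smsum.
    exact: subset_trans NQ (smsumSr sL).
  - exact: smsumSr.
  - by apply: smsumSl => //; exact: line_id.
have [_ [n [[b _ <-] Qn vE]]] := TQ v I.
(* From v = b a v + n, the element (1 - b a) v lies in Q, and 1 - b a is a unit because a is in
   m. *)
have [|c cE] := local_unit local_m (a := 1 - b * a).
  apply/negP => H; have := idealr1 m; rewrite -(subrK (b * a) 1).
  by rewrite rpredD // idealMr.
apply: Qav; apply: submoduleZ => //; rewrite -[v]scale1r -cE -scalerA.
by apply: submoduleZ => //; rewrite scalerBl scale1r {1}vE scalerA addrC addKr.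
Qed.

End Nakayama.

Section MinimalGenerators.
Variables (A : comNzRingType) (m : idealr A) (V : lmodType A).
Hypothesis local_m : local_ring m.
Local Notation mV := (@maxmul A m V).
Local Notation pi := (\pi_{ideal_quot m})%qT.

Lemma eq_fibre_maxmul (u v : V) : fibre_pi m u = fibre_pi m v <-> mV (u - v).
Proof. by rewrite /maxmul /= -eq_fibre; split=> /eqP. Qed.

Lemma fibre_pi_sum k (a : 'I_k -> A) (v : 'I_k -> V) :
  fibre_pi m (\sum_i a i *: v i) = \sum_i (pi (a i) : {ideal_quot m}) *: fibre_pi m (v i).
Proof.
have -> : fibre_pi m (\sum_i a i *: v i) = \sum_i fibre_pi m (a i *: v i).
  exact: (raddf_sum (quotmod_pi (ideal_smul m (whole V)))).
by apply: eq_bigr => i _; rewrite -fibre_scaleE.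
Qed.

Definition gens_mod k := exists v : 'I_k -> V, forall u : V, exists a : 'I_k -> A,
  mV (u - \sum_i a i *: v i).

(** A relation modulo mV with a unit coefficient at j expresses the j-th generator by the others. *)
Lemma gens_mod_relation k (v : 'I_k.+1 -> V) (a : 'I_k.+1 -> A) j :
  (forall u : V, exists a : 'I_k.+1 -> A, mV (u - \sum_i a i *: v i)) ->
  mV (\sum_i a i *: v i) -> a j \notin m -> gens_mod k.
Proof.
have sM := submodule_maxmul m V.
move=> vg va /(local_unit local_m)[b ba]; exists (fun i => v (lift j i)) => u.
have [c uc] := vg u.
exists (fun i => c (lift j i) - c j * b * a (lift j i)).
have := submoduleD sM uc (submoduleZ (c j * b) sM va).
rewrite (bigD1_ord j) //= (bigD1_ord (F := fun i => a i *: v i) j) //=.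
rewrite scalerDr scalerA -[c j * b * a j]mulrA ba mulr1.
rewrite scaler_sumr opprD !addrA -addrA; set X := \sum_i c _ *: _.
rewrite (_ : u - c j *: v j - X + (c j *: v j + _) =
  u - (X - \sum_i (c j * b) *: (a (lift j i) *: v (lift j i)))).
  rewrite {}/X -sumrB; congr (mV (_ - _)); apply: eq_bigr => i _.
  by rewrite scalerBl scalerA.
set Y := \sum_i _; set w := c j *: v j.
by rewrite addrACA subrK opprB [Y - X]addrC.
Qed.

(** A family of least size generating V modulo mV is a basis of the fibre: two coordinate vectors of
    one element that differ somewhere give a relation with a coefficient outside m, which removes a
    generator. *)
Lemma exists_basis_fibre (s : seq V) : setT = span s ->
  exists k (w : 'I_k -> fibre m V), is_basis w.
Proof.
move=> sE.
have ex : exists k, `[< gens_mod k >].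
  exists (size s); apply/asboolP; exists (fun i => s`_i) => u.
  have : span s u by rewrite -sE.
  (* With exponent 0 the lemma only reads off coefficients on s, so the empty family of ring
     elements serves. *)
  move=> /(xpow_comb (x := fun i : 'I_0 => 0 : A) (n := 0))[a [_ ->]].
  by exists (fun i => a i); rewrite subrr; exact: submodule0 (submodule_maxmul m V).
case: (ex_minnP ex) => k /asboolP[v vg] kmin.
exists k, (fun i => fibre_pi m (v i)) => y.
have [u ->] := fibre_piP y; have [a ua] := vg u.
have E : fibre_pi m u = \sum_i (pi (a i) : {ideal_quot m}) *: fibre_pi m (v i).
  by rewrite -fibre_pi_sum; exact/eq_fibre_maxmul.
exists [ffun i => pi (a i)]; split=> [|c cE].
  by rewrite E; apply: eq_bigr => i _; rewrite ffunE.
apply/ffunP => j; rewrite ffunE; apply/eqP; rewrite -[c j]reprK -Quotient.idealrBE.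
apply: contrapT => /negP am.
have va : mV (\sum_i (a i - repr (c i)) *: v i).
  rewrite -[\sum_i _]subr0; apply/eq_fibre_maxmul.
  rewrite fibre_pi_sum; under eq_bigr => i _ do rewrite rmorphB scalerBl /= reprK.
  rewrite sumrB -E cE subrr.
  exact: esym (raddf0 (quotmod_pi (ideal_smul m (whole V)))).
clear E cE ua; case: k v vg kmin c a j am va => [v _ _ _ _ []//|k v vg kmin c a j am va].
have := kmin k; rewrite ltnn => H; have /H // : `[< gens_mod k >].
by apply/asboolP; exact: gens_mod_relation vg va am.
Qed.

(** The generators bound lengths of localizations from above by nu; the chain from mV to V bounds
    the length of H_0 from below by nu. *)
Lemma nu_gens (s : seq V) : acc (setT : set A^o) -> setT = span s ->
  exists v : seq V, [/\ size v = nu m V, setT = span v & ch (nu m V) mV setT].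
Proof.
move=> aA sE; have sM := submodule_maxmul m V.
have [w wb] : exists w : 'I_(nu m V) -> fibre m V, is_basis w.
  have [k [w wb]] := exists_basis_fibre sE.
  exact: (@xgetPex _ 0%N [set k | exists w : 'I_k -> fibre m V, is_basis w] (ex_intro _ k (ex_intro _ w wb))).
move: (nu m V) w wb => k w wb.
have /choice[v vE] : forall i, exists v, w i = fibre_pi m v by move=> i; exact: fibre_piP.
have aV : acc (setT : set V).
  by rewrite sE; exact: acc_span.
have pi_inj (c c' : 'I_k -> A) : mV (\sum_i c i *: v i - \sum_i c' i *: v i) ->
    forall i, pi (c i) = pi (c' i) :> {ideal_quot m}.
  move/eq_fibre_maxmul; rewrite !fibre_pi_sum => E i.
  have [e [_ eU]] := wb (\sum_i (pi (c i) : {ideal_quot m}) *: w i).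
  have e1 : e = [ffun i => pi (c i)].
    by apply: eU; apply: eq_bigr => j _; rewrite ffunE.
  have e2 : e = [ffun i => pi (c' i)].
    apply: eU; transitivity (\sum_i (pi (c i) : {ideal_quot m}) *: fibre_pi m (v i)).
      by apply: eq_bigr => j _; rewrite vE.
    by rewrite E; apply: eq_bigr => j _; rewrite ffunE vE.
  by have := congr1 (fun f : {ffun 'I_k -> {ideal_quot m}} => f i) (etrans (esym e1) e2); rewrite !ffunE.
exists [seq v i | i : 'I_k]; split; first by rewrite size_map size_enum_ord.
  apply/seteqP; split=> //.
  apply: (nakayama local_m aV); first exact: submodule_span.
  move=> u _; have [c [cE _]] := wb (fibre_pi m u).
  exists (\sum_i repr (c i) *: v i), (u - \sum_i repr (c i) *: v i); split.
  - apply: submodule_sum => [|i _]; first exact: submodule_span.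
    apply: submoduleZ; first exact: submodule_span.
    by apply: mem_span; apply: map_f; rewrite mem_enum.
  - apply/eq_fibre_maxmul; rewrite fibre_pi_sum cE.
    by apply: eq_bigr => i _; rewrite reprK vE.
  - by rewrite addrC subrK.
(* mV together with the first j generators. Each step is strict since coordinates in the basis [w]
   are unique and 1 is not in m. *)
pose N j : set V := [set u | exists c : 'I_k -> A,
  (forall i : 'I_k, (j <= i)%N -> c i = 0) /\ mV (u - \sum_i c i *: v i)].
have sN j : submodule (N j).
  split=> [|a u u' [c [c0 uc]] [c' [c0' uc']]].
    exists (fun=> 0); split=> //; rewrite sub0r.
    by rewrite big1 ?oppr0 => [|i _]; [exact: submodule0|rewrite scale0r].
  exists (fun i => a * c i + c' i); split=> [i ji|]; first by rewrite c0 // c0' // mulr0 addr0.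
  have := sM.2 a _ _ uc uc'; rewrite scalerBr addrACA -opprD scaler_sumr -big_split /=.
  by under eq_bigr => i _ do rewrite scalerA -scalerDl.
suff H j : (j <= k)%N -> ch j mV (N j) by apply: ch_top (H k (leqnn k)).
elim: j => [_|j IH jk].
  move=> u Mu; exists (fun=> 0); split=> //.
  by rewrite big1 ?subr0 // => i _; rewrite scale0r.
exists (N j); split=> //.
- exact/IH/ltnW.
- by move=> u [c [c0 uc]]; exists c; split=> // i ij; apply: c0; exact: ltnW.
pose i0 := Ordinal jk; pose c0 (i : 'I_k) : A := (i == i0)%:R.
have vc0 : \sum_i c0 i *: v i = v i0.
  rewrite (bigD1 i0) //= /c0 eqxx scale1r big1 ?addr0 // => i /negbTE ->.
  exact: scale0r.
move=> /(_ (v i0))[|c [cj]].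
  exists c0; rewrite vc0 subrr; split; last exact: submodule0.
  by move=> i ji; rewrite /c0; case: eqP => // ii; rewrite ii ltnn in ji.
rewrite -{1}vc0 => /pi_inj /(_ i0); rewrite /c0 eqxx cj // => /eqP.
by rewrite -Quotient.idealrBE subr0 idealr1.
Qed.

End MinimalGenerators.

(** * Comparison of rank, nu and the length of H_0 *)

(** Each generator adds a cyclic quotient, hence a quotient of B, of length at most l. *)
Lemma haslen_generators (B : comNzRingType) (W : lmodType B) (s : seq W) l :
  haslen [set (0 : B^o)] setT l ->
  exists2 k, (k <= size s * l)%N & haslen [set 0] (span s) k.
Proof.
move=> Hl; elim: s => [|v s [k kl Hk]] /=.
  by exists 0%N => //; apply: haslen0; exact: submodule1.
have sS := submodule_span s.
have [j jl /(haslen_cyclic _ _ sS) Hj] : exists2 j, (j <= l)%N &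
    haslen (colon (span s) v) setT j.
  apply: haslen_sub Hl _ _ _ => // _ ->; exact: (submodule0 (submodule_colon v sS)).
exists (k + j)%N; first by rewrite mulSn addnC leq_add.
apply: haslenD Hk Hj => //; first exact: submodule1.
by apply: submodule_smsum => //; exact: submodule_line.
Qed.

(** With t = nu / r, dividing nu <= r e + c by r gives t <= e + (c / nu) t, so t <= 2 e once c / nu
    is at most 1/2 in absolute value. Then c / r = (c / nu) t tends to 0. *)
Lemma ratio_cvg (F : realType) (h c nu r : nat -> F) (e : F) :
  (forall n, 0 < r n) -> (forall n, r n <= nu n) -> (forall n, nu n <= h n) ->
  (forall n, h n = r n * e + c n) -> (fun n => c n / nu n) @ \oo --> (0 : F) ->
  (fun n => h n / r n) @ \oo --> e.
Proof.
move=> r0 rnu nuh hE c0.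
have nu0 n : 0 < nu n by exact: lt_le_trans (r0 n) (rnu n).
have lim0 : (fun n => `|c n / nu n| * (2 * e)) @ \oo --> (0 : F).
  by rewrite -(mul0r (2 * e)); apply: cvgMr_tmp; apply/norm_cvg0P.
have cr0 : (fun n => `|c n / r n|) @ \oo --> (0 : F).
  apply: (squeeze_cvgr _ (cvg_cst (0 : F)) lim0); near=> n; rewrite normr_ge0 /=.
  have small : `|c n / nu n| <= 2^-1.
    by near: n; apply: (cvgr0_norm_le _ c0); rewrite invr_gt0 ltr0n.
  have te : nu n / r n <= 2 * e.
    have : nu n / r n <= e + 2^-1 * (nu n / r n).
      apply: le_trans (ler_wpM2r _ (nuh n)) _; first by rewrite invr_ge0 ltW.
      have -> : h n / r n = e + (c n / nu n) * (nu n / r n).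
        by rewrite hE mulrA divfK ?gt_eqF // mulrDl mulrAC divff ?gt_eqF ?mul1r.
      rewrite lerD2l; apply: ler_wpM2r; first by rewrite divr_ge0 ?ltW.
      exact: le_trans (ler_norm _) small.
    set t := nu n / r n; lra.
  have -> : c n / r n = (c n / nu n) * (nu n / r n) by rewrite mulrA divfK ?gt_eqF.
  rewrite normrM; apply: ler_wpM2l => //.
  by rewrite ger0_norm // divr_ge0 ?ltW.
have -> : (fun n => h n / r n) = (fun n => e + c n / r n).
  by apply/funext => n; rewrite hE mulrDl mulrAC divff ?gt_eqF ?mul1r.
rewrite -[X in _ --> X]addr0; apply: cvgD; first exact: cvg_cst.
exact/norm_cvg0P.
Unshelve. all: by end_near.
Qed.

Section RankBounds.
Variables (A : comNzRingType) (m : idealr A) (d : nat) (F : realType).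
Hypothesis accA : acc (setT : set A^o).
Hypothesis local_m : local_ring m.
Hypothesis dimA : krull_dim F A = (d%:R)%:E.
Variables (V : lmodType A) (s : seq V).
Hypothesis sE : setT = span s.

Lemma finlen_locmod (W : lmodType A) (t : seq W) (q : prime_idealr A) : setT = span t ->
  minimal_prime q -> finlen [set (0 : locmod q W)] setT.
Proof.
move=> tE qmin; rewrite -(locset0 q W) -(locsetT q W).
have s0 := @submodule1 A W.
apply: (@devissage A W (fun Q => finlen (locset q [set (0 : W)]) (locset q Q)) [set 0] setT) => //.
- by rewrite tE; exact: acc_span.
- by exists 0%N; apply: haslen0; exact: submodule_locset.
move=> Q v sQ _ _ fQ _ pv; apply: finlen_trans fQ _.
- exact: submodule_locset.
- exact: submodule_locset.
- by apply: submodule_locset; apply: submodule_smsum => //; exact: submodule_line.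
eexists; apply: haslen_locset_cyclic => //.
have [p pE] := prime_set_idealr pv; rewrite pE => pq a aq.
by apply: (qmin p) aq => b; exact: pq.
Qed.

Lemma locset_span (q : prime_idealr A) (t : seq V) :
  locset q (span t) = span [seq locfrac v (denom1 q) | v <- t].
Proof.
elim: t => [|v t IH] /=; first exact: locset0.
by rewrite (locset_smsum v (denom1 q)) ?IH //; exact: submodule_span.
Qed.

(** If V_q were 0, every generator would be killed by some denominator, and the product of these
    denominators would annihilate V without lying in q. *)
Lemma locmod_neq0 (q : prime_idealr A) : (forall a, (forall v : V, a *: v = 0) -> a \in q) ->
  ~ (setT : set (locmod q V)) `<=` [set 0].
Proof.
move=> ann H.
have : exists u : denom q, forall v, v \in s -> dval u *: v = 0.
  elim: s => [|v t [u uP]]; first by exists (denom1 q).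
  have /eq_locfrac[w] : locfrac v (denom1 q) = locfrac 0 (denom1 q) by apply: H.
  rewrite !scaler0 !dval1 !scale1r => wv; exists (denomM u w) => z; rewrite dvalM inE.
  move=> /orP[/eqP ->|/uP uz]; first by rewrite -scalerA wv scaler0.
  by rewrite mulrC -scalerA uz scaler0.
move=> [u uP]; have := svalP u; apply/negP/negPn; apply: ann => v.
have : span s v by rewrite -sE.
suff K : submodule [set v : V | dval u *: v = 0] by apply: (span_sub K).
split=> [|a y z /= y0 z0]; rewrite /= ?scaler0 //.
by rewrite scalerDr scalerA mulrC -scalerA y0 z0 scaler0 addr0.
Qed.

(** At a prime q of full dimension containing Ann V, let a and l be the lengths of V_q and A_q, so
    that a = r l. V_q is not 0, hence a > 0; and V_q has nu generators, hence a <= nu l. *)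
Lemma rank_bounds (r : F) : mod_dim F V = (d%:R)%:E -> has_rank V r ->
  0 < r /\ r <= (nu m V)%:R.
Proof.
move=> dimV rk; have [q [qd qann]] := mod_dim_prime dimV.
have qmin := pchain_minimal dimA qd.
have [t tE] := acc_spanT accA.
have [a Ha] := finlen_locmod sE qmin.
have [l Hl] := finlen_locmod tE qmin.
have := rk q qmin (pchain_krull_dim dimA qd).
rewrite (mlength_haslen F Ha) (mlength_locring F Hl) -EFinM => E.
have {E} aE := EFin_inj E.
have a0 : (0 < a)%N.
  have [_] := Ha; apply => /=; exists [set 0]; split=> //; first exact: submodule1.
  exact: locmod_neq0.
have [v [vs vE _]] := nu_gens local_m accA sE.
have al : (a <= nu m V * l)%N.
  have [k kl Hk] := haslen_generators [seq locfrac w (denom1 q) | w <- v]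
     (Hl : haslen [set (0 : (locring q)^o)] setT l).
  rewrite size_map vs -locset_span -vE locsetT in kl Hk.
  by rewrite (haslen_inj Ha Hk).
have l0 : (0 < l)%N by rewrite lt0n; apply: contraTneq al => ->; rewrite muln0 -ltnNge.
have l0' : (0 : F) < l%:R by rewrite ltr0n.
split.
  by rewrite -(pmulr_lgt0 _ l0') -aE ltr0n.
by rewrite -(ler_pM2r l0') -aE -natrM ler_nat.
Qed.

End RankBounds.

(** H_0 is V / (x)V, read off at the coordinate of the empty set. As (x)V lies in mV, the chain of
    nu steps from mV to V is a chain above (x)V. *)
Lemma nu_le_koszul0 (A : comNzRingType) (m : idealr A) (d : nat) (x : 'I_d -> A)
    (V : lmodType A) (s : seq V) :
  acc (setT : set A^o) -> local_ring m -> is_sop m x -> setT = span s ->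
  finlen (@kbnd A d x V 0) (@kcyc A d x V 0) ->
  (nu m V <= len (@kbnd A d x V 0) (@kcyc A d x V 0))%N.
Proof.
move=> aA local_m sop_x sE /lenP H.
have [v [_ _ ch_nu]] := nu_gens local_m aA sE.
pose g := @kcoord A d V finset.set0.
have sT := @submoduleT A V.
have ker f : kcyc x 0 f -> g f = 0 -> kbnd x 0 f.
  rewrite kcyc0 => Hf f0; rewrite (_ : f = 0); first exact: submodule0 (submodule_kbnd x V 0).
  apply/ffunP => J; rewrite ffunE; have := Hf J; case: ifP => // /eqP/cards0_eq -> _.
  exact: f0.
have [+ _] := haslen_image (g := @kcoord A d V finset.set0)
  (len (@kbnd A d x V 0) (@kcyc A d x V 0)) (submodule_kbnd x V 0) (submodule_kcyc x V 0)
  (@kbnd_sub A d x V 0) ker.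
move=> /(_ H)[_]; apply.
have -> : g @` kcyc x 0 = setT.
  apply/seteqP; split=> // w _; exists (ksingle finset.set0 w); last first.
    by rewrite /g /kcoord ffunE eqxx.
  rewrite kcyc0 => J; rewrite ffunE; case: ifP => // J0.
  by case: eqP => // JE; rewrite JE cards0 in J0.
apply: ch_bot ch_nu => _ [_ [f Hf <-] <-].
have := koszul_diff_kpart x sT Hf finset.set0; rewrite cards0 eqxx => -[w [_ E]].
change (@maxmul A m V (koszul_diff x f finset.set0)); rewrite E.
apply: submodule_sum => [|i _]; first exact: submodule_maxmul.
by apply: maxmulZ; exact: sop_x.1.
Qed.

Theorem lemma4p16 (F : realType) (R : comNzRingType) (m : idealr R) (d : nat)
    (R_noeth : noetherian R) (R_local : local_ring m)
    (R_dim : krull_dim F R = (d%:R)%:E)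
    (M : nat -> lmodType R) (M_limCM : weakly_lim_CM F m d M)
    (rank : nat -> F) (M_rank : forall n, has_rank (M n) (rank n)) :
  (forall n, rank n != 0) /\
  (forall x : 'I_d -> R, is_sop m x ->
    (fun n => fine (mlength F (koszul_homology x (M n) 0)) / rank n) @ \oo -->
      hs_mult F d (gen_ideal x)) /\
  (forall x : 'I_d -> R, is_sop m x ->
    exists C : F, 0 < C /\ forall n,
      1 <= (nu m (M n))%:R / rank n /\
      (nu m (M n))%:R / rank n <=
        fine (mlength F (koszul_homology x (M n) 0)) / rank n /\
      fine (mlength F (koszul_homology x (M n) 0)) / rank n <= C).
Proof.
have [M_dim M_lim] := M_limCM; have aR := noetherian_acc R_noeth.
have M_fg n : exists s : seq (M n), setT = span s.
  have [/fin_gen_span[s sE] _] := M_dim n; exists s; rewrite -sE.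
  by apply/seteqP.
have rk n : 0 < rank n /\ rank n <= (nu m (M n))%:R.
  have [s sE] := M_fg n.
  exact: (rank_bounds aR R_local R_dim sE (M_dim n).2 (M_rank n)).
have rk0 n : 0 < rank n by have [] := rk n.
have nuH (x : 'I_d -> R) n : is_sop m x ->
    (nu m (M n))%:R <= fine (mlength F (koszul_homology x (M n) 0)).
  move=> sop_x; have [s sE] := M_fg n.
  rewrite (mlength_koszul F aR R_local sop_x sE) //= ler_nat.
  apply: (nu_le_koszul0 aR R_local sop_x sE).
  exact: (finlen_koszul F aR R_local sop_x sE).
have lim (x : 'I_d -> R) : is_sop m x ->
    (fun n => fine (mlength F (koszul_homology x (M n) 0)) / rank n) @ \oo -->
      hs_mult F d (gen_ideal x).
  move=> sop_x; rewrite (hs_mult_koszul F aR R_local sop_x).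
  apply: ratio_cvg rk0 (fun n => (rk n).2) (fun n => nuH x n sop_x) _ (M_lim x sop_x) => n.
  have [s sE] := M_fg n.
  rewrite (koszul_chi_chi1 F aR R_local sop_x sE).
  by rewrite (koszul_chi_rank aR R_local sop_x R_dim sE (M_rank n)).
split; first by move=> n; rewrite gt_eqF.
split=> // x sop_x.
(* A convergent sequence is bounded for all indices, not only for large ones. *)
have [C HC] := cvg_has_ub (cvgP _ (lim x sop_x)).
pose u n := fine (mlength F (koszul_homology x (M n) 0)) / rank n.
have uC n : u n <= C.
  by apply: le_trans (ler_norm _) _; apply: HC; exists n.
have nu1 n : 1 <= (nu m (M n))%:R / rank n by rewrite ler_pdivlMr // mul1r (rk n).2.
have nuu n : (nu m (M n))%:R / rank n <= u n.
  by apply: ler_wpM2r; [rewrite invr_ge0 ltW|exact: nuH].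
exists C; split=> [|n]; last by split; [exact: nu1|split; [exact: nuu|exact: uC]].
(* C is positive because it dominates 1 already at n = 0. *)
exact: lt_le_trans ltr01 (le_trans (nu1 0%N) (le_trans (nuu 0%N) (uC 0%N))).
Qed.
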